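(* Let $\mathfrak g$ be a root reductive direct limit Lie algebra with Cartan subalgebra $\mathfrak h$ and roots $\Delta$, and let $M$ be an irreducible weight $\mathfrak g$-module. Then the shadow of $M$ is well-defined: for every $\alpha\in\Delta$, the set $m^\lambda_\alpha:=\{q\in\mathbb R:\lambda+q\alpha\in\operatorname{supp}M\}$ is bounded from above either for all $\lambda\in\operatorname{supp}M$ or for no $\lambda\in\operatorname{supp}M$, and likewise it is bounded from below either for all $\lambda\in\operatorname{supp}M$ or for no $\lambda\in\operatorname{supp}M$.
   Context: All Lie algebras are over $\mathbb C$. A root reductive direct limit Lie algebra is a nonzero Lie algebra $\mathfrak g=\varinjlim\mathfrak g_n$ of a direct system $\mathfrak g_1\to\mathfrak g_2\to\cdots$ of finite-dimensional reductive Lie algebras with fixed Cartan subalgebras $\mathfrak h_n$, whose maps are root homomorphisms (they map $\mathfrak h_n$ into $\mathfrak h_{n+1}$ and each root space of $\mathfrak g_n$ into a root space of $\mathfrak g_{n+1}$). Then $\mathfrak h=\varinjlim\mathfrak h_n$ is a Cartan subalgebra (self-normalizing nilpotent subalgebra) of $\mathfrak g$ and $\mathfrak g=\mathfrak h\oplus\bigoplus_{\alpha\in\Delta}\mathfrak g^\alpha$ with $\Delta=\varinjlim\Delta_n$. A weight $\mathfrak g$-module is a module $M=\bigoplus_{\lambda\in\mathfrak h^*}M^\lambda$, $M^\lambda=\{m:hm=\lambda(h)m\ \forall h\in\mathfrak h\}$; $\operatorname{supp}M=\{\lambda:M^\lambda\ne0\}$. *)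

(* Defs.v *)
From HB Require Import structures.
From mathcomp Require Import all_boot all_order all_algebra.
From mathcomp Require Import reals complex.
Set Implicit Arguments. Unset Strict Implicit. Unset Printing Implicit Defensive.
Import Order.TTheory GRing.Theory Num.Theory.
Local Open Scope ring_scope.

Notation Cplx R := (complex (Real.sort R)).

Section LieDefs.
Variable K : fieldType.

Definition is_lie_bracket (g : lmodType K) (br : g -> g -> g) : Prop :=
  [/\ forall (a : K) x y z, br (a *: x + y) z = a *: br x z + br y z,
      forall (a : K) x y z, br x (a *: y + z) = a *: br x y + br x z,
      forall x, br x x = 0 &
      forall x y z, br x (br y z) + br y (br z x) + br z (br x y) = 0].

Variables (g : lmodType K) (br : g -> g -> g).

Definition subspace (S : g -> Prop) : Prop :=
  S 0 /\ forall (a : K) x y, S x -> S y -> S (a *: x + y).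

Definition subalgebra (S : g -> Prop) : Prop :=
  subspace S /\ forall x y, S x -> S y -> S (br x y).

Definition findim (L : g -> Prop) : Prop :=
  exists (n : nat) (e : 'I_n -> g), (forall i, L (e i)) /\
    forall x, L x -> exists c : 'I_n -> K, x = \sum_(i < n) c i *: e i.

Definition ideal_of (L I : g -> Prop) : Prop :=
  subspace I /\ (forall x, I x -> L x) /\
  forall x y, L x -> I y -> I (br x y).

(* finite-dimensional reductive Lie algebra: the adjoint representation is
   completely reducible, i.e. every ideal (= ad-submodule) has a
   complementary ideal. *)
Definition reductive (L : g -> Prop) : Prop :=
  subalgebra L /\ findim L /\
  forall I, ideal_of L I ->
    exists J, ideal_of L J /\ (forall x, I x -> J x -> x = 0) /\
      (forall x, L x -> exists y z, I y /\ J z /\ x = y + z).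

(* nilpotent subalgebra: some iterated bracket [x1,[x2,...,[xn,y]]] of
   elements of H vanishes identically (lower central series terminates) *)
Definition nilpotent (H : g -> Prop) : Prop :=
  exists n : nat, forall (x : 'I_n -> g) (y : g),
    (forall i, H (x i)) -> H y ->
    \big[(fun a b => br a b) / y]_(i < n) x i = 0.

Definition cartan_of (L H : g -> Prop) : Prop :=
  subalgebra H /\ (forall x, H x -> L x) /\ nilpotent H /\
  forall x, L x -> (forall h, H h -> H (br x h)) -> H x.

(* root space of (L, H) for the functional alpha (only its values on H
   matter) and roots *)
Definition root_space (L H : g -> Prop) (alpha : g -> K) : g -> Prop :=
  fun x => L x /\ forall h, H h -> br h x = alpha h *: x.

Definition is_root (L H : g -> Prop) (alpha : g -> K) : Prop :=
  (exists h, H h /\ alpha h != 0) /\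
  (exists x, x != 0 /\ root_space L H alpha x).

(* Root reductive direct limit Lie algebra, presented as the union of the
   images g_n of the direct system: an increasing exhausting chain of
   finite-dimensional reductive subalgebras Ls n with Cartan subalgebras
   Hs n, Hs n contained in Hs n.+1, the inclusions being root homomorphisms;
   g is nonzero.  Its Cartan subalgebra is h = union of the Hs n. *)
Definition root_reductive_limit (Ls Hs : nat -> g -> Prop) : Prop :=
  (exists x : g, x != 0) /\
  (forall n, reductive (Ls n)) /\
  (forall n, cartan_of (Ls n) (Hs n)) /\
  (forall n x, Ls n x -> Ls n.+1 x) /\
  (forall x, exists n, Ls n x) /\
  (forall n x, Hs n x -> Hs n.+1 x) /\
  (forall n alpha, is_root (Ls n) (Hs n) alpha ->
     exists beta, is_root (Ls n.+1) (Hs n.+1) beta /\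
       forall x, root_space (Ls n) (Hs n) alpha x ->
                 root_space (Ls n.+1) (Hs n.+1) beta x).

Definition limit_cartan (Hs : nat -> g -> Prop) : g -> Prop :=
  fun x => exists n, Hs n x.

Variables (V : lmodType K) (act : g -> V -> V).

Definition is_rep : Prop :=
  [/\ forall (a : K) x y v, act (a *: x + y) v = a *: act x v + act y v,
      forall (a : K) x v w, act x (a *: v + w) = a *: act x v + act x w &
      forall x y v, act (br x y) v = act x (act y v) - act y (act x v)].

Definition weight_space (h : g -> Prop) (lam : g -> K) : V -> Prop :=
  fun v => forall x, h x -> act x v = lam x *: v.

Definition supp (h : g -> Prop) (lam : g -> K) : Prop :=
  exists v, v != 0 /\ weight_space h lam v.

Definition weight_module (h : g -> Prop) : Prop :=
  forall v : V, exists (n : nat) (lam : 'I_n -> g -> K) (w : 'I_n -> V),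
    (forall i, weight_space h (lam i) (w i)) /\ v = \sum_(i < n) w i.

Definition submodule (S : V -> Prop) : Prop :=
  S 0 /\ (forall (a : K) v w, S v -> S w -> S (a *: v + w)) /\
  forall x v, S v -> S (act x v).

Definition irreducible : Prop :=
  (exists v : V, v != 0) /\
  forall S, submodule S -> (forall v, S v -> v = 0) \/ (forall v, S v).

End LieDefs.

Definition shadow_set (R : realType) (g : lmodType (Cplx R)) (V : lmodType (Cplx R))
  (act : g -> V -> V) (h : g -> Prop) (lam alpha : g -> Cplx R) : R -> Prop :=
  fun q => supp act h (fun x => lam x + (q%:C)%C * alpha x).

Definition bdd_above (R : realType) (A : R -> Prop) : Prop :=
  exists b : R, forall q, A q -> q <= b.
Definition bdd_below (R : realType) (A : R -> Prop) : Prop :=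
  exists b : R, forall q, A q -> b <= q.

(* Main.v *)
(* Irreducibility joins any two weights of the support by a word of root
   vectors with nonzero product, so it is enough to compare the shadows at [lam]
   and at [lam + xi], where a root vector of weight [xi] does not kill the
   weight space.  Suppose [lam + xi + q alpha] is a weight.  A word from [lam]
   to it can be reordered and shortened (each commutator is a shorter word)
   until what remains is a point [lam + j alpha] of the support and a list [T]
   of roots no part of which sums to a multiple of [alpha], with
   [- xi + sum T = (q - j) alpha].  Modulo [alpha], the list [- xi, T] is a
   minimal zero-sum sequence of roots; the sum of such a sequence is [d alpha]
   with [d] bounded by a constant depending only on [alpha].  So the bound at
   [lam] moves by at most that constant.

   The bound on [d] is Euclidean: only the roots that do not act by zero on the
   module matter, finitely many of them at a time embed in a Euclidean space by
   the trace form of a reductive level of the limit, and merging roots at obtuse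
   angles makes the sequence pairwise acute.  If finitely many roots make an
   acute angle with [alpha], partial sums of the sequence run through finitely
   many roots modulo [alpha].  If there are infinitely many, the mean of many
   roots in general position is almost an integral vector of norm 1, against
   which each root takes very few values, and [d <= 2]. *)
Require Import Defs.
From mathcomp Require Import all_boot all_order all_algebra.
From mathcomp Require Import reals complex.
From mathcomp Require Import ring lra zify boolp functions mxred.
Set Implicit Arguments. Unset Strict Implicit. Unset Printing Implicit Defensive.
Import Order.TTheory GRing.Theory Num.Theory.
Local Open Scope ring_scope.

(** * Minimal zero-sum sequences of roots modulo a line *)

(** The bound must depend neither on the rank nor on the length of the sequence, both unbounded in
    the limit, so no finite root system can carry the whole argument. The data independent of the
    chosen level are the Cartan numbers, which is why they, and not a form on the weights, make up
    the abstract root datum. The model behind the infinite case is a coordinate system of a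
    classical root system: roots with mutual Cartan number 1 look like e_0 - e_i, and alpha is e_0,
    2 e_0 or e_0 + y with y orthogonal to e_0. The value 2 is attained, by (e_0 + e_1) + (e_0 - e_1)
    = 2 e_0 in type B and by 2 e_0 + 2 e_1 = 2 (e_0 + e_1) in type C. Estimates become equalities
    because the squared norms in question are half-integers. On the algebra side, reductivity is
    given as complete reducibility of the adjoint action and a Cartan subalgebra as a
    self-normalizing nilpotent one; its diagonal adjoint action is read off from the weight module,
    on an ideal that acts faithfully there. *)

Section Multiset.
Variable X : eqType.
Implicit Types S T U : seq X.

Definition submset S T := forall x, (count_mem x S <= count_mem x T)%N.

Lemma submset_perm S T : submset S T -> exists U, perm_eq T (S ++ U).
Proof.
move=> /count_subseqP[S' /perm_to_subseq[U TU] SS'].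
by exists U; apply: (perm_trans TU); rewrite perm_cat2r perm_sym.
Qed.

Lemma perm_submset S T U : perm_eq T (S ++ U) -> submset S T.
Proof. by move=> /permP P x; rewrite P count_cat leq_addr. Qed.

Lemma submset_mem S T x : submset S T -> x \in S -> x \in T.
Proof. by move=> sST; rewrite -!has_pred1 !has_count => /leq_trans -> //. Qed.

Lemma submset_size_perm S T : submset S T -> size S = size T -> perm_eq S T.
Proof.
move=> /submset_perm[U TU] sz; have := perm_size TU.
rewrite size_cat sz -[LHS]addn0 => /addnI/esym/size0nil U0.
by move: TU; rewrite U0 cats0 perm_sym.
Qed.

Lemma submset_cat_disj S S' T : submset S T -> submset S' T ->
  (forall x, x \in S -> x \notin S') -> submset (S ++ S') T.
Proof.
move=> sS sS' dis x; rewrite count_cat; case: (boolP (x \in S)) => [/dis|] xS.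
  by rewrite (count_memPn xS) addn0.
by rewrite (count_memPn xS) add0n.
Qed.

Lemma submset1 x T : x \in T -> submset [:: x] T.
Proof. by move=> /perm_to_rem xT; apply: (@perm_submset _ _ (rem x T)). Qed.

End Multiset.

(** * Integrality and inner products *)

Section Integral.
Variable R : realFieldType.
Definition isint (x : R) := exists z : int, x = z%:~R.

Lemma isint_int (z : int) : isint z%:~R. Proof. by exists z. Qed.
Lemma isintD x y : isint x -> isint y -> isint (x + y).
Proof. by move=> [a ->] [b ->]; exists (a + b); rewrite intrD. Qed.
Lemma isintN x : isint x -> isint (- x).
Proof. by move=> [a ->]; exists (- a); rewrite intrN. Qed.
Lemma isintM x y : isint x -> isint y -> isint (x * y).
Proof. by move=> [a ->] [b ->]; exists (a * b); rewrite intrM. Qed.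
Lemma isint0 : isint 0. Proof. by exists 0. Qed.
Lemma isint_gt0_ge1 x : isint x -> 0 < x -> 1 <= x.
Proof. by move=> [a ->]; rewrite ltr0z ler1z. Qed.
Lemma isint_lt1_le0 x : isint x -> x < 1 -> x <= 0.
Proof. by move=> [a ->]; rewrite ltrz1 lerz0; lia. Qed.
Lemma isint_small x : isint x -> x ^+ 2 < 1 -> x = 0.
Proof.
move=> ix x1; apply/eqP; rewrite eq_le; apply/andP; split.
  by apply: isint_lt1_le0 => //; nra.
by rewrite -oppr_le0; apply: isint_lt1_le0; [exact: isintN | nra].
Qed.
End Integral.

Section InnerProduct.
Variables (R : realFieldType) (E : lmodType R) (dot : E -> E -> R).

Record inner_product := InnerProduct {
  dotC : forall u v, dot u v = dot v u;
  dotDl : forall u v w, dot (u + v) w = dot u w + dot v w;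
  dotZl : forall a u v, dot (a *: u) v = a * dot u v;
  dot_gt0 : forall u, u != 0 -> 0 < dot u u }.

Hypothesis dotP : inner_product.

Lemma dotDr u v w : dot u (v + w) = dot u v + dot u w.
Proof. by rewrite dotC // dotDl // !(dotC dotP u). Qed.
Lemma dotZr a u v : dot u (a *: v) = a * dot u v.
Proof. by rewrite dotC // dotZl // (dotC dotP u). Qed.
Lemma dotNl u v : dot (- u) v = - dot u v.
Proof. by rewrite -scaleN1r dotZl // mulN1r. Qed.
Lemma dotNr u v : dot u (- v) = - dot u v.
Proof. by rewrite -scaleN1r dotZr // mulN1r. Qed.
Lemma dot0l v : dot 0 v = 0. Proof. by rewrite -(scale0r 0) dotZl // mul0r. Qed.
Lemma dot0r v : dot v 0 = 0. Proof. by rewrite dotC // dot0l. Qed.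
Lemma dot_suml (I : Type) (s : seq I) F v :
  dot (\sum_(i <- s) F i) v = \sum_(i <- s) dot (F i) v.
Proof.
by elim: s => [|i s IH]; rewrite ?big_nil ?dot0l // !big_cons dotDl // IH.
Qed.
Lemma dot_sumr (I : Type) (s : seq I) F v :
  dot v (\sum_(i <- s) F i) = \sum_(i <- s) dot v (F i).
Proof. by rewrite dotC // dot_suml; apply: eq_bigr => i _; rewrite dotC. Qed.
Lemma dot_ge0 u : 0 <= dot u u.
Proof. by case: (eqVneq u 0) => [->|/(dot_gt0 dotP)/ltW//]; rewrite dot0l. Qed.
Lemma dot_eq0 u : dot u u = 0 -> u = 0.
Proof.
by move=> u0; apply/eqP/negPn/negP => /(dot_gt0 dotP); rewrite u0 ltxx.
Qed.

Definition dotE := (dotDl dotP, dotDr, dotNl, dotNr, dotZl dotP, dotZr).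

Lemma cauchy_schwarz u v : dot u v ^+ 2 <= dot u u * dot v v.
Proof.
have [->|/(dot_gt0 dotP) v0] := eqVneq v 0.
  by rewrite !dot0r expr0n mulr0.
have := dot_ge0 (dot v v *: u - dot u v *: v).
rewrite !dotE (dotC dotP v u) => H.
rewrite [X in _ <= X](_ : _ = dot v v * (dot u u * dot v v - dot u v ^+ 2)) in H.
  by rewrite pmulr_rge0 // subr_ge0 in H.
by ring.
Qed.

Lemma dot_parallelogram u v : dot (u + v) (u + v) <= 2 * dot u u + 2 * dot v v.
Proof. by have := dot_ge0 (u - v); rewrite !dotE (dotC dotP v u); lra. Qed.

(* The types of a root u against e: e plays the role of a coordinate vector, up
   to a small error, so that u is one of e, e + y, 2 e with y orthogonal to e. *)
Lemma root_type e eps u : dot e e = 1 + eps -> 0 <= eps -> eps <= 1/100 ->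
  0 < dot u u -> isint (dot e u) -> isint (2 * dot e u / dot u u) -> dot e u != 0 ->
  [\/ dot u u = 1 /\ dot e u ^+ 2 = 1, dot u u = 2 /\ dot e u ^+ 2 = 1
    | dot u u = 4 /\ dot e u ^+ 2 = 4].
Proof.
move=> ee eps0 eps1 u0; have := cauchy_schwarz e u; rewrite ee.
set N := dot u u in u0 *; set c := dot e u => cs [z cz] [k kz] c0.
have kN : k%:~R * N = 2 * c :> R by rewrite -kz divfK // gt_eqF.
have k0 : k%:~R != 0 :> R.
  by apply: contraNneq c0 => k0; move: kN; rewrite k0 mul0r => /esym/eqP; rewrite mulf_eq0 pnatr_eq0.
have ck_gt0 : 0 < c * k%:~R.
  have -> : c = k%:~R * N / 2 by rewrite kN; field.
  have : 0 < k%:~R ^+ 2 :> R by rewrite exprn_even_gt0.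
  by nra.
(* Cauchy-Schwarz gives c k = 2 c^2 / N <= 2 (1 + eps), so the integers c and k have product 1 or 2,
   which leaves six pairs. *)
have ck_lt3 : c * k%:~R < 3.
  have : (c * k%:~R) * (c * k%:~R) <= (2 * (1 + eps)) * (c * k%:~R).
    have := ler_wpM2l (sqr_ge0 (k%:~R : R)) cs.
    rewrite (_ : _ * _ ^+ 2 = c * k%:~R * (c * k%:~R)); last by ring.
    rewrite (_ : k%:~R ^+ 2 * _ = (1 + eps) * k%:~R * (k%:~R * N)); last by ring.
    by rewrite kN; lra.
  by rewrite ler_pM2r // => ?; lra.
rewrite cz -intrM ltr0z in ck_gt0; rewrite cz -intrM -[3]/(3%:~R) ltr_int in ck_lt3.
have : [\/ z = 1 /\ k = 1, z = -1 /\ k = -1, z = 1 /\ k = 2 | z = -1 /\ k = -2]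
   \/ (z = 2 /\ k = 1) \/ (z = -2 /\ k = -1).
  case: z k {cz kz kN k0} ck_lt3 ck_gt0 => [[|[|[|z]]]|[|[|z]]] [[|[|[|k]]]|[|[|k]]];
    rewrite ?NegzE => h1 h2; try nia; solve
    [ by left; constructor 1 | by left; constructor 2 | by left; constructor 3
    | by left; constructor 4 | by right; left | by right; right ].
by case=> [[]|[]] [ez ek]; move: kN; rewrite cz ez ek => kN;
  [ constructor 2 | constructor 2 | constructor 1 | constructor 1
  | constructor 3 | constructor 3]; split; (lra || ring).
Qed.

End InnerProduct.

Lemma small_double (R : realFieldType) (t eps : R) :
  eps <= 1/100 -> t ^+ 2 <= 2 * eps -> (2 * t) ^+ 2 < 1.
Proof. by rewrite exprMn => h1 h2; lra. Qed.

(** In its uses [k] is the squared norm of a root meeting [e] and [c] the square of [dot e a], both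
    at most 4; 16 eps is still below 1, and integrality then turns the error into 0. *)
Lemma sq_lt1 (R : realFieldType) (t k c eps : R) : 0 <= k -> k <= 4 -> c <= 4 -> 0 <= eps ->
  eps <= 1/100 -> t ^+ 2 <= k * (c * eps) -> t ^+ 2 < 1.
Proof.
move=> k0 k4 c4 e0 e1 h; apply: (le_lt_trans h).
apply: (@le_lt_trans _ _ (4 * (4 * eps))); last by lra.
apply: (@le_trans _ _ (k * (4 * eps))).
  by apply: ler_wpM2l => //; apply: ler_wpM2r.
by apply: ler_wpM2r => //; apply: mulr_ge0.
Qed.

(** * The degree of a minimal sequence against an almost integral unit vector *)

Section AtomBound.
Variables (R : realFieldType) (E : lmodType R) (dot : E -> E -> R).
Hypothesis dotP : inner_product dot.
Let dotE := (dotDl dotP, dotDr dotP, dotNl dotP, dotNr dotP, dotZl dotP, dotZr dotP).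
Variables (X : eqType) (r : X -> E) (T : seq X) (a : E) (d : R).
Local Notation N u := (dot u u).

Hypothesis T_gt0 : forall x, x \in T -> 0 < N (r x).
Hypothesis T_int : forall x y, x \in T -> y \in T -> isint (2 * dot (r x) (r y) / N (r y)).
Hypothesis T_pair : forall x y U, perm_eq T [:: x, y & U] -> 0 <= dot (r x) (r y).
Hypothesis T_sum : \sum_(x <- T) r x = d *: a.
Hypothesis d_gt0 : 0 < d.

Section Half.
Variables (e : E) (eps : R).
Hypotheses (ee : N e = 1 + eps) (eps0 : 0 <= eps) (eps1 : eps <= 1/100).
Hypothesis e_int : forall x, x \in T -> isint (dot e (r x)).
Hypothesis e_crys : forall x, x \in T -> isint (2 * dot e (r x) / N (r x)).
Hypothesis e_ge0 : forall x, x \in T -> 0 <= dot e (r x).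
Hypothesis a_ge1 : 1 <= dot e a.
Hypothesis Ta : forall x, x \in T -> dot e (r x) = 1 -> N (r x) = 2 -> dot (r x) a = dot e a.

Lemma type_gt0 x : x \in T -> 0 < dot e (r x) ->
  [\/ N (r x) = 1 /\ dot e (r x) = 1, N (r x) = 2 /\ dot e (r x) = 1
    | N (r x) = 4 /\ dot e (r x) = 2].
Proof.
move=> xT c0; case: (root_type dotP ee eps0 eps1 (T_gt0 xT) (e_int xT) (e_crys xT)).
- by rewrite gt_eqF.
- by move=> [-> c1]; constructor 1; split=> //; apply/eqP; rewrite -(@eqrXn2 _ 2) ?expr1n ?c1 // ltW.
- by move=> [-> c1]; constructor 2; split=> //; apply/eqP; rewrite -(@eqrXn2 _ 2) ?expr1n ?c1 // ltW.
- move=> [-> c1]; constructor 3; split=> //; apply/eqP; rewrite -(@eqrXn2 _ 2) ?c1 // ?ltW //.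
  by rewrite expr2; apply/eqP; lra.
Qed.

Lemma near_unit x : N (r x) = 1 -> dot e (r x) = 1 -> N (r x - e) = eps.
Proof.
move=> n1 c1; rewrite !dotE (dotC dotP (r x) e) n1 c1 ee; ring.
Qed.

(* Apart from [d <= 1], some part of the sequence has a sum close to [2 e]: one
   root with [N = 4], two with [N = 2], or two with [N = 1]. *)
Lemma half_sum : d <= 1 \/ exists S, [/\ submset S T, S != [::],
  forall x, x \in S -> 0 < dot e (r x) & N (\sum_(x <- S) r x - 2 *: e) <= 4 * eps].
Proof.
have sum_c : \sum_(x <- T) dot e (r x) = d * dot e a.
  by rewrite -dot_sumr // T_sum dotZr.
case: (pselect (exists2 x, x \in T & 0 < dot e (r x) /\ N (r x) = 4)).
  move=> [x xT [c0 n4]]; right; exists [:: x]; split=> //; first exact: submset1.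
    by move=> y; rewrite inE => /eqP ->.
  rewrite big_seq1; have [[]|[]|[_ c2]] := type_gt0 xT c0; rewrite ?n4; try lra.
  move: ee n4; rewrite !dotE (dotC dotP (r x) e) c2 => -> ->; lra.
move=> no4.
case: (pselect (exists2 x, x \in T & 0 < dot e (r x) /\ N (r x) = 2)).
  move=> [x xT [c0 n2]].
  have c1 : dot e (r x) = 1.
    by have [[]|[]|[]] := type_gt0 xT c0; rewrite ?n2 //; lra.
  (* By [Ta], [r x - e] is orthogonal to [a], hence to the sum of T. The term of x itself is 2 - 1 =
     1, so some y compensates it; as x and y are not obtuse, y has a positive e-coordinate. *)
  have sum0 : \sum_(y <- T) dot (r x - e) (r y) = 0.
    rewrite -dot_sumr // T_sum dotZr // !dotE Ta //; ring.
  have [U TU] : exists U, perm_eq T (x :: U) by exists (rem x T); exact: perm_to_rem.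
  have [y yU yneg] : exists2 y, y \in U & dot (r x - e) (r y) < 0.
    apply/not_exists2P => yneg; move: sum0; rewrite (perm_big _ TU) big_cons /=.
    have : 0 <= \sum_(j <- U) dot (r x - e) (r j).
      rewrite big_seq; apply: sumr_ge0 => j jU.
      by case: (yneg j) => [/(_ jU)//|/negP]; rewrite -leNgt.
    rewrite !dotE n2 c1; lra.
  have TU2 : perm_eq T [:: x, y & rem y U].
    by apply: (perm_trans TU); rewrite perm_cons perm_to_rem.
  have yT : y \in T by rewrite (perm_mem TU) inE yU orbT.
  have xy0 := T_pair TU2.
  have cy0 : 0 < dot e (r y) by move: yneg; rewrite !dotE; lra.
  right; exists [:: x; y]; split=> //.
  - exact: (@perm_submset _ _ _ (rem y U)).
  - by move=> z; rewrite !inE => /orP[] /eqP ->; rewrite // c1.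
  rewrite big_cons big_seq1.
  have [[n1 cy1]|[ny2 cy1]|[n4 _]] := type_gt0 yT cy0; last by case: no4; exists y.
  (* Here [r y] is nearly [e], so the integer [dot (r x) (r y)] is nearly 1, hence equal to 1,
     against the choice of y. *)
  + have := cauchy_schwarz dotP (r x) (r y - e).
    rewrite n2 near_unit // !dotE (dotC dotP (r x) e) c1 => cs.
    have : isint (2 * (dot (r x) (r y) - 1)).
      have := T_int yT xT; rewrite n2 => -[z zE].
      exists (2 * z - 2); rewrite intrB intrM -zE (dotC dotP (r x)) (_ : 2%:~R = 2 :> R) //; lra.
    move=> /isint_small H.
    have : 2 * (dot (r x) (r y) - 1) = 0.
      apply: H.
      exact: small_double cs.
    by move: yneg; rewrite !dotE cy1; lra.
  + have xy_eq0 : dot (r x) (r y) = 0.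
      apply/eqP; rewrite eq_le xy0 andbT; apply: isint_lt1_le0.
        by have := T_int xT yT; rewrite ny2 mulrC mulKf ?pnatr_eq0.
      by move: yneg; rewrite !dotE cy1; lra.
    move: ee n2 ny2; rewrite !dotE (dotC dotP (r y) (r x)) (dotC dotP (r x) e) (dotC dotP (r y) e).
    by rewrite xy_eq0 c1 cy1 => -> -> ->; lra.
move=> no2.
have type1 x : x \in T -> 0 < dot e (r x) -> N (r x) = 1 /\ dot e (r x) = 1.
  move=> xT c0; have [//|[n2 _]|[n4 _]] := type_gt0 xT c0.
  + by case: no2; exists x.
  + by case: no4; exists x.
have [x xT cx] : exists2 x, x \in T & 0 < dot e (r x).
  apply/not_exists2P => H; suff : d * dot e a <= 0.
    by rewrite leNgt mulr_gt0 // (lt_le_trans ltr01).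
  rewrite -sum_c big_seq; apply: sumr_le0 => x xT.
  by case: (H x) => [/(_ xT)//|/negP]; rewrite -leNgt.
have [U TU] : exists U, perm_eq T (x :: U) by exists (rem x T); exact: perm_to_rem.
case: (pselect (exists2 y, y \in U & 0 < dot e (r y))).
  move=> [y yU cy]; right; exists [:: x; y].
  have yT : y \in T by rewrite (perm_mem TU) inE yU orbT.
  split=> //.
  - apply: (@perm_submset _ _ _ (rem y U)).
    by apply: (perm_trans TU); rewrite perm_cons perm_to_rem.
  - by move=> z; rewrite !inE => /orP[] /eqP ->.
  have [n1 c1] := type1 _ xT cx; have [ny1 cy1] := type1 _ yT cy.
  rewrite big_cons big_seq1.
  have -> : r x + r y - 2 *: e = (r x - e) + (r y - e).
    by rewrite -[2]/(1 + 1) scalerDl scale1r opprD addrACA.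
  by have := dot_parallelogram dotP (r x - e) (r y - e); rewrite !near_unit //; lra.
(* A single root carries the whole e-coordinate of the sum, so [d * dot e a = 1]. *)
move=> H; left.
have : d * dot e a = 1.
  rewrite -sum_c (perm_big _ TU) big_cons /= (type1 _ xT cx).2 big_seq big1 ?addr0 // => y yU.
  apply/eqP; rewrite eq_le e_ge0 ?andbT; last by rewrite (perm_mem TU) inE yU orbT.
  by rewrite leNgt; apply/negP => cy; case: H; exists y.
by move=> <-; have := ler_wpM2l (ltW d_gt0) a_ge1; rewrite mulr1.
Qed.

End Half.

Hypothesis a_gt0 : 0 < N a.
Hypothesis T_a_gt0 : forall x, x \in T -> 0 < dot (r x) a.
Hypothesis T_a_int : forall x, x \in T -> isint (2 * dot (r x) a / N a).
Hypothesis a_T_int : forall x, x \in T -> isint (2 * dot (r x) a / N (r x)).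
Hypothesis T_min : forall S q, submset S T -> S != [::] ->
  \sum_(x <- S) r x = q *: a -> size S = size T.

(** Integral squared norms and integral Cartan numbers make all mutual products half-integers. *)
Lemma half_lattice S q : (forall x, x \in S -> x \in T /\ isint (N (r x))) ->
  isint (N a) -> isint q -> isint (2 * N (\sum_(x <- S) r x - q *: a)).
Proof.
move=> ST aa iq.
have Sa S' : {subset S' <= S} -> isint (2 * dot (\sum_(x <- S') r x) a).
  elim: S' => [|x S' IH] sS; first by rewrite big_nil dot0l // mulr0; exact: isint0.
  rewrite big_cons !dotE mulrDr; apply: isintD.
    have [xT _] := ST x (sS _ (mem_head _ _)).
    by have := isintM (T_a_int xT) aa; rewrite divfK ?gt_eqF.
  by apply: IH => y yS'; apply: sS; rewrite inE yS' orbT.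
have Sx y S' : y \in S -> {subset S' <= S} -> isint (2 * dot (\sum_(x <- S') r x) (r y)).
  move=> yS; elim: S' => [|x S' IH] sS; first by rewrite big_nil dot0l // mulr0; exact: isint0.
  rewrite big_cons !dotE mulrDr; apply: isintD.
    have [xT _] := ST x (sS _ (mem_head _ _)); have [yT yN] := ST y yS.
    by have := isintM (T_int xT yT) yN; rewrite divfK ?gt_eqF ?T_gt0.
  by apply: IH => z zS'; apply: sS; rewrite inE zS' orbT.
have SS S' : {subset S' <= S} -> isint (2 * dot (\sum_(x <- S') r x) (\sum_(x <- S) r x)).
  elim: S' => [|x S' IH] sS; first by rewrite big_nil dot0l // mulr0; exact: isint0.
  rewrite big_cons !dotE mulrDr; apply: isintD.
    by rewrite (dotC dotP); apply: Sx => //; apply: sS; rewrite mem_head.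
  by apply: IH => z zS'; apply: sS; rewrite inE zS' orbT.
rewrite !dotE (dotC dotP a) (_ : 2 * _ = 2 * dot (\sum_(x <- S) r x) (\sum_(x <- S) r x)
  - (q + q) * (2 * dot (\sum_(x <- S) r x) a) + 2%:~R * (q * (q * N a))); last by ring.
apply: isintD; first apply: isintD; first exact: SS.
  by apply/isintN/isintM; [exact: isintD | exact: Sa].
by apply: isintM; [exact: isint_int | do 2! apply: isintM => //].
Qed.

(** Twice 16 eps is below 1, so the integer 2 N vanishes and S sums to a multiple of [a]; minimality
    then identifies S with T. The 16 is what [dot_parallelogram] makes of two errors of size 4
    eps. *)
Lemma half_lattice_eq0 S q eps : submset S T -> S != [::] ->
  (forall x, x \in S -> isint (N (r x))) -> isint (N a) -> isint q ->
  eps <= 1/100 -> N (\sum_(x <- S) r x - q *: a) <= 16 * eps -> d = q.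
Proof.
move=> sS S0 SN aa iq eps1 Nle.
have N0 : N (\sum_(x <- S) r x - q *: a) = 0.
  apply/eqP; rewrite eq_le dot_ge0 // andbT -(@pmulr_rle0 _ 2) //.
  apply: isint_lt1_le0; last by move: Nle eps1; set t := N _ => ? ?; lra.
  by apply: half_lattice => // x xS; split; [exact: submset_mem sS xS | exact: SN].
have Sq : \sum_(x <- S) r x = q *: a by apply/subr0_eq/(dot_eq0 dotP).
have ST := submset_size_perm sS (T_min sS S0 Sq).
apply/eqP; rewrite -subr_eq0; move: T_sum; rewrite -(perm_big _ ST) Sq => /eqP.
rewrite eq_sym -subr_eq0 -scalerBl scaler_eq0 => /orP[//|/eqP a0].
by move: a_gt0; rewrite a0 dot0l ?ltxx.
Qed.

Variables (e : E) (eps : R).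
Hypotheses (ee : N e = 1 + eps) (eps0 : 0 <= eps) (eps1 : eps <= 1/100).
Hypothesis e_int : forall x, x \in T -> isint (dot e (r x)).
Hypothesis e_crys : forall x, x \in T -> isint (2 * dot e (r x) / N (r x)).
Hypothesis ea_int : isint (dot e a).
Hypothesis ea_crys : isint (2 * dot e a / N a).
Hypothesis ea_gt0 : 0 < dot e a.

(** With c = [dot e a], the vector [a] is close to c e. A partial sum close to 2 e is therefore
    close to (2 / c) a, and the half-integral lattice makes this an equality, whence d = 2 / c. *)
Lemma degree_aligned : N a = dot e a ^+ 2 -> dot e a = 1 \/ dot e a = 2 -> d <= 2.
Proof.
set c := dot e a => Na cE.
have near : N (a - c *: e) = c ^+ 2 * eps.
  by rewrite !dotE (dotC dotP a e) -/c ee Na; ring.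
have c2 : c ^+ 2 <= 4 by case: cE => ->; rewrite ?expr1n; lra.
have Ta x : x \in T -> dot e (r x) = 1 -> N (r x) = 2 -> dot (r x) a = dot e a.
  move=> xT c1 n2.
  have := cauchy_schwarz dotP (r x) (a - c *: e).
  rewrite near n2 !dotE (dotC dotP (r x) e) c1 mulr1 => cs.
  apply/subr0_eq/isint_small; last by apply: (sq_lt1 _ _ c2 eps0 eps1 cs); lra.
  by apply: isintD; [have := a_T_int xT; rewrite n2 mulrC mulKf ?pnatr_eq0 | exact: isintN].
have c_ge1 : 1 <= c by case: cE => ->; lra.
(* A negative coordinate is at most -1 and would push the product of [r x] with [a - c *: e] to at
   least 1, but that vector has squared norm at most 4 eps. *)
have e_ge0 x : x \in T -> 0 <= dot e (r x).
  move=> xT; rewrite leNgt; apply/negP => cx.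
  have N4 : N (r x) <= 4.
    have c0 : dot e (r x) != 0 by rewrite lt_eqF.
    by case: (root_type dotP ee eps0 eps1 (T_gt0 xT) (e_int xT) (e_crys xT) c0) => -[-> _]; lra.
  have := cauchy_schwarz dotP (r x) (a - c *: e).
  rewrite near !dotE (dotC dotP (r x) e) => cs.
  have := sq_lt1 (ltW (T_gt0 xT)) N4 c2 eps0 eps1 cs.
  have : 1 <= - dot e (r x) by apply: isint_gt0_ge1; [exact/isintN/e_int | rewrite oppr_gt0].
  have := T_a_gt0 xT; move: (dot (r x) a) (dot e (r x)) => u v u0 v1.
  have : 1 <= u - c * v by nra.
  by move: (u - c * v) => t; nra.
case: (half_sum ee eps0 eps1 e_int e_crys e_ge0 c_ge1 Ta) => [|[S [sS S0 Sc Se]]]; first lra.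
have SN x : x \in S -> isint (N (r x)).
  move=> xS; have xT := submset_mem sS xS.
  by case: (type_gt0 ee eps0 eps1 e_int e_crys xT (Sc x xS)) => -[-> _];
    [exists 1 | exists 2 | exists 4].
have Naint : isint (N a) by rewrite Na expr2; apply: isintM.
have c0 : c != 0 by rewrite gt_eqF.
have iq : isint (2 / c).
  by case: cE => ->; [exists 2; rewrite divr1 | exists 1; rewrite divff ?pnatr_eq0].
have := @half_lattice_eq0 S (2 / c) eps sS S0 SN Naint iq eps1.
have -> : \sum_(x <- S) r x - (2 / c) *: a =
    (\sum_(x <- S) r x - 2 *: e) + (- (2 / c)) *: (a - c *: e).
  by rewrite scalerBr scalerA mulNr divfK // scaleNr scaleNr opprK [_ + 2 *: e]addrC addrA subrK.
move=> H; rewrite H; first by case: cE => ->; rewrite ?divr1 ?divff ?pnatr_eq0 //; lra.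
apply: (le_trans (dot_parallelogram dotP _ _)).
rewrite (dotZl dotP) (dotZr dotP) near.
rewrite (_ : 2 * (- (2 / c) * (- (2 / c) * (c ^+ 2 * eps))) = 8 * eps); first by lra.
by field.
Qed.

(** Here a = e + e' with e' a second almost integral vector, almost orthogonal to e. Unless [a]
    itself occurs, every root of T misses e or e', so the partial sums close to 2 e and to 2 e' use
    disjoint roots and together come close to 2 a. *)
Lemma degree_split : N a = 2 -> dot e a = 1 -> d <= 2.
Proof.
move=> Na ca.
have [[x xT xa]|noa] := pselect (exists2 x, x \in T & r x = a).
  have sx := submset1 xT; have ST : perm_eq [:: x] T.
    by apply: (submset_size_perm sx); apply: (T_min (q := 1)) => //; rewrite big_seq1 scale1r.
  move: T_sum; rewrite -(perm_big _ ST) big_seq1 xa => /eqP.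
  rewrite -subr_eq0 -{1}[a]scale1r -scalerBl scaler_eq0 => /orP[/eqP|/eqP a0]; first by lra.
  by move: a_gt0; rewrite a0 dot0l ?ltxx.
pose e' := a - e.
have e'E x : dot e' x = dot x a - dot e x by rewrite !dotE (dotC dotP a).
have e'e : N e' = 1 + eps by rewrite !dotE (dotC dotP a e) Na ca ee; ring.
have e'_int x : x \in T -> isint (dot e' (r x)).
  move=> xT; rewrite e'E; apply: isintD; last exact/isintN/e_int.
  by have := T_a_int xT; rewrite Na mulrC mulKf ?pnatr_eq0.
have e'_crys x : x \in T -> isint (2 * dot e' (r x) / N (r x)).
  move=> xT; rewrite e'E mulrBr mulrBl; apply: isintD; first exact: a_T_int.
  by apply/isintN/e_crys.
have e'a : dot e' a = 1 by rewrite e'E Na ca; ring.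
(* A root meeting both vectors has equal coordinates on them, since its product with [a] is
   positive; then [N (r x - a)] is negative or [r x = a]. *)
have both x : x \in T -> dot e (r x) = 0 \/ dot e' (r x) = 0.
  move=> xT; case: (eqVneq (dot e (r x)) 0) => [|c0]; first by left.
  case: (eqVneq (dot e' (r x)) 0) => [|c'0]; first by right.
  have t1 := root_type dotP ee eps0 eps1 (T_gt0 xT) (e_int xT) (e_crys xT) c0.
  have t2 := root_type dotP e'e eps0 eps1 (T_gt0 xT) (e'_int x xT) (e'_crys x xT) c'0.
  have c2E : dot e (r x) ^+ 2 = dot e' (r x) ^+ 2.
    by case: t1 => -[n1 ->]; case: t2 => -[n2 ->] //; move: n2; rewrite n1; lra.
  have sumE : dot (r x) a = dot e (r x) + dot e' (r x) by rewrite e'E; ring.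
  have ccE : dot e' (r x) = dot e (r x).
    apply/eqP; rewrite eq_sym -subr_eq0; have := T_a_gt0 xT; rewrite sumE => /gt_eqF.
    have : (dot e (r x) - dot e' (r x)) * (dot e (r x) + dot e' (r x)) == 0.
      by rewrite -subr_sqr c2E subrr.
    by rewrite mulf_eq0 => /orP[//|] ->.
  have Nxa : N (r x - a) = N (r x) - 4 * dot e (r x) + 2.
    by rewrite !dotE (dotC dotP a) Na sumE ccE; ring.
  have c_gt0 : 0 < dot e (r x) by have := T_a_gt0 xT; rewrite sumE ccE; lra.
  have := dot_ge0 dotP (r x - a); have := type_gt0 ee eps0 eps1 e_int e_crys xT c_gt0.
  rewrite Nxa => -[] [n1 c1]; rewrite n1 c1; try lra.
  by case: noa; exists x => //; apply/subr0_eq/(dot_eq0 dotP); rewrite Nxa n1 c1; ring.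
have e_ge0 x : x \in T -> 0 <= dot e (r x).
  move=> xT; case: (both x xT) => [->//|]; rewrite e'E; have := T_a_gt0 xT; lra.
have e'_ge0 x : x \in T -> 0 <= dot e' (r x).
  move=> xT; case: (both x xT) => [|->//]; rewrite e'E; have := T_a_gt0 xT; lra.
have Ta x : x \in T -> dot e (r x) = 1 -> N (r x) = 2 -> dot (r x) a = dot e a.
  by move=> xT c1 _; case: (both x xT); rewrite ?e'E c1 ca; lra.
have Ta' x : x \in T -> dot e' (r x) = 1 -> N (r x) = 2 -> dot (r x) a = dot e' a.
  by move=> xT c1 _; case: (both x xT); move: c1; rewrite e'a ?e'E; lra.
case: (half_sum ee eps0 eps1 e_int e_crys e_ge0 _ Ta); first by rewrite ca.
  by lra.
move=> [S [sS S0 Sc Se]].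
case: (half_sum e'e eps0 eps1 e'_int e'_crys e'_ge0 _ Ta'); first by rewrite e'a.
  by lra.
move=> [S' [sS' S'0 Sc' Se']].
have dis x : x \in S -> x \notin S'.
  move=> xS; apply/negP => xS'; have xT := submset_mem sS xS.
  by have := Sc x xS; have := Sc' x xS'; case: (both x xT) => ->; rewrite ltxx.
have sSS := submset_cat_disj sS sS' dis.
suff -> : d = 2 by [].
apply: (@half_lattice_eq0 (S ++ S') 2 eps sSS _ _ _ _ eps1).
- by rewrite -size_eq0 size_cat addn_eq0 !size_eq0 (negPf S0).
- move=> x; rewrite mem_cat => /orP[xS|xS].
    by case: (type_gt0 ee eps0 eps1 e_int e_crys (submset_mem sS xS) (Sc x xS)) => -[-> _];
      [exists 1 | exists 2 | exists 4].
  by case: (type_gt0 e'e eps0 eps1 e'_int e'_crys (submset_mem sS' xS) (Sc' x xS)) => -[-> _];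
      [exists 1 | exists 2 | exists 4].
- by rewrite Na; exists 2.
- by exists 2.
have -> : \sum_(x <- S ++ S') r x - 2 *: a =
    (\sum_(x <- S) r x - 2 *: e) + (\sum_(x <- S') r x - 2 *: e').
  by rewrite big_cat /= addrACA -opprD -scalerDr /e' (addrC e) subrK.
apply: (le_trans (dot_parallelogram dotP _ _)); lra.
Qed.

Lemma degree_le2 : d <= 2.
Proof.
have ca0 : dot e a != 0 by rewrite gt_eqF.
case: (root_type dotP ee eps0 eps1 a_gt0 ea_int ea_crys ca0) => -[Na c2].
- apply: degree_aligned; rewrite ?Na ?c2 //; left.
  by apply/eqP; rewrite -(@eqrXn2 _ 2) ?expr1n ?c2 // ltW.
- apply: degree_split => //.
  by apply/eqP; rewrite -(@eqrXn2 _ 2) ?expr1n ?c2 // ltW.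
- apply: degree_aligned; rewrite ?Na ?c2 //; right.
  apply/eqP; rewrite -(@eqrXn2 _ 2) ?c2 // ?ltW //.
  by apply/eqP; ring.
Qed.

End AtomBound.

(** * Homogeneous sequences in an infinite set *)

Section InfiniteRamsey.
Variables (X : eqType).
Implicit Types (A : X -> Prop) (l : seq X).

Definition infinite_prop A := forall l, exists2 x, A x & x \notin l.

Lemma infinite_pigeonhole (I : finType) A (f : X -> I) : infinite_prop A ->
  exists i, infinite_prop (fun x => A x /\ f x = i).
Proof.
move=> infA; apply: contrapT => /forallNP fin.
have /choice[g gP] (i : I) : exists l, forall x, A x -> f x = i -> x \in l.
  have /existsNP[l lP] := fin i; exists l => x Ax fx; apply/negPn/negP => xl.
  by apply: lP; exists x.
have [x Ax /negP[]] := infA (flatten [seq g i | i <- enum I]).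
by apply/flattenP; exists (g (f x)); [apply: map_f; rewrite mem_enum | exact: gP].
Qed.

(** Each chosen x is followed by a shrinking to an infinite set on which [g x] is constant, so one
    color is attached to x for all later terms; among [#|I| * k] terms some attached color occurs k
    times. Only colors from earlier to later terms are fixed, so [g] may be asymmetric. *)
Lemma homogeneous_seq (I : finType) A (g : X -> X -> I) k : infinite_prop A ->
  exists c (s : seq X), [/\ size s = k, forall x, x \in s -> A x
    & pairwise (fun x y => (x != y) && (g x y == c)) s].
Proof.
move=> infA.
have [s [sz sA sP]] : exists s : seq (X * I), [/\ size s = (#|I| * k)%N,
    forall p, p \in s -> A p.1
  & pairwise (fun p q => (p.1 != q.1) && (g p.1 q.1 == p.2)) s].
  elim: (#|I| * k)%N A infA => [|m IH] A infA; first by exists [::].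
  have [x Ax _] := infA [::].
  have infA' : infinite_prop (fun y => A y /\ y != x).
    move=> l; have [y Ay] := infA (x :: l); rewrite inE negb_or => /andP[yx yl].
    by exists y.
  have [c /IH[s [sz sA sP]]] := infinite_pigeonhole (g x) infA'.
  exists ((x, c) :: s); split; first by rewrite /= sz.
    by move=> p; rewrite inE => /predU1P[-> //|/sA[[]]].
  rewrite /= sP andbT; apply/allP => p /sA /= [[_ px] ->].
  by rewrite eqxx andbT eq_sym.
have [c kc] : exists c, (k <= count (fun p => p.2 == c) s)%N.
  have [->|k0] := posnP k.
    have [x Ax _] := infA [::]; by exists (g x x).
  apply: contrapT => /forallNP H.
  have : (\sum_(c : I) count (fun p => p.2 == c) s < #|I| * k)%N.
    have I0 : (0 < #|I|)%N.
      by have [x _ _] := infA [::]; apply/card_gt0P; exists (g x x).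
    apply: (@leq_ltn_trans (\sum_(c : I) k.-1)%N).
      by apply: leq_sum => c _; have /negP := H c; rewrite -ltnNge; case: (k) k0.
    by rewrite sum_nat_const ltn_pmul2l //; case: (k) k0.
  rewrite -sz ltnNge => /negP[]; elim: s {sz sA sP H} => [//|p s IH] /=.
  rewrite big_split /= -add1n leq_add // (bigD1 p.2) //= eqxx; exact: leq_addr.
pose s1 := take k [seq p <- s | p.2 == c].
have s1s : subseq s1 s by apply: (subseq_trans (take_subseq _ _)); exact: filter_subseq.
exists c, (unzip1 s1); split.
- by rewrite size_map size_take size_filter; case: ltngtP kc.
- by move=> x /mapP[p /(mem_subseq s1s)/sA ? ->].
rewrite pairwise_map; move: (subseq_pairwise s1s sP).
have : all (fun p => p.2 == c) s1.
  by apply/allP => p /mem_take; rewrite mem_filter => /andP[].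
elim: s1 {s1s} => //= p s1 IH /andP[pc /IH {}IH] /andP[ps /IH ->].
by rewrite andbT; apply: sub_all ps => q /=; rewrite (eqP pc).
Qed.

End InfiniteRamsey.

(** * Abstract root data and reduction of minimal sequences *)

Lemma perm_cons_mid (X : eqType) (z : X) U S W :
  perm_eq (z :: U) (S ++ z :: W) = perm_eq U (S ++ W).
Proof. by rewrite (permPr (permEl (perm_catCA S [:: z] W))) perm_cons. Qed.

Section RootDatum.
Variables (R : realFieldType) (X : zmodType) (Phi : X -> Prop) (n : X -> X -> int).
Variables (line : R -> X).
Let alpha := line 1.

(* [r x] need not be additive in [x]: it reflects sums only as far as they lie on
   the line through [alpha]. *)
Definition realization (F : seq X) (k : nat) (r : X -> 'rV[R]_k) (dot : 'rV[R]_k -> 'rV[R]_k -> R) :=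
  [/\ inner_product dot, forall x, x \in F -> 0 < dot (r x) (r x),
      {in F &, injective r},
      forall x y, x \in F -> y \in F ->
        (n x y)%:~R = 2 * dot (r x) (r y) / dot (r y) (r y)
    & forall S q, {subset S <= F} ->
        \sum_(x <- S) r x = q *: r alpha <-> \sum_(x <- S) x = line q].

(* [n x y] is the Cartan number of [x] against the coroot of [y], and [line q]
   stands for [q alpha] although [X] is no vector space.  The roots may be
   infinitely many and of unbounded rank, so only finite sets are realized. *)
Record root_datum := RootDatum {
  rd_lineD : forall p q, line (p + q) = line p + line q;
  rd_line_inj : injective line;
  rd_alpha : Phi alpha;
  rd_opp : forall x, Phi x -> Phi (- x);
  rd_add : forall x y, Phi x -> Phi y -> n x y < 0 -> Phi (x + y) \/ x + y = 0;
  rd_nD : forall x y z, Phi x -> Phi y -> Phi z -> Phi (x + y) -> n (x + y) z = n x z + n y z;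
  rd_realize : forall F, (forall x, x \in F -> Phi x) -> alpha \in F ->
    exists k (r : X -> 'rV[R]_k) dot, realization F r dot }.

Hypothesis rdP : root_datum.

Lemma line0 : line 0 = 0.
Proof. by apply: (@addrI _ (line 0)); rewrite -rd_lineD // !addr0. Qed.
Lemma lineN q : line (- q) = - line q.
Proof. by apply: (@addrI _ (line q)); rewrite -rd_lineD // !subrr line0. Qed.
Lemma lineB p q : line (p - q) = line p - line q.
Proof. by rewrite rd_lineD // lineN. Qed.

Section Numbers.
Variables (F : seq X) (k : nat) (r : X -> 'rV[R]_k) (dot : 'rV[R]_k -> 'rV[R]_k -> R).
Hypothesis rF : realization F r dot.

Lemma dot_n x y : x \in F -> y \in F ->
  dot (r x) (r y) = (n x y)%:~R * dot (r y) (r y) / 2.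
Proof.
case: rF => dotP r0 _ rn _ xF yF; rewrite rn // divfK ?gt_eqF ?r0 //.
by rewrite mulrC mulKf ?pnatr_eq0.
Qed.

Lemma dot_n_gt0 x y : x \in F -> y \in F -> (0 < dot (r x) (r y)) = (0 < n x y).
Proof.
move=> xF yF; have r0 : 0 < dot (r y) (r y) by case: rF => _ ->.
by rewrite dot_n // -mulrA pmulr_lgt0 ?ltr0z // divr_gt0.
Qed.

Lemma dot_n_ge0 x y : x \in F -> y \in F -> (0 <= dot (r x) (r y)) = (0 <= n x y).
Proof.
move=> xF yF; have r0 : 0 < dot (r y) (r y) by case: rF => _ ->.
by rewrite dot_n // -mulrA pmulr_lge0 ?ler0z // divr_gt0.
Qed.

End Numbers.

Lemma realize_with F : (forall x, x \in F -> Phi x) ->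
  exists k (r : X -> 'rV[R]_k) dot, realization (alpha :: F) r dot.
Proof.
move=> PF; apply: rd_realize => //; last exact: mem_head.
by move=> x; rewrite inE => /predU1P[->|/PF //]; exact: rd_alpha.
Qed.

Lemma n_pos_sym x y : Phi x -> Phi y -> (0 < n x y) = (0 < n y x).
Proof.
move=> Px Py; have [|k [r [dot rF]]] := @realize_with [:: x; y].
  by move=> z; rewrite !inE => /orP[] /eqP ->.
have [dotP _ _ _ _] := rF.
have xF : x \in [:: alpha; x; y] by rewrite !inE eqxx orbT.
have yF : y \in [:: alpha; x; y] by rewrite !inE eqxx !orbT.
by rewrite -(dot_n_gt0 rF xF yF) -(dot_n_gt0 rF yF xF) (dotC dotP).
Qed.

Lemma n_ge0_sym x y : Phi x -> Phi y -> (0 <= n x y) = (0 <= n y x).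
Proof.
move=> Px Py; have [|k [r [dot rF]]] := @realize_with [:: x; y].
  by move=> z; rewrite !inE => /orP[] /eqP ->.
have [dotP _ _ _ _] := rF.
have xF : x \in [:: alpha; x; y] by rewrite !inE eqxx orbT.
have yF : y \in [:: alpha; x; y] by rewrite !inE eqxx !orbT.
by rewrite -(dot_n_ge0 rF xF yF) -(dot_n_ge0 rF yF xF) (dotC dotP).
Qed.

Lemma n_self x : Phi x -> n x x = 2.
Proof.
move=> Px; have [|k [r [dot rF]]] := @realize_with [:: x].
  by move=> z; rewrite !inE => /eqP ->.
have [dotP r0 _ rn _] := rF.
have xF : x \in [:: alpha; x] by rewrite !inE eqxx orbT.
have := rn x x xF xF; rewrite mulfK ?gt_eqF ?r0 // => /eqP.
by rewrite (_ : 2 = 2%:~R) // eqr_int => /eqP.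
Qed.

(** Cauchy-Schwarz bounds [n x y * n y x] by 4, and the two factors have the same sign. The value 4
    stays possible because proportional roots such as x = 2 y are not excluded. *)
Lemma n_bound x y : Phi x -> Phi y -> `|n x y| <= 4.
Proof.
move=> Px Py; have [|k [r [dot rF]]] := @realize_with [:: x; y].
  by move=> z; rewrite !inE => /orP[] /eqP ->.
have [dotP r0 _ _ _] := rF.
have xF : x \in [:: alpha; x; y] by rewrite !inE eqxx orbT.
have yF : y \in [:: alpha; x; y] by rewrite !inE eqxx !orbT.
have := cauchy_schwarz dotP (r x) (r y).
rewrite expr2 {2}(dotC dotP) (dot_n rF xF yF) (dot_n rF yF xF) => cs.
have nn4 : n x y * n y x <= 4.
  rewrite -(ler_int R) intrM -[4%:~R]/(4 : R).
  have p : 0 < dot (r x) (r x) * dot (r y) (r y) by rewrite mulr_gt0 ?r0.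
  rewrite -(ler_pM2r p); lra.
have := n_pos_sym Px Py; have := n_ge0_sym Px Py; nia.
Qed.

Definition min_zero_sum (T : seq X) (d : R) :=
  [/\ forall x, x \in T -> Phi x, \sum_(x <- T) x = line d
    & forall S q, submset S T -> S != [::] -> \sum_(x <- S) x = line q ->
      size S = size T].

Lemma min_zero_sum_perm T T' d : perm_eq T T' -> min_zero_sum T d -> min_zero_sum T' d.
Proof.
move=> TT' [PT sT mT]; split.
- by move=> x; rewrite -(perm_mem TT'); apply: PT.
- by rewrite -(perm_big _ TT').
- move=> S q sS; rewrite -(perm_size TT'); apply: mT => x.
  by rewrite (permP TT'); apply: sS.
Qed.

(** Moving one element along the line does not change its class modulo alpha, so the same parts sum
    to multiples of alpha as before. *)
Lemma min_zero_sum_shift x U d p : min_zero_sum (x :: U) d -> Phi (x + line p) ->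
  min_zero_sum (x + line p :: U) (d + p).
Proof.
move=> [PT sT mT] Py; split.
- by move=> z; rewrite inE => /predU1P[->//|zU]; apply: PT; rewrite inE zU orbT.
- by rewrite big_cons rd_lineD // -sT big_cons addrAC.
move=> S q sS S0 Sq; have [W SW] := submset_perm sS.
case: (boolP (x + line p \in S)) => [/perm_to_rem Sy|yS]; last first.
  apply: (mT _ q _ S0 Sq); have := perm_mem SW (x + line p).
  rewrite mem_head mem_cat (negPf yS) /= => /esym/perm_to_rem Wy.
  have {}SW : perm_eq (x + line p :: U) (S ++ x + line p :: rem (x + line p) W).
    by apply: (perm_trans SW); rewrite perm_cat2l.
  rewrite perm_cons_mid in SW.
  by apply: (@perm_submset _ _ _ (x :: rem (x + line p) W)); rewrite perm_cons_mid.
have /(mT (x :: rem (x + line p) S) (q - p)) : submset (x :: rem (x + line p) S) (x :: U).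
  apply: (@perm_submset _ _ _ W); rewrite perm_cons -(perm_cons (x + line p)).
  by apply: (perm_trans SW); rewrite -cat_cons perm_cat2r.
rewrite (perm_size Sy) /=; apply=> //.
by rewrite lineB -Sq (perm_big _ Sy) !big_cons /= [x + line p + _]addrAC addrK.
Qed.

(** A part containing [x + y] unfolds to a part with both x and y; a part avoiding it would be a
    proper part of the old sequence. *)
Lemma min_zero_sum_merge x y U d : min_zero_sum [:: x, y & U] d -> Phi (x + y) ->
  min_zero_sum (x + y :: U) d.
Proof.
move=> [PT sT mT] Py; split.
- by move=> z; rewrite inE => /predU1P[->//|zU]; apply: PT; rewrite !inE zU !orbT.
- by rewrite big_cons -sT !big_cons addrA.
move=> S q sS S0 Sq; have [W SW] := submset_perm sS.
case: (boolP (x + y \in S)) => [/perm_to_rem Sy|yS]; last first.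
  have := perm_mem SW (x + y).
  rewrite mem_head mem_cat (negPf yS) /= => /esym/perm_to_rem Wy.
  have {}SW : perm_eq (x + y :: U) (S ++ x + y :: rem (x + y) W).
    by apply: (perm_trans SW); rewrite perm_cat2l.
  rewrite perm_cons_mid in SW.
  have sS' : submset S [:: x, y & U].
    apply: (@perm_submset _ _ _ [:: x, y & rem (x + y) W]).
    by rewrite perm_cons_mid perm_cons_mid.
  have := mT _ q sS' S0 Sq; have := perm_size SW.
  by rewrite size_cat /=; lia.
have sS' : submset [:: x, y & rem (x + y) S] [:: x, y & U].
  apply: (@perm_submset _ _ _ W); rewrite !perm_cons -(perm_cons (x + y)).
  by apply: (perm_trans SW); rewrite -cat_cons perm_cat2r.
have /eqP : size [:: x, y & rem (x + y) S] = size [:: x, y & U].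
  by apply: (mT _ q sS') => //; rewrite -Sq (perm_big _ Sy) !big_cons addrA.
by rewrite (perm_size Sy) /= !eqSS => /eqP ->.
Qed.

Lemma shift_root x : Phi x -> n x alpha < 0 -> Phi (x + alpha) \/ x = line (-1).
Proof.
move=> Px; move/(rd_add rdP Px (rd_alpha rdP)) => [|/eqP]; first by left.
by rewrite addr_eq0 => /eqP ->; right; rewrite lineN.
Qed.

Lemma n_shift x : Phi x -> Phi (x + alpha) -> n (x + alpha) alpha = n x alpha + 2.
Proof. by move=> Px Pxa; rewrite rd_nD ?n_self //; exact: rd_alpha. Qed.

(** Replacing x by x + alpha raises its pairing with alpha by 2 and the degree by 1, which is
    harmless for an upper bound; the total negative part of the pairings decreases. The step fails
    only at x = - alpha, which is then all of T. *)
Lemma min_zero_sum_raise T d : min_zero_sum T d -> d <= 0 \/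
  exists T' d', [/\ min_zero_sum T' d', d <= d' & forall x, x \in T' -> 0 <= n x alpha].
Proof.
pose mu T := (\sum_(x <- T) absz (Num.min (n x alpha) 0))%N.
have [m] := ubnP (mu T); elim: m => // m IH in T d *; rewrite ltnS => Tm mT.
have [pos|/existsNP[x /not_implyP[xT /negP]]] := pselect (forall x, x \in T -> 0 <= n x alpha).
  by right; exists T, d.
rewrite -ltNge => nx; have TU := perm_to_rem xT; set U := rem x T in TU.
have Px : Phi x by case: mT => PT _ _; apply: PT.
have {}mT := min_zero_sum_perm TU mT.
have [Pxa|xE] := shift_root Px nx; last first.
  case: mT => _ sT mT; have /mT : submset [:: x] (x :: U) by apply: (@perm_submset _ _ _ U).
  move=> /(_ (-1) isT); rewrite big_seq1 => /(_ xE) [] /esym/size0nil U0.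
  move: sT; rewrite U0 big_seq1 xE => /(rd_line_inj rdP) <-; left; lra.
case: (IH (x + alpha :: U) (d + 1)).
- apply: leq_trans Tm; rewrite /mu (perm_big _ TU) !big_cons /= ltn_add2r n_shift //; lia.
- exact: min_zero_sum_shift.
- by move=> ?; left; lra.
- by move=> [T' [d' [mT' dd' pT']]]; right; exists T', d'; split=> //; lra.
Qed.

(** Each merge of an obtuse pair shortens T and keeps the degree and the signs against alpha. If x +
    y = 0, minimality leaves nothing else in T and d = 0. *)
Lemma min_zero_sum_pairwise T d : min_zero_sum T d -> (forall x, x \in T -> 0 <= n x alpha) ->
  d <= 0 \/ exists T', [/\ min_zero_sum T' d, forall x, x \in T' -> 0 <= n x alpha
    & forall x y U, perm_eq T' [:: x, y & U] -> 0 <= n x y].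
Proof.
have [m] := ubnP (size T); elim: m => // m IH in T *; rewrite ltnS => Tm mT Ta.
have [pos|/existsNP[x /existsNP[y /existsNP[U /not_implyP[TU /negP]]]]] :=
  pselect (forall x y U, perm_eq T [:: x, y & U] -> 0 <= n x y).
  by right; exists T.
rewrite -ltNge => nxy.
have {}Ta z : z \in [:: x, y & U] -> 0 <= n z alpha by rewrite -(perm_mem TU); apply: Ta.
have {}mT := min_zero_sum_perm TU mT; have [PT sT minT] := mT.
have xT : x \in [:: x, y & U] by rewrite !inE eqxx.
have yT : y \in [:: x, y & U] by rewrite !inE eqxx orbT.
have [Pxy|xy0] := rd_add rdP (PT x xT) (PT y yT) nxy.
  apply: (IH (x + y :: U)); last 1 first.
  - move=> z; rewrite inE => /predU1P[->|zU]; last by apply: Ta; rewrite !inE zU !orbT.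
    by rewrite (rd_nD rdP (PT _ xT) (PT _ yT) (rd_alpha rdP) Pxy) addr_ge0 ?Ta.
  - by apply: leq_trans Tm; rewrite (perm_size TU).
  - exact: min_zero_sum_merge.
left; have /minT : submset [:: x; y] [:: x, y & U] by apply: (@perm_submset _ _ _ U).
move=> /(_ 0 isT); rewrite big_cons big_seq1 line0 => /(_ xy0) [] /esym/size0nil U0.
by move: sT; rewrite U0 big_cons big_seq1 xy0 -line0 => /(rd_line_inj rdP) <-.
Qed.

End RootDatum.

(** * Finitely many roots at an acute angle with alpha *)

Section DegreeBound.
Variables (R : realFieldType) (X : zmodType) (Phi : X -> Prop) (n : X -> X -> int).
Variables (line : R -> X).
Hypothesis rdP : root_datum Phi n line.
Local Notation alpha := (line 1).
Local Notation min_zero_sum := (min_zero_sum Phi line).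

Definition positive_root x := Phi x /\ 0 < n x alpha.

Section Reduced.
Variables (T : seq X) (d : R).
Hypothesis mT : min_zero_sum T d.
Hypothesis T_pair : forall x y U, perm_eq T [:: x, y & U] -> 0 <= n x y.
Hypothesis T_ge0 : forall x, x \in T -> 0 <= n x alpha.
Hypothesis d_gt0 : 0 < d.

Let PT x : x \in T -> Phi x. Proof. by case: mT => + _ _; exact. Qed.

(** The product of [r x] with the sum of T is d times its product with alpha; it contains the square
    of [r x] and otherwise nonnegative terms. *)
Lemma reduced_positive x : x \in T -> positive_root x.
Proof.
move=> xT; split; first exact: PT.
have [k [r [dot rF]]] := realize_with rdP PT; have [dotP r0 _ _ rlin] := rF.
have sF : {subset T <= alpha :: T} by move=> y yT; rewrite inE yT orbT.
have aF : alpha \in alpha :: T by rewrite mem_head.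
have [_ sT _] := mT; move/(rlin T d sF).2: sT => sT.
rewrite -(dot_n_gt0 rF (sF x xT) aF) -(pmulr_rgt0 _ d_gt0) -(dotZr dotP) -sT.
rewrite dot_sumr // (perm_big _ (perm_to_rem xT)) big_cons /= ltr_wpDr ?r0 ?sF //.
rewrite big_seq; apply: sumr_ge0 => y yT.
rewrite (dot_n_ge0 rF) ?sF // ?(mem_rem yT) //.
apply: (T_pair (U := rem y (rem x T))).
by apply: (perm_trans (perm_to_rem xT)); rewrite perm_cons perm_to_rem.
Qed.

Lemma degree_size : d <= 2 * (size T)%:R.
Proof.
have [k [r [dot rF]]] := realize_with rdP PT; have [dotP r0 _ _ rlin] := rF.
have sF : {subset T <= alpha :: T} by move=> y yT; rewrite inE yT orbT.
have aF : alpha \in alpha :: T by rewrite mem_head.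
have [_ sT _] := mT; move/(rlin T d sF).2: sT => /(congr1 (fun v => dot v (r alpha))).
rewrite dot_suml // (dotZl dotP) => dE.
have a0 := r0 _ aF; rewrite -(ler_pM2r a0) -dE.
apply: (@le_trans _ _ (\sum_(x <- T) 2 * dot (r alpha) (r alpha))).
  rewrite big_seq [leRHS]big_seq; apply: ler_sum => x xT.
  rewrite (dot_n rF (sF x xT) aF) mulrAC ler_wpM2r ?(ltW a0) //.
  rewrite ler_pdivrMr // -natrM -[_%:R]/(4%:~R) ler_int.
  by apply: le_trans (n_bound rdP (PT xT) (rd_alpha rdP)); exact: ler_norm.
by rewrite big_const_seq count_predT iter_addr_0 -[leLHS]mulr_natr mulrAC.
Qed.

End Reduced.

Lemma n_opp x y : Phi x -> Phi y -> n (- x) y = - n x y.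
Proof.
move=> Px Py; have [|k [r [dot rF]]] := @realize_with _ _ _ _ _ rdP [:: x; - x; y].
  by move=> z; rewrite !inE => /or3P[] /eqP -> //; apply: (rd_opp rdP).
have [dotP r0 _ rn rlin] := rF; set F := alpha :: _ in rF r0 rn rlin.
have xF : x \in F by rewrite !inE eqxx orbT.
have nxF : - x \in F by rewrite !inE eqxx !orbT.
have yF : y \in F by rewrite !inE eqxx !orbT.
have [|_] := rlin [:: x; - x] 0.
  by move=> z; rewrite !inE => /orP[] /eqP ->; rewrite eqxx !orbT.
rewrite !big_cons !big_nil !addr0 subrr scale0r => H.
have {}H : r (- x) = - r x by apply/eqP; rewrite -addr_eq0 addrC H ?(line0 rdP).
by apply/eqP; rewrite -(eqr_int R) rmorphN /= !rn // H (dotNl dotP) mulrN mulNr.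
Qed.

Lemma raise_root x : Phi x -> (exists q, x = line q) \/
  exists q, Phi (x + line q) /\ 0 <= n (x + line q) alpha.
Proof.
have [m] := ubnP (absz (Num.min (n x alpha) 0)); elim: m => // m IH in x *; rewrite ltnS => xm Px.
have [nx|nx] := leP 0 (n x alpha).
  by right; exists 0; rewrite (line0 rdP) addr0.
have [Pxa|->] := shift_root rdP Px nx; last by left; exists (-1).
have nE := n_shift rdP Px Pxa.
case: (IH (x + alpha)) => //; first by apply: leq_trans xm; rewrite nE; lia.
  by move=> [q xq]; left; exists (q - 1); rewrite (lineB rdP) -xq addrK.
by move=> [q]; rewrite -addrA -(rd_lineD rdP) => H; right; exists (1 + q).
Qed.

Section FinitelyMany.
Variable l : seq X.
Hypothesis lP : forall x, positive_root x -> x \in l.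

Definition classes := [seq - p | p <- l] ++ [seq p' - p | p' <- l, p <- l].

Variables (T : seq X) (d : R).
Hypothesis mT : min_zero_sum T d.
Hypothesis T_pair : forall x y U, perm_eq T [:: x, y & U] -> 0 <= n x y.
Hypothesis T_ge0 : forall x, x \in T -> 0 <= n x alpha.
Hypothesis d_gt0 : 0 < d.

Let PT x : x \in T -> Phi x. Proof. by case: mT => + _ _; exact. Qed.

(** Let u realize - s and let ub be its component orthogonal to alpha, nonzero by minimality. Modulo
    alpha the rest sums to u, so its products with ub add up to the square of ub, and some x in the
    rest is acute to ub. Both u and x have nonnegative product with alpha, so x is acute to u as
    well, that is [n s x < 0]. *)
Lemma chain_step us rest s q : perm_eq T (us ++ rest) -> us != [::] -> (size us < size T)%N ->
  Phi s -> \sum_(x <- us) x - s = line q -> n s alpha <= 0 ->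
  exists2 x, x \in rest & (Phi (s + x) \/ s + x = 0) /\ s \in classes.
Proof.
move=> TU us0 sz Ps sE ns.
have usT : {subset us <= T} by move=> x; rewrite (perm_mem TU) mem_cat => ->.
have restT : {subset rest <= T} by move=> x; rewrite (perm_mem TU) mem_cat orbC => ->.
have [|k [r [dot rF]]] := @realize_with _ _ _ _ _ rdP (- s :: T).
  by move=> x; rewrite inE => /predU1P[->|/PT//]; exact: (rd_opp rdP).
have [dotP r0 _ _ rlin] := rF; set F := alpha :: _ in rF r0 rlin.
have TF : {subset T <= F} by move=> y yT; rewrite !inE yT !orbT.
have aF : alpha \in F by rewrite mem_head.
have sF : - s \in F by rewrite !inE eqxx orbT.
have [_ + minT] := mT; move/(rlin T d TF).2; rewrite (perm_big _ TU) big_cat /= => Td.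
have usF : {subset - s :: us <= F} by move=> x; rewrite inE => /predU1P[->//|/usT/TF].
have := (rlin (- s :: us) q usF).2; rewrite !big_cons addrC => /(_ sE) usE.
pose u := r (- s); pose a := r alpha; pose c := dot u a / dot a a.
have a0 : 0 < dot a a := r0 _ aF.
have ua0 : 0 <= dot u a by rewrite (dot_n_ge0 rF sF aF) n_opp // ?oppr_ge0 //; exact: (rd_alpha rdP).
pose ub := u - c *: a.
have aub : dot a ub = 0.
  by rewrite (dotDr dotP) (dotNr dotP) (dotZr dotP) (dotC dotP a) /c divfK ?subrr ?gt_eqF.
have ub0 : ub != 0.
  apply/eqP => /subr0_eq ucE.
  have subs : {subset [:: - s] <= F} by move=> x; rewrite inE => /eqP ->.
  have := proj1 (rlin [:: - s] c subs); rewrite !big_seq1 => /(_ ucE) nsE.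
  have := minT us (q - c) (perm_submset TU) us0.
  rewrite (lineB rdP) -sE -nsE opprK subrK => /(_ erefl) szE.
  by rewrite szE ltnn in sz.
have rest_gt0 : 0 < \sum_(x <- rest) dot (r x) ub.
  rewrite -dot_suml //.
  have -> : \sum_(x <- rest) r x = (d - q) *: a + u.
    rewrite scalerBl -/a -Td -usE -/u [u + _]addrC opprD !addrA subrK.
    by rewrite [X in _ = X - _]addrC addrK.
  rewrite (dotDl dotP) (dotZl dotP) aub mulr0 add0r.
  have -> : dot u ub = dot ub ub.
    by rewrite {2}/ub (dotDl dotP) (dotNl dotP) (dotZl dotP) aub mulr0 subr0.
  exact: dot_gt0.
have [x xrest xub] : exists2 x, x \in rest & 0 < dot (r x) ub.
  apply: contrapT => /forall2NP H; move: rest_gt0; rewrite ltNge => /negP; apply.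
  rewrite big_seq; apply: sumr_le0 => x xrest.
  by case: (H x) => [/(_ xrest)//|/negP]; rewrite -leNgt.
have xT := restT _ xrest; have [Px xpos] := reduced_positive mT T_pair d_gt0 xT.
have nsx : n s x < 0.
  rewrite -oppr_gt0 -n_opp // (n_pos_sym rdP) //; last exact: (rd_opp rdP).
  rewrite -(dot_n_gt0 rF (TF x xT) sF) -/u.
  move: xub; rewrite (dotDr dotP) (dotNr dotP) (dotZr dotP) subr_gt0; apply: le_lt_trans.
  apply: mulr_ge0; first by rewrite divr_ge0 // ltW.
  by rewrite (dot_n_ge0 rF (TF x xT) aF) T_ge0.
have Pxs : Phi (s + x) \/ s + x = 0 by apply: (rd_add rdP).
exists x => //; split=> //; rewrite mem_cat; apply/orP.
(* If s pairs negatively with alpha then - s is a positive root; if it pairs to 0 then s + x pairs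
   like x, and s is the difference of s + x and x. *)
have [ns0|ns0] := ltP (n s alpha) 0.
  left; apply/mapP; exists (- s); rewrite ?opprK //; apply: lP; split; first exact: (rd_opp rdP).
  by rewrite n_opp ?oppr_gt0 //; exact: (rd_alpha rdP).
have {}ns0 : n s alpha = 0 by apply/eqP; rewrite eq_le ns.
right; apply/allpairsP; exists (s + x, x) => /=; split; [|exact: lP|by rewrite addrK].
case: Pxs => [Pxs|/eqP].
  by apply: lP; split=> //; rewrite (rd_nD rdP) // ?ns0 ?add0r //; exact: (rd_alpha rdP).
rewrite addr_eq0 => /eqP sx; move: ns0 xpos; rewrite sx n_opp //; last exact: (rd_alpha rdP).
by move=> /eqP; rewrite oppr_eq0 => /eqP ->.
Qed.

(* Each partial sum is a root [s] modulo [alpha], which the next element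
   continues to a root, so that [s] is a difference of two positive roots or the
   opposite of one. *)
Lemma chain k : (0 < k <= size T)%N -> exists us rest, [/\ perm_eq T (us ++ rest), size us = k,
  forall i, (0 < i < k)%N -> exists c q, c \in classes /\ \sum_(x <- take i us) x - c = line q
  & (k < size T)%N -> exists s q, Phi s /\ \sum_(x <- us) x - s = line q].
Proof.
have [_ _ minT] := mT.
elim: k => // -[|k] IH /andP[_ kT].
  case TE: T kT => [//|x T'] _; exists [:: x], T'; split=> //; first by move=> [|i].
  move=> _; exists x, 0; split; first by apply: PT; rewrite TE mem_head.
  by rewrite big_seq1 subrr (line0 rdP).
have [|us [rest [TU szus cus]]] := IH; first exact: ltnW.
move=> /(_ kT)[s [q [Ps sE]]].
have us0 : us != [::] by rewrite -size_eq0 szus.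
have usT : submset us T := perm_submset TU.
have [[p sp]|[p [Psp sp]]] := raise_root (rd_opp rdP Ps).
  have := minT us (q - p) usT us0; rewrite (lineB rdP) -sE -sp opprK subrK => /(_ erefl).
  by rewrite szus => kE; rewrite kE ltnn in kT.
(* Raising - s rather than s yields a representative of the same class with [n t alpha <= 0], as
   [chain_step] requires. *)
pose t := s - line p.
have tE : - (- s + line p) = t by rewrite opprD opprK.
have Pt : Phi t by rewrite -tE; apply: (rd_opp rdP).
have nt : n t alpha <= 0 by rewrite -tE n_opp ?oppr_le0 //; exact: (rd_alpha rdP).
have tus : \sum_(x <- us) x - t = line (q + p).
  by rewrite (rd_lineD rdP) -sE opprB addrA addrAC.
have [|x xrest [Ptx tc]] := chain_step TU us0 _ Pt tus nt; first by rewrite szus.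
exists (rcons us x), (rem x rest); split.
- apply: (perm_trans TU); rewrite -cats1 -catA perm_cat2l /=; exact: perm_to_rem.
- by rewrite size_rcons szus.
- move=> i /andP[i0]; rewrite ltnS leq_eqVlt => /predU1P[->|ik].
    by exists t, (q + p); rewrite -cats1 take_cat szus ltnn subnn take0 cats0.
  by rewrite -cats1 takel_cat ?szus ?(ltnW ik) //; apply: cus; rewrite i0.
move=> kT2.
have E : \sum_(y <- rcons us x) y - (t + x) = line (q + p).
  by rewrite -cats1 big_cat big_seq1 /= opprD addrACA subrr addr0.
exists (t + x), (q + p); split=> //; case: Ptx => // tx0; move: E; rewrite tx0 subr0.
move=> /minT; rewrite size_rcons szus -size_eq0 size_rcons => H.
have : k.+2 = size T; last by move=> kE; rewrite kE ltnn in kT2.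
apply: H => //; apply: (@perm_submset _ _ _ (rem x rest)).
by apply: (perm_trans TU); rewrite -cats1 -catA perm_cat2l /=; exact: perm_to_rem.
Qed.

(** Two partial sums in one class enclose a proper nonempty block that sums to a multiple of alpha.
    Only the [(size T).-1] proper partial sums are assigned a class, hence the successor. *)
Lemma finite_size_bound : (size T <= (size classes).+1)%N.
Proof.
have [_ _ minT] := mT; have [->//|T0] := posnP (size T).
have [|us [rest [TU szus cus _]]] := @chain (size T); first by rewrite T0 leqnn.
rewrite leqNgt; apply/negP => big.
have /choice[f fP] (i : 'I_(size T).-1) : exists j : 'I_(size classes),
    exists q, \sum_(x <- take i.+1 us) x - nth 0 classes j = line q.
  have [|c [q [cc cE]]] := cus i.+1; first by have := ltn_ord i; lia.
  have cj : (index c classes < size classes)%N by rewrite index_mem.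
  by exists (Ordinal cj), q; rewrite /= nth_index.
have [i [j [ij fij]]] : exists i j : 'I_(size T).-1, (i < j)%N /\ f i = f j.
  apply: contrapT => /forallNP H.
  have /leq_card : injective f.
    move=> i j fij; apply/val_inj/eqP; case: ltngtP => // ij.
      by case: (H i); exists j.
    by case: (H j); exists i.
  by rewrite !card_ord; lia.
have [q qE] := fP i; have [q' q'E] := fP j.
pose S := drop i.+1 (take j.+1 us).
have Ssz : size S = (j - i)%N by rewrite size_drop size_takel //; have := ltn_ord j; lia.
have usE : us = take i.+1 us ++ S ++ drop j.+1 us.
  rewrite catA -{1}(cat_take_drop j.+1 us); congr (_ ++ _).
  by rewrite -[LHS](cat_take_drop i.+1) take_takel ?ltnS ?(ltnW ij).
have /minT : submset S T.
  apply: (@perm_submset _ _ _ (take i.+1 us ++ drop j.+1 us ++ rest)).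
  apply: (perm_trans TU); rewrite {1}usE -!catA; exact: permEl (perm_catCA _ _ _).
move=> /(_ (q' - q)); rewrite Ssz => H.
have : (j - i)%N = size T; last by have := ltn_ord j; lia.
apply: H; first by rewrite -size_eq0 Ssz; lia.
rewrite (lineB rdP) -qE -q'E fij opprB addrA subrK.
rewrite -[in X in X - _](cat_take_drop i.+1 (take j.+1 us)) big_cat /= take_takel ?ltnS ?(ltnW ij) //.
by rewrite addrAC subrr add0r.
Qed.

End FinitelyMany.
End DegreeBound.

(** * Infinitely many roots at an acute angle with alpha *)

Section SumNorm.
Variables (R : realFieldType) (E : lmodType R) (dot : E -> E -> R).
Hypothesis dotP : inner_product dot.

Lemma dot_sum_pairwise (X : eqType) (r : X -> E) (a b : R) (s : seq X) :
  (forall x, x \in s -> dot (r x) (r x) = a) -> pairwise (fun x y => dot (r x) (r y) == b) s ->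
  dot (\sum_(x <- s) r x) (\sum_(x <- s) r x) = (size s)%:R * a + (size s)%:R * ((size s)%:R - 1) * b.
Proof.
elim: s => [|x s IH] sa /=; first by rewrite !big_nil dot0l // !mul0r addr0.
move=> /andP[/allP xs sb]; rewrite !big_cons !(dotDl dotP, dotDr dotP).
rewrite IH //; last by move=> y ys; apply: sa; rewrite inE ys orbT.
rewrite (dotC dotP (\sum_(j <- s) r j)) sa ?mem_head //.
have -> : dot (r x) (\sum_(y <- s) r y) = (size s)%:R * b.
  rewrite dot_sumr // -sum1_size natr_sum mulr_suml big_seq [RHS]big_seq.
  by apply: eq_bigr => y /xs /eqP ->; rewrite mul1r.
by rewrite -[(size s).+1]addn1 natrD; ring.
Qed.
End SumNorm.

Lemma inner_product_scale (R : realFieldType) (E : lmodType R) (dot : E -> E -> R) c :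
  0 < c -> inner_product dot -> inner_product (fun u v => c * dot u v).
Proof.
move=> c0 dotP; split=> [u v|u v w|a u v|u u0].
- by rewrite (dotC dotP).
- by rewrite (dotDl dotP) mulrDr.
- by rewrite (dotZl dotP); ring.
- by rewrite mulr_gt0 // dot_gt0.
Qed.

Section DegreeBound.
Variables (R : realFieldType) (X : zmodType) (Phi : X -> Prop) (n : X -> X -> int).
Variables (line : R -> X).
Hypothesis rdP : root_datum Phi n line.
Local Notation alpha := (line 1).
Local Notation min_zero_sum := (min_zero_sum Phi line).
Local Notation positive_root := (positive_root Phi n line).

(** By [n_bound] Cartan numbers lie between -4 and 4, so nine colors separate them. *)
Let color (z : int) : 'I_9 := inord (absz (z + 4)).

Lemma color_inj x y x' y' : Phi x -> Phi y -> Phi x' -> Phi y' ->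
  color (n x y) = color (n x' y') -> n x y = n x' y'.
Proof.
move=> Px Py Px' Py' /(congr1 val); have := n_bound rdP Px Py; have := n_bound rdP Px' Py'.
by move=> ? ?; rewrite /= !inordK; lia.
Qed.

(** Pigeonhole fixes the pairings with [F], in both orders, and the Ramsey argument fixes those
    inside [s]. The size 100 is what gives the mean of [s] the squared norm 1 + 1/100. *)
Lemma infinite_generic (F : seq X) : (forall x, x \in F -> Phi x) -> infinite_prop positive_root ->
  exists (s : seq X) b, [/\ size s = 100, forall x, x \in s -> positive_root x,
    forall v x y, v \in F -> x \in s -> y \in s -> n v x = n v y /\ n x v = n y v
  & pairwise (fun x y => (x != y) && (n x y == b)) s].
Proof.
move=> PF inf.
pose f x := [ffun i : 'I_(size F) => (color (n (nth 0 F i) x), color (n x (nth 0 F i)))].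
have [c /(homogeneous_seq (fun x y => color (n x y)) 100)] := infinite_pigeonhole f inf.
move=> [b [s [sz sA sP]]].
have sPhi x : x \in s -> Phi x by move=> /sA[[]].
have [x0 [y0 [x0s y0s nb]]] : exists x y, [/\ x \in s, y \in s & color (n x y) = b].
  case: s sz sP {sA sPhi} => [//|x [//|y s]] _ /= /andP[/andP[/andP[_ /eqP xy]]] _ _.
  by exists x, y; rewrite !inE !eqxx orbT.
exists s, (n x0 y0); split=> //; first by move=> x /sA[].
  move=> v x y vF xs ys; have [_ fx] := sA x xs; have [_ fy] := sA y ys.
  have iF : (index v F < size F)%N by rewrite index_mem.
  have := congr1 (fun g : {ffun _} => g (Ordinal iF)) (etrans fx (esym fy)).
  rewrite !ffunE /= nth_index // => -[] /color_inj ? /color_inj ?.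
  by split; auto.
apply: (sub_in_pairwise (P := [in s])) sP; last exact/allP.
move=> x y xs ys /andP[-> /eqP xyb]; apply/eqP/color_inj; rewrite ?xyb ?nb //; exact: sPhi.
Qed.

Lemma infinite_degree_bound T d : infinite_prop positive_root -> min_zero_sum T d ->
  (forall x y U, perm_eq T [:: x, y & U] -> 0 <= n x y) -> 0 < d -> d <= 2.
Proof.
move=> inf mT T_pair d_gt0; have [PT sT minT] := mT.
have PaT x : x \in alpha :: T -> Phi x.
  by rewrite inE => /predU1P[->|/PT//]; exact: (rd_alpha rdP).
have [s [b [sz sP sc sb]]] := infinite_generic PaT inf.
have [|k [r [dot rF]]] := @realize_with _ _ _ _ _ rdP (T ++ s).
  by move=> x; rewrite mem_cat => /orP[/PT //|/sP[]].
set F := alpha :: _ in rF; have [dotP r0 rinj rn rlin] := rF.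
have aF : alpha \in F by rewrite mem_head.
have TF : {subset T <= F} by move=> x xT; rewrite !inE mem_cat xT orbT.
have sF : {subset s <= F} by move=> x xs; rewrite !inE mem_cat xs !orbT.
have aTF : {subset alpha :: T <= F} by move=> x; rewrite inE => /predU1P[->//|/TF].
have aaT : alpha \in alpha :: T by rewrite mem_head.
have [x0 x0s] : exists x0, x0 \in s by case: s sz {sP sc sb F rF r0 rinj rn rlin aF TF sF aTF} => [//|x s] _; exists x; rewrite mem_head.
have [Px0 nx0a] := sP x0 x0s.
have nax0 : 0 < n alpha x0 by rewrite (n_pos_sym rdP) //; exact: (rd_alpha rdP).
pose l := dot (r x0) (r x0); have l0 : 0 < l := r0 _ (sF _ x0s).
(* The ratio of the norms of x and alpha is the ratio of their two Cartan numbers, which are nonzero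
   and constant on [s]. *)
have normE x : x \in s -> dot (r x) (r x) = l.
  move=> xs; have [nax nxa] := sc alpha x x0 aaT xs x0s.
  have E y : y \in s -> dot (r y) (r y) * (n alpha y)%:~R = (n y alpha)%:~R * dot (r alpha) (r alpha).
    move=> ys; have ny0 : (n alpha y)%:~R != 0 :> R.
      by have [-> _] := sc alpha y x0 aaT ys x0s; rewrite intr_eq0 gt_eqF.
    have := dot_n rF aF (sF _ ys); rewrite (dotC dotP) (dot_n rF (sF _ ys) aF); lra.
  have nax0R : (n alpha x0)%:~R != 0 :> R by rewrite intr_eq0 gt_eqF.
  by apply: (mulIf nax0R); rewrite -{1}nax E // nxa -E.
(* With norm 2 on [s], products with elements of [s] are plain Cartan numbers. *)
pose dot' u v := 2 / l * dot u v.
have dotP' : inner_product dot' by apply: inner_product_scale => //; exact: divr_gt0.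
have dotnE x y : dot' (r x) (r y) = 2 / l * dot (r x) (r y) by [].
have s2 x : x \in s -> dot' (r x) (r x) = 2 by move=> xs; rewrite dotnE normE // divfK ?gt_eqF.
have rn' x y : x \in F -> y \in F -> (n x y)%:~R = 2 * dot' (r x) (r y) / dot' (r y) (r y).
  move=> xF yF; rewrite rn // !dotnE; have := r0 y yF => y0.
  by field; rewrite !gt_eqF.
have r0' x : x \in F -> 0 < dot' (r x) (r x).
  by move=> xF; rewrite dotnE mulr_gt0 ?r0 ?divr_gt0.
have dotxs x y : x \in F -> y \in s -> dot' (r x) (r y) = (n x y)%:~R.
  by move=> xF ys; rewrite (rn' x y xF (sF _ ys)) s2 // mulrC mulKf ?pnatr_eq0.
(* For the roots e_0 - e_i this mean differs from e_0 by a vector of squared norm 1/100. *)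
pose e := 100^-1 *: \sum_(x <- s) r x.
have e_dot v : v \in alpha :: T -> dot' e (r v) = (n v x0)%:~R.
  move=> vT; rewrite (dotZl dotP') (dot_suml dotP').
  rewrite (eq_big_seq (fun _ => (n v x0)%:~R)); last first.
    by move=> x xs; rewrite (dotC dotP') dotxs ?aTF //; have [->] := sc v x x0 vT xs x0s.
  by rewrite big_const_seq count_predT sz iter_addr_0 -[X in _ * X]mulr_natr mulrC mulfK ?pnatr_eq0.
have ee : dot' e e = (2 + 99 * b%:~R) / 100.
  rewrite (dotZl dotP') (dotZr dotP') (dot_sum_pairwise dotP' (a := 2) (b := b%:~R)) ?sz //.
    by field.
  apply: (sub_in_pairwise (P := [in s])) sb; last exact/allP.
  by move=> x y xs ys /andP[_ /eqP bE]; apply/eqP; rewrite dotxs ?sF // bE.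
(* Cauchy-Schwarz gives b <= 2, and b = 2 would make two members of [s] equal. With b <= 0 the
   squared norm of e would be at most 2/100, too small for its positive integral product with
   alpha. *)
have b1 : b = 1.
  have [x [y [xs ys xy nxy]]] : exists x y, [/\ x \in s, y \in s, x != y & n x y = b].
    case: s sz sb {sP sc sF F rF r0 rinj rn rlin aF TF aTF x0s normE s2 rn' r0' dotxs e e_dot ee} => [//|x [//|y s]] _ /=.
    move=> /andP[/andP[/andP[xy /eqP nxy] _] _].
    by exists x, y; rewrite !inE !eqxx orbT.
  have := cauchy_schwarz dotP' (r x) (r y); rewrite !s2 // dotxs ?sF // nxy => cs.
  have b2 : b <= 2.
    rewrite leNgt; apply/negP => b3; have : 3 <= b%:~R :> R by rewrite -[3]/(3%:~R) ler_int.
    by move=> ?; nra.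
  have bn2 : b != 2.
    apply/eqP => b2E; move/eqP: xy; apply; apply: rinj; rewrite ?sF //.
    apply/subr0_eq/(dot_eq0 dotP').
    rewrite !(dotDl dotP', dotDr dotP', dotNl dotP', dotNr dotP') (dotC dotP' (r y)).
    by rewrite !s2 // dotxs ?sF // nxy b2E; ring.
  have b_gt0 : 0 < b.
    have := cauchy_schwarz dotP' e (r alpha); rewrite e_dot // ee.
    have := rn' x0 alpha (sF _ x0s) aF; rewrite dotnE (dotC dotP) -dotnE dotxs //.
    have := r0' _ aF; set N := dot' (r alpha) (r alpha) => N0 nE cs'.
    have {nE} : (n x0 alpha)%:~R * N = 2 * (n alpha x0)%:~R by rewrite nE divfK ?gt_eqF.
    have : 1 <= (n alpha x0)%:~R :> R by rewrite ler1z.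
    have : 1 <= (n x0 alpha)%:~R :> R by rewrite ler1z.
    move: cs'; set u := (n alpha x0)%:~R; set v := (n x0 alpha)%:~R => cs' v1 u1 vN.
    rewrite ltNge; apply/negP => b0; have : b%:~R <= 0 :> R by rewrite lerz0.
    move=> b0R; have : u ^+ 2 <= 2/100 * N by nra.
    have : N <= 2 * u by nra.
    by move=> ? ?; nra.
  by lia.
have e_crys v : v \in alpha :: T -> isint (2 * dot' e (r v) / dot' (r v) (r v)).
  move=> vT; rewrite e_dot // -dotxs ?aTF // (dotC dotP') -(rn' x0 v (sF _ x0s) (aTF _ vT)).
  exact: isint_int.
have sumT : \sum_(x <- T) r x = d *: r alpha by apply: (rlin T d TF).2.
apply: (@degree_le2 _ _ _ dotP' _ r T (r alpha) d _ _ _ sumT d_gt0 _ _ _ _ _ e (1/100)).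
- by move=> x xT; apply/r0'/TF.
- by move=> x y xT yT; rewrite -rn' ?TF //; exact: isint_int.
- move=> x y U TU; have xT : x \in T by rewrite (perm_mem TU) !inE eqxx.
  have yT : y \in T by rewrite (perm_mem TU) !inE eqxx orbT.
  rewrite dotnE mulr_ge0 ?divr_ge0 ?(ltW l0) // (dot_n_ge0 rF) ?TF //.
  exact: T_pair TU.
- exact: r0' aF.
- move=> x xT; rewrite dotnE mulr_gt0 ?divr_gt0 // (dot_n_gt0 rF (TF _ xT) aF).
  by have [] := reduced_positive rdP mT T_pair d_gt0 xT.
- by move=> x xT; rewrite -(rn' x alpha (TF _ xT) aF); exact: isint_int.
- by move=> x xT; rewrite (dotC dotP') -(rn' alpha x aF (TF _ xT)); exact: isint_int.
- move=> S q sST S0 Sq; apply: (minT S q) => //; apply: (proj1 (rlin S q _) Sq).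
  by move=> x /(submset_mem sST)/TF.
- by rewrite ee b1; field.
- by rewrite divr_ge0.
- by [].
- by move=> x xT; rewrite e_dot ?inE ?xT ?orbT //; exact: isint_int.
- by move=> x xT; apply: e_crys; rewrite inE xT orbT.
- by rewrite e_dot //; exact: isint_int.
- exact: e_crys.
- by rewrite e_dot // ltr0z.
Qed.

Lemma degree_bound : exists K, forall T d, min_zero_sum T d -> d <= K.
Proof.
have [inf|/existsNP[l lP]] := pselect (infinite_prop positive_root).
  exists 2 => T d mT; have [|[T' [d' [mT' dd' T'0]]]] := min_zero_sum_raise rdP mT; first by lra.
  apply: (le_trans dd'); have [|[S [mS _ S_pair]]] := min_zero_sum_pairwise rdP mT' T'0; first by lra.
  have [d'0|d'0] := ltP 0 d'; last by lra.
  exact: infinite_degree_bound mS S_pair d'0.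
exists (2 * ((size (classes l)).+1)%:R) => T d mT.
have K0 : 0 <= 2 * ((size (classes l)).+1)%:R :> R by rewrite mulr_ge0.
have [|[T' [d' [mT' dd' T'0]]]] := min_zero_sum_raise rdP mT; first by move/le_trans; exact.
apply: (le_trans dd'); have [|[S [mS S0 S_pair]]] := min_zero_sum_pairwise rdP mT' T'0.
  by move/le_trans; exact.
have [d'0|/le_trans] := ltP 0 d'; last exact.
apply: (le_trans (degree_size rdP mS)); rewrite ler_pM2l // ler_nat.
apply: (finite_size_bound rdP _ mS S_pair S0 d'0) => x xP.
by apply/negPn/negP => xl; apply: lP; exists x.
Qed.

End DegreeBound.

(** * A reductive level acting faithfully and diagonally *)

(** The hypothesis drops a repeated linear factor from any split polynomial in A that kills v, so
    the squarefree part of the minimal polynomial already annihilates A. *)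
Lemma diagonalizable_semisimple (K : closedFieldType) n (A : 'M[K]_n) :
  (forall (a : K) (v : 'rV_n), v *m (A - a%:M) *m (A - a%:M) = 0 -> v *m (A - a%:M) = 0) ->
  diagonalizable A.
Proof.
case: n A => [|n] A ss.
  by exists 1%:M; rewrite ?unitmx1 // /similar_to flatmx0; apply/is_diag_mxP => -[].
have drop_mult (s : seq K) (v : 'rV_n.+1) :
    v *m horner_mx A (\prod_(z <- s) ('X - z%:P)) = 0 ->
    v *m horner_mx A (\prod_(z <- undup s) ('X - z%:P)) = 0.
  elim: s v => //= z s IH v.
  rewrite big_cons rmorphM /= rmorphB /= horner_mx_X horner_mx_C -mulmxE mulmxA.
  move=> /IH; case: ifP => zs.
    rewrite (bigD1_seq z) ?undup_uniq ?mem_undup //= rmorphM /= rmorphB /=.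
    set Q := horner_mx A (\prod_(_ <- _ | _) _).
    rewrite horner_mx_X horner_mx_C -!mulmxE.
    have QC : (A - z%:M) *m Q = Q *m (A - z%:M).
      have -> : A - z%:M = horner_mx A ('X - z%:P) by rewrite rmorphB /= horner_mx_X horner_mx_C.
      by rewrite /Q !mulmxE -!rmorphM /= mulrC.
    rewrite QC !mulmxA => H; apply: ss; move: H.
    by rewrite -!(mulmxA v) QC !mulmxA -(mulmxA (v *m Q)).
  by rewrite big_cons rmorphM /= rmorphB /= horner_mx_X horner_mx_C -mulmxE mulmxA.
have [r pE] := closed_field_poly_normal (mxminpoly A).
rewrite (monicP (mxminpoly_monic A)) scale1r in pE.
apply/diagonalizableP; exists (undup r); first exact: undup_uniq.
apply: mxminpoly_min; apply/row_matrixP => i; rewrite rowE row0.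
apply: drop_mult; rewrite -pE mx_root_minpoly mulmx0 //.
Qed.

(** * Subspaces, bilinear maps and eigenvectors *)

Section Subspace.
Variables (K : fieldType) (g : lmodType K).
Implicit Types (S L : g -> Prop).

Lemma subspace0 S : subspace S -> S 0. Proof. by case. Qed.
Lemma subspaceZ S a x : subspace S -> S x -> S (a *: x).
Proof. by move=> [S0 SD] Sx; rewrite -[_ *: _]addr0; apply: SD. Qed.
Lemma subspaceD S x y : subspace S -> S x -> S y -> S (x + y).
Proof. by move=> [S0 SD] Sx Sy; rewrite -[x]scale1r; apply: SD. Qed.
Lemma subspaceB S x y : subspace S -> S x -> S y -> S (x - y).
Proof. by move=> sS Sx Sy; apply: subspaceD => //; rewrite -scaleN1r; apply: subspaceZ. Qed.
Lemma subspace_sum S (I : Type) (s : seq I) (F : I -> g) :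
  subspace S -> (forall i, S (F i)) -> S (\sum_(i <- s) F i).
Proof.
move=> sS SF; elim: s => [|i s IH]; first by rewrite big_nil; exact: subspace0.
by rewrite big_cons; apply: subspaceD.
Qed.

Definition spans n (b : 'I_n -> g) S :=
  (forall i, S (b i)) /\ forall x, S x -> exists c : 'I_n -> K, x = \sum_i c i *: b i.

Definition free_family n (b : 'I_n -> g) :=
  forall c : 'I_n -> K, \sum_i c i *: b i = 0 -> forall i, c i = 0.

(** The [e i] need not lie in S. The vectors of S in the span of the last n of them are handled by
    induction, and a single further vector of S accounts for the first coordinate. *)
Lemma subspace_spans n (e : 'I_n -> g) S : subspace S ->
  (forall x, S x -> exists c : 'I_n -> K, x = \sum_i c i *: e i) ->
  exists m (b : 'I_m -> g), spans b S.
Proof.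
elim: n e S => [|n IH] e S sS Se.
  by exists 0%N, e; split=> // -[].
pose S' x := S x /\ exists c : 'I_n -> K, x = \sum_i c i *: e (lift ord0 i).
have [||m [b [bS' b_span]]] := IH (fun i => e (lift ord0 i)) S'.
- split; first split; first exact: subspace0.
    by exists (fun=> 0); rewrite big1 // => i _; rewrite scale0r.
  move=> a x y [Sx [c xE]] [Sy [d yE]]; split; first by case: sS => _ sD; apply: sD.
  exists (fun i => a * c i + d i); rewrite xE yE scaler_sumr -big_split /=.
  by apply: eq_bigr => i _; rewrite scalerDl scalerA.
- by move=> x [].
have [all_S'|/existsNP[x0 /not_implyP[Sx0 nS'x0]]] := pselect (forall x, S x -> S' x).
  exists m, b; split; first by move=> i; case: (bS' i).
  by move=> x /all_S'; apply: b_span.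
have [c x0E] := Se x0 Sx0.
have c0 : c ord0 != 0.
  apply/eqP => c0; apply: nS'x0; split=> //; exists (fun i => c (lift ord0 i)).
  by rewrite {1}x0E big_ord_recl c0 scale0r add0r.
exists m.+1, (fun i => oapp b x0 (unlift ord0 i)); split.
  by move=> i; case: unliftP => [j|] _ //=; case: (bS' j).
move=> x Sx; have [d xE] := Se x Sx; pose q := d ord0 / c ord0.
have [|f fE] := b_span (x - q *: x0).
  split; first by apply: subspaceB => //; apply: subspaceZ.
  exists (fun i => d (lift ord0 i) - q * c (lift ord0 i)).
  rewrite {1}xE {1}x0E !big_ord_recl scalerDr scalerA divfK // opprD addrACA subrr add0r.
  rewrite scaler_sumr -sumrB; apply: eq_bigr => i _.
  by rewrite scalerBl scalerA.
exists (fun i => oapp f q (unlift ord0 i)); rewrite big_ord_recl unlift_none /=.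
rewrite -[x in LHS](subrK (q *: x0)) fE addrC; congr (_ + _).
by apply: eq_bigr => i _; rewrite liftK.
Qed.

Lemma spans_free n (b : 'I_n -> g) S : spans b S ->
  exists m (b' : 'I_m -> g), spans b' S /\ free_family b'.
Proof.
elim: n b => [|n IH] b bS; first by exists 0%N, b; split=> // c _ [].
have [fb|/existsNP[c /not_implyP[cb /existsNP[i ci]]]] := pselect (free_family b).
  by exists n.+1, b.
have [bS1 bS2] := bS; apply: (IH (fun j => b (lift i j))); split=> // x /bS2[d ->].
have biE : b i = \sum_j (- (c (lift i j) / c i)) *: b (lift i j).
  have cb' : c i *: b i + \sum_j c (lift i j) *: b (lift i j) = 0.
    by move: cb; rewrite (bigD1_ord i).
  have/eqP c0 := ci; apply: (scalerI c0); move/eqP: cb'; rewrite addr_eq0 => /eqP ->.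
  rewrite scaler_sumr -sumrN; apply: eq_bigr => j _.
  by rewrite scalerA mulrN mulrC divfK // scaleNr.
exists (fun j => d (lift i j) - d i * (c (lift i j) / c i)).
rewrite (bigD1_ord i) //= biE scaler_sumr -big_split /=; apply: eq_bigr => j _.
by rewrite scalerA mulrN addrC scalerDl.
Qed.

End Subspace.

Section Bilinear.
Variables (K : fieldType) (U V W : lmodType K) (f : U -> V -> W).
Hypothesis fl : forall a x y v, f (a *: x + y) v = a *: f x v + f y v.
Hypothesis fr : forall a x v w, f x (a *: v + w) = a *: f x v + f x w.

Lemma bilDl x y v : f (x + y) v = f x v + f y v.
Proof. by rewrite -[x in LHS]scale1r fl scale1r. Qed.
Lemma bilDr x v w : f x (v + w) = f x v + f x w.
Proof. by rewrite -[v in LHS]scale1r fr scale1r. Qed.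
Lemma bil0l v : f 0 v = 0.
Proof. by apply: (@addrI _ (f 0 v)); rewrite -bilDl !addr0. Qed.
Lemma bil0r x : f x 0 = 0.
Proof. by apply: (@addrI _ (f x 0)); rewrite -bilDr !addr0. Qed.
Lemma bilZl a x v : f (a *: x) v = a *: f x v.
Proof. by rewrite -[a *: x]addr0 fl bil0l addr0. Qed.
Lemma bilZr a x v : f x (a *: v) = a *: f x v.
Proof. by rewrite -[a *: v]addr0 fr bil0r addr0. Qed.
Lemma bilNl x v : f (- x) v = - f x v.
Proof. by rewrite -scaleN1r bilZl scaleN1r. Qed.
Lemma bilNr x v : f x (- v) = - f x v.
Proof. by rewrite -scaleN1r bilZr scaleN1r. Qed.
Lemma bil_suml (I : Type) (s : seq I) (F : I -> U) v :
  f (\sum_(i <- s) F i) v = \sum_(i <- s) f (F i) v.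
Proof. by elim: s => [|i s IH]; rewrite ?big_nil ?bil0l // !big_cons bilDl IH. Qed.
Lemma bil_sumr (I : Type) (s : seq I) (F : I -> V) x :
  f x (\sum_(i <- s) F i) = \sum_(i <- s) f x (F i).
Proof. by elim: s => [|i s IH]; rewrite ?big_nil ?bil0r // !big_cons bilDr IH. Qed.
End Bilinear.

Section Eigenvectors.
Variables (K : fieldType) (V : lmodType K).

(* A vector that is an eigenvector and also a sum of eigenvectors, each of which
   some operator of the family separates from it, vanishes. *)
Lemma eigen_sum_eq0 (I : Type) (f : I -> V -> V) (mu : I -> K) n (nu : 'I_n -> I -> K)
    (w : 'I_n -> V) (v : V) :
  (forall i a x y, f i (a *: x + y) = a *: f i x + f i y) ->
  (forall i, f i v = mu i *: v) -> (forall k i, f i (w k) = nu k i *: w k) ->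
  (forall k, exists i, nu k i != mu i) -> v = \sum_k w k -> v = 0.
Proof.
move=> flin; elim: n nu w v => [|n IH] nu w v fv fw sep vE; first by rewrite vE big_ord0.
have [i inu] := sep ord0.
have f0 j : f j 0 = 0.
  by apply: (@addrI _ (f j 0)); rewrite -{1}[f j 0]scale1r -flin scaler0 !addr0.
have fZ j a x : f j (a *: x) = a *: f j x by rewrite -[a *: x]addr0 flin f0 addr0.
have fD j x y : f j (x + y) = f j x + f j y by rewrite -[x in LHS]scale1r flin scale1r.
have fS j m (F : 'I_m -> V) : f j (\sum_k F k) = \sum_k f j (F k).
  by apply: (big_morph (f j)).
have : (mu i - nu ord0 i) *: v = 0.
  apply: (IH (fun k => nu (lift ord0 k)) (fun k => (nu (lift ord0 k) i - nu ord0 i) *: w (lift ord0 k))).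
  - by move=> j; rewrite fZ fv !scalerA mulrC.
  - by move=> k j; rewrite fZ fw !scalerA mulrC.
  - by move=> k.
  rewrite scalerBl -fv {1}vE fS big_ord_recl fw {1}vE big_ord_recl scalerDr.
  rewrite opprD addrACA subrr add0r scaler_sumr -sumrB.
  by apply: eq_bigr => k _; rewrite fw scalerBl.
by move/eqP; rewrite scaler_eq0 subr_eq0 eq_sym (negPf inu) => /eqP.
Qed.
End Eigenvectors.

(** * The faithful ideal of one level and its weight basis *)

Section Level.
Variables (K : numClosedFieldType) (g : lmodType K) (br : g -> g -> g).
Variables (V : lmodType K) (act : g -> V -> V) (L H : g -> Prop).
Hypothesis brP : is_lie_bracket br.
Hypothesis actP : is_rep br act.
Hypothesis redL : reductive br L.
Hypothesis carH : cartan_of br L H.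
Hypothesis wtV : weight_module act H.

Lemma brl a x y z : br (a *: x + y) z = a *: br x z + br y z. Proof. by case: brP. Qed.
Lemma brr a x y z : br x (a *: y + z) = a *: br x y + br x z. Proof. by case: brP. Qed.
Lemma brxx x : br x x = 0. Proof. by case: brP. Qed.
Lemma brC x y : br x y = - br y x.
Proof.
apply/eqP; rewrite -addr_eq0; apply/eqP; have := brxx (x + y).
by rewrite (bilDl brl) !(bilDr brr) !brxx add0r addr0.
Qed.
Lemma jacobi x y z : br x (br y z) = br (br x y) z + br y (br x z).
Proof.
have [_ _ _ J] := brP; have := J x y z.
rewrite (brC z (br x y)) (brC z x) (bilNr brr) => E.
by apply/eqP; rewrite -subr_eq0 [X in _ - X]addrC opprD addrA E.
Qed.

Lemma actl a x y v : act (a *: x + y) v = a *: act x v + act y v. Proof. by case: actP. Qed.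
Lemma actr a x v w : act x (a *: v + w) = a *: act x v + act x w. Proof. by case: actP. Qed.
Lemma act_br x y v : act (br x y) v = act x (act y v) - act y (act x v). Proof. by case: actP. Qed.

Definition act0 x := forall v, act x v = 0.

Lemma sL : subspace L. Proof. by case: redL => -[]. Qed.
Lemma brL x y : L x -> L y -> L (br x y). Proof. by case: redL => -[_ bL] _; exact: bL. Qed.
Lemma HL x : H x -> L x. Proof. by case: carH => _ [+ _]; exact. Qed.
Lemma sH : subspace H. Proof. by case: carH => -[]. Qed.
Lemma H_self x : L x -> (forall h, H h -> br x h = 0) -> H x.
Proof.
case: carH => _ [_ [_ sn]] Lx xH; apply: sn => // h Hh.
by rewrite xH //; exact: subspace0 sH.
Qed.

Lemma act0_br x y : act0 x -> act0 (br y x).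
Proof. by move=> x0 v; rewrite act_br !x0 (bil0r actr) subrr. Qed.

(** The elements of L acting by zero form an ideal, which reductivity splits off. Identities in the
    complement can then be verified on the module. *)
Lemma faithful_complement : exists J, [/\ ideal_of br L J,
  forall x, J x -> act0 x -> x = 0 &
  forall x, L x -> exists i j, [/\ L i, act0 i, J j & x = i + j]].
Proof.
have [_ [_ compl]] := redL; pose I x := L x /\ act0 x.
have [|J [idJ [IJ LIJ]]] := compl I.
  split; first split.
  - by split; [exact: subspace0 sL | move=> v; rewrite (bil0l actl)].
  - move=> a x y [Lx x0] [Ly y0]; split; last by move=> v; rewrite actl x0 y0 scaler0 addr0.
    by apply: (subspaceD sL) => //; apply: (subspaceZ _ sL).
  by split=> [x []//|x y Lx [Ly y0]]; split; [exact: brL | exact: act0_br].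
exists J; split=> //; first by move=> x Jx x0; apply: IJ => //; split=> //; case: idJ => _ [+ _]; exact.
by move=> x /LIJ[i [j [[Li i0] [Jj xE]]]]; exists i, j.
Qed.

(** Simultaneously diagonal operators commute; for a nilpotent H this is the available form of
    commutativity. *)
Lemma act0_brH h h' : H h -> H h' -> act0 (br h h').
Proof.
move=> Hh Hh' v; have [n [lam [w [ww ->]]]] := wtV v.
rewrite (bil_sumr actr) big1 // => i _.
by rewrite act_br !(ww i _ Hh, ww i _ Hh', bilZr actr) !scalerA mulrC subrr.
Qed.

Section Complement.
Variable J : g -> Prop.
Hypothesis idJ : ideal_of br L J.
Hypothesis faithJ : forall x, J x -> act0 x -> x = 0.
Hypothesis decJ : forall x, L x -> exists i j, [/\ L i, act0 i, J j & x = i + j].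

Lemma sJ : subspace J. Proof. by case: idJ. Qed.
Lemma JL x : J x -> L x. Proof. by case: idJ => _ [+ _]; exact. Qed.
Lemma brLJ x y : L x -> J y -> J (br x y). Proof. by case: idJ => _ [_ +]; exact. Qed.
Lemma br_act0J x y : L x -> act0 x -> J y -> br x y = 0.
Proof.
move=> Lx x0 Jy; apply: faithJ; first exact: brLJ.
by move=> v; rewrite act_br !x0 (bil0r actr) subrr.
Qed.
Lemma eqJ x y : J x -> J y -> (forall v, act x v = act y v) -> x = y.
Proof.
move=> Jx Jy xy; apply/subr0_eq/faithJ; first exact: (subspaceB sJ).
by move=> v; rewrite (bilDl actl) (bilNl actl) xy subrr.
Qed.

(** On a vector w of weight lam, h - (lam h + a) sends u w to z w and kills z w. Since u w is a sum
    of eigenvectors of h, this forces z w = 0. *)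
Lemma ad_semisimple h a u : H h -> J u ->
  br h (br h u - a *: u) = a *: (br h u - a *: u) -> br h u = a *: u.
Proof.
move=> Hh Ju; set z := _ - _ => hz; apply: subr0_eq; rewrite -/z.
have Jz : J z by apply: (subspaceB sJ); [exact/brLJ/Ju/HL | exact: (subspaceZ _ sJ)].
apply: faithJ => // v; have [n [lam [w [ww ->]]]] := wtV v.
rewrite (bil_sumr actr) big1 // => i _.
pose b := lam i h + a.
have huE : br h u = z + a *: u by rewrite /z subrK.
have hu : act h (act u (w i)) = b *: act u (w i) + act z (w i).
  have := act_br h u (w i).
  rewrite huE (bilDl actl) (bilZl actl) (ww i _ Hh) (bilZr actr) => /eqP.
  rewrite eq_sym subr_eq => /eqP ->.
  by rewrite /b scalerDl [LHS]addrC -[RHS]addrA; congr (_ + _); exact: addrC.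
have hzw : act h (act z (w i)) = b *: act z (w i).
  have := act_br h z (w i); rewrite hz (bilZl actl) (ww i _ Hh) (bilZr actr) => /eqP.
  by rewrite eq_sym subr_eq addrC => /eqP ->; rewrite -scalerDl.
have [p [mu [y [wy uE]]]] := wtV (act u (w i)).
(* A term with [mu k h = b] has coefficient 0, hence is the zero vector; it gets the eigenvalue b +
   1 so that it too is separated from b. *)
apply: (@eigen_sum_eq0 _ _ unit (fun=> act h) (fun=> b) p
  (fun k _ => if mu k h == b then b + 1 else mu k h) (fun k => (mu k h - b) *: y k)) => //.
- by move=> _ c x1 x2; exact: actr.
- by move=> k _; rewrite (bilZr actr) (wy k h Hh) !scalerA; case: eqVneq => [->|_];
    rewrite 1?mulrC // subrr !(mulr0, mul0r).
- move=> k; exists tt; case: ifP => [_|/negbT //].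
  by rewrite -subr_eq0 addrC addKr oner_eq0.
have -> : act z (w i) = act h (act u (w i)) - b *: act u (w i).
  by rewrite hu addrC addKr.
rewrite uE (bil_sumr actr) scaler_sumr -sumrB; apply: eq_bigr => k _.
by rewrite (wy k h Hh) scalerBl.
Qed.

(** On J the operators ad h commute, because brackets in H act by zero and so annihilate J, and each
    is diagonalizable by [ad_semisimple]. A finite spanning family of H is diagonalized
    simultaneously. *)
Lemma weight_basis : exists m (b : 'I_m -> g) (beta : 'I_m -> g -> K),
  [/\ spans b J, free_family b & forall i h, H h -> br h (b i) = beta i h *: b i].
Proof.
have [_ [[p [e [_ e_span]]] _]] := redL.
have [m0 [b0 b0s]] := subspace_spans sJ (fun x Jx => e_span x (JL Jx)).
have [m [b [[bJ b_span] bf]]] := spans_free b0s.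
have [q [hs [hsH hs_span]]] := subspace_spans sH (fun x Hx => e_span x (HL Hx)).
pose vec (v : 'rV_m) := \sum_i v 0 i *: b i.
have vecB u v : vec (u - v) = vec u - vec v.
  by rewrite /vec -sumrB; apply: eq_bigr => i _; rewrite !mxE scalerBl.
have vecZ a v : vec (a *: v) = a *: vec v.
  by rewrite /vec scaler_sumr; apply: eq_bigr => i _; rewrite !mxE scalerA.
have vecJ v : J (vec v).
  by apply: (subspace_sum _ sJ) => i; apply: (subspaceZ _ sJ).
have vec_eq0 v : vec v = 0 -> v = 0 by move/bf => v0; apply/rowP => i; rewrite v0 mxE.
have vec_inj u v : vec u = vec v -> u = v.
  by move=> uv; apply/subr0_eq/vec_eq0; rewrite vecB uv subrr.
have /choice[coord coordE] x : exists c : 'I_m -> K, J x -> x = \sum_i c i *: b i.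
  by have [/b_span[c ->]|nJ] := pselect (J x); [exists c | exists (fun=> 0)].
pose D x : 'M_m := \matrix_(i, j) coord (br x (b i)) j.
have vecD x v : L x -> br x (vec v) = vec (v *m D x).
  move=> Lx; rewrite /vec (bil_sumr brr).
  transitivity (\sum_i \sum_j (v 0 i * D x i j) *: b j).
    apply: eq_bigr => i _; rewrite (bilZr brr) (coordE _ (brLJ Lx (bJ i))) scaler_sumr.
    by apply: eq_bigr => j _; rewrite scalerA mxE.
  by rewrite exchange_big; apply: eq_bigr => j _; rewrite mxE scaler_suml.
have comm h h' : H h -> H h' -> comm_mx (D h) (D h').
  move=> Hh Hh'; apply/row_matrixP => i; rewrite !rowE !mulmxA; apply: vec_inj.
  rewrite -(vecD _ _ (HL Hh')) -(vecD _ _ (HL Hh)) -(vecD _ _ (HL Hh)) -(vecD _ _ (HL Hh')).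
  rewrite jacobi (br_act0J _ (act0_brH Hh' Hh)) ?add0r //.
  by apply: brL; apply: HL.
have diag h : H h -> diagonalizable (D h).
  move=> Hh; apply: diagonalizable_semisimple => a v vDD0.
  have vecDa u : vec (u *m (D h - a%:M)) = br h (vec u) - a *: vec u.
    by rewrite mulmxBr mul_mx_scalar vecB vecZ -(vecD _ _ (HL Hh)).
  apply: vec_eq0; rewrite vecDa; apply/eqP; rewrite subr_eq0; apply/eqP.
  apply: (ad_semisimple Hh (vecJ v)); apply/eqP; rewrite -subr_eq0 -vecDa -vecDa vDD0.
  by rewrite /vec big1 // => i _; rewrite mxE scale0r.
have [P Pu /allP Pdiag] : codiagonalizable [seq D (hs k) | k <- enum 'I_q].
  apply/codiagonalizableP; split; last by move=> _ /mapP[k _ ->]; exact: diag.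
  by move=> _ _ /mapP[k _ ->] /mapP[l _ ->]; exact: comm.
have /choice[d dE] k : exists d : 'rV_m, P *m D (hs k) = diag_mx d *m P.
  have /Pdiag : D (hs k) \in [seq D (hs k) | k <- enum 'I_q].
    by apply: map_f; rewrite mem_enum.
  rewrite /= /similar_to conjumx // => /diag_mxP[d dE]; exists d.
  by rewrite -dE mulmxKV.
pose b' i := vec (row i P).
have vec_comb (w : 'rV_m) : vec (w *m P) = \sum_i w 0 i *: b' i.
  rewrite /b' /vec.
  transitivity (\sum_i \sum_j (w 0 i * P i j) *: b j).
    by rewrite exchange_big; apply: eq_bigr => j _; rewrite mxE scaler_suml.
  by apply: eq_bigr => i _; rewrite scaler_sumr; apply: eq_bigr => j _; rewrite scalerA mxE.
have /choice[gam gamE] h : exists c : 'I_q -> K, H h -> h = \sum_k c k *: hs k.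
  by have [/hs_span[c ->]|nH] := pselect (H h); [exists c | exists (fun=> 0)].
exists m, b', (fun i h => \sum_k gam h k * d k 0 i); split.
- split=> [i|x /b_span[c ->]]; first exact: vecJ.
  pose w := (\row_j c j) *m invmx P; exists (fun i => w 0 i).
  have -> : \sum_i c i *: b i = vec (w *m P).
    by rewrite /w mulmxKV // /vec; apply: eq_bigr => i _; rewrite mxE.
  by rewrite vec_comb.
- move=> c cb i; have : vec ((\row_j c j) *m P) = 0.
    by rewrite vec_comb -[RHS]cb; apply: eq_bigr => j _; rewrite mxE.
  move=> /vec_eq0 /(congr1 (mulmxr (invmx P))) /=; rewrite mulmxK // mul0mx.
  by move/rowP => /(_ i); rewrite !mxE.
move=> i h Hh; rewrite [in LHS](gamE h Hh) (bil_suml brl) scaler_suml; apply: eq_bigr => k _.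
rewrite (bilZl brl) /b' (vecD _ _ (HL (hsH k))) -row_mul dE -scalerA; congr (_ *: _).
by rewrite -vecZ row_mul row_diag_mx -scalemxAl -rowE.
Qed.

(** * Trace form, Cartan's criterion and sl2-triples *)

Section WeightBasis.
Variables (m : nat) (b : 'I_m -> g) (beta : 'I_m -> g -> K) (coord : g -> 'I_m -> K).
Hypothesis bJ : forall i, J (b i).
Hypothesis coordE : forall x, J x -> x = \sum_i coord x i *: b i.
Hypothesis bf : free_family b.
Hypothesis bw : forall i h, H h -> br h (b i) = beta i h *: b i.

Lemma coord_uniq (c d : 'I_m -> K) : \sum_i c i *: b i = \sum_i d i *: b i -> forall i, c i = d i.
Proof.
move=> cd i; apply/subr0_eq; apply: (bf (c := fun i => c i - d i)).
by rewrite (eq_bigr (fun i => c i *: b i - d i *: b i)) ?sumrB ?cd ?subrr // => j _; rewrite scalerBl.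
Qed.

Lemma coord_sum (c : 'I_m -> K) i : coord (\sum_i c i *: b i) i = c i.
Proof.
apply: (coord_uniq (c := coord _)); rewrite -coordE //.
by apply: (subspace_sum _ sJ) => j; apply: (subspaceZ _ sJ).
Qed.

Lemma coordP a x y i : J x -> J y -> coord (a *: x + y) i = a * coord x i + coord y i.
Proof.
move=> Jx Jy; rewrite {1}(coordE Jx) {1}(coordE Jy) scaler_sumr -big_split /=.
rewrite (eq_bigr (fun i => (a * coord x i + coord y i) *: b i)) ?coord_sum //.
by move=> j _; rewrite scalerDl scalerA.
Qed.

(** Matrices act on row vectors, which reverses the order of products in [ad_mx_br]. *)
Definition ad_mx x : 'M[K]_m := \matrix_(i, j) coord (br x (b i)) j.
Local Notation D := ad_mx.

Lemma ad_mxP a x y : L x -> L y -> D (a *: x + y) = a *: D x + D y.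
Proof.
by move=> Lx Ly; apply/matrixP => i j; rewrite !mxE brl coordP //; exact: brLJ.
Qed.

Lemma ad_mx_sum (I : Type) (s : seq I) (c : I -> K) (F : I -> g) : (forall i, L (F i)) ->
  D (\sum_(i <- s) c i *: F i) = \sum_(i <- s) c i *: D (F i).
Proof.
move=> LF; elim: s => [|i s IH].
  rewrite !big_nil; apply/matrixP => i j; rewrite !mxE (bil0l brl).
  by have := coord_sum (fun=> 0) j; rewrite big1 // => k _; rewrite scale0r.
rewrite !big_cons ad_mxP ?IH //.
by apply: (subspace_sum _ sL) => j; exact: (subspaceZ _ sL).
Qed.

Lemma br_b x i : L x -> br x (b i) = \sum_j D x i j *: b j.
Proof. by move=> Lx; rewrite (coordE (brLJ Lx (bJ i))); apply: eq_bigr => j _; rewrite mxE. Qed.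

Lemma ad_mx_br x y : L x -> L y -> D (br x y) = D y *m D x - D x *m D y.
Proof.
move=> Lx Ly; have comp u v i : L u -> L v -> br u (br v (b i)) = \sum_j (D v *m D u) i j *: b j.
  move=> Lu Lv; rewrite br_b // (bil_sumr brr).
  transitivity (\sum_k \sum_j (D v i k * D u k j) *: b j).
    by apply: eq_bigr => k _; rewrite (bilZr brr) br_b // scaler_sumr; apply: eq_bigr => j _; rewrite scalerA.
  by rewrite exchange_big; apply: eq_bigr => j _; rewrite mxE scaler_suml.
apply/matrixP => i; apply: coord_uniq; rewrite -br_b; last exact: brL.
have := jacobi x y (b i); rewrite comp // comp // => /eqP; rewrite -subr_eq => /eqP <-.
by rewrite -sumrB; apply: eq_bigr => j _; rewrite !mxE scalerBl.
Qed.

Lemma ad_mx_diag h : H h -> D h = diag_mx (\row_i beta i h).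
Proof.
move=> Hh; apply/matrixP => i; apply: coord_uniq; rewrite -br_b; last exact: HL.
rewrite bw // (bigD1 i) //= !mxE eqxx mulr1n big1 ?addr0 // => j ji.
by rewrite !mxE eq_sym (negPf ji) mulr0n scale0r.
Qed.

Lemma ad_mx_weight x h a i j : L x -> H h -> br h x = a *: x ->
  D x i j != 0 -> beta j h = beta i h + a.
Proof.
move=> Lx Hh hx Dij; apply: (mulIf Dij).
have := jacobi h x (b i); rewrite hx (bw i Hh) (bilZl brl) (bilZr brr) -scalerDl (br_b _ Lx).
rewrite (bil_sumr brr) scaler_sumr => E.
have : \sum_j (beta j h * D x i j) *: b j = \sum_j ((a + beta i h) * D x i j) *: b j.
  rewrite [RHS](eq_bigr (fun j => (a + beta i h) *: (D x i j *: b j))); last by move=> k _; rewrite scalerA.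
  by rewrite -E; apply: eq_bigr => k _; rewrite (bilZr brr) bw // scalerA mulrC.
by move/coord_uniq => ->; rewrite addrC.
Qed.

Definition tr_form x y := \tr (D x *m D y).
Local Notation tau := tr_form.

Lemma tauC x y : tau x y = tau y x. Proof. exact: mxtrace_mulC. Qed.
Lemma taul a x y z : L x -> L y -> tau (a *: x + y) z = a * tau x z + tau y z.
Proof. by move=> Lx Ly; rewrite /tau ad_mxP // mulmxDl -scalemxAl mxtraceD mxtraceZ. Qed.
Lemma tau_inv x y z : L x -> L y -> L z -> tau (br x y) z = tau x (br y z).
Proof.
move=> Lx Ly Lz; rewrite /tau !ad_mx_br // mulmxBl mulmxBr !mxtraceD !raddfN /=.
by rewrite -(mulmxA (D y)) (mxtrace_mulC (D y)) !mulmxA.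
Qed.
Lemma tauZl a x z : L x -> tau (a *: x) z = a * tau x z.
Proof.
move=> Lx; have L0 := subspace0 sL; have := taul 1 z L0 L0; rewrite scaler0 addr0 mul1r => E.
have t0 : tau 0 z = 0 by apply: (@addrI _ (tau 0 z)); rewrite addr0 -E.
by rewrite -[a *: x]addr0 taul // t0 addr0.
Qed.

(* Complex conjugation of the eigenvalues replaces the rational linear forms
   of the usual proof of Cartan's criterion. *)
Definition conj_mx d : 'M[K]_m := diag_mx (\row_i (beta i d)^*).

Lemma conj_trace d : H d -> \tr (conj_mx d *m D d) = 0 -> forall i, beta i d = 0.
Proof.
move=> Hd; rewrite ad_mx_diag // /conj_mx mulmx_diag mxtrace_diag => E i.
have := E; rewrite (eq_bigr (fun i => `|beta i d| ^+ 2)); last first.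
  by move=> j _; rewrite !mxE normCK mulrC.
move/eqP; rewrite psumr_eq0; last by move=> j _; rewrite exprn_ge0.
by move=> /allP /(_ i); rewrite mem_index_enum => /(_ isT); rewrite /= expf_eq0 normr_eq0 /= => /eqP.
Qed.

(** The nonzero entries of [D x] link d-eigenvalues that differ by a, hence conjugates that differ
    by [a^*]. *)
Lemma conj_mx_comm x d a : L x -> H d -> br d x = a *: x ->
  D x *m conj_mx d - conj_mx d *m D x = a^* *: D x.
Proof.
move=> Lx Hd dx; apply/matrixP => i j; rewrite mul_mx_diag mul_diag_mx !mxE.
case: (eqVneq (coord (br x (b i)) j) 0) => [->|Dij]; first by rewrite !(mulr0, mul0r) subrr.
have := @ad_mx_weight x d a i j Lx Hd dx; rewrite mxE => /(_ Dij) ->.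
by rewrite rmorphD /=; ring.
Qed.

(** A complementary ideal brackets A to 0, so only the A-component of z acts on x; that component
    still commutes with H because both ideals are stable under H. *)
Lemma ideal_split A z x : ideal_of br L A -> L z -> (forall h, H h -> br h z = 0) -> A x ->
  exists a, [/\ A a, forall h, H h -> br h a = 0 & br a x = br z x].
Proof.
move=> [sA [AL brA]] Lz zH Ax; have [_ [_ compl]] := redL.
have [C [[sC [CL brCA]] [AC LAC]]] := compl A (conj sA (conj AL brA)).
have [a [c [Aa [Cc zE]]]] := LAC z Lz; exists a; split=> // [h Hh|].
  apply: AC; first exact: (brA _ _ (HL Hh)).
  have := zH h Hh; rewrite zE (bilDr brr) => /eqP; rewrite addr_eq0 => /eqP ->.
  by rewrite -scaleN1r; apply: (subspaceZ _ sC); apply: brCA; [exact: HL|].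
rewrite zE (bilDl brl) [X in _ + X](_ : _ = 0) ?addr0 //.
apply: AC; first by apply: brA => //; exact: CL.
by rewrite brC -scaleN1r; apply: (subspaceZ _ sC); apply: brCA => //; exact: AL.
Qed.

Definition radical s := J s /\ forall y, J y -> tau s y = 0.

Lemma radical_ideal : ideal_of br L radical.
Proof.
have J0 := subspace0 sJ; split; first split.
- split=> // y Jy; have := tauZl 0 y (JL J0); rewrite scaler0 mul0r; exact.
- move=> a s s' [Js s0] [Js' s'0]; split; first by apply: (subspaceD sJ) => //; exact: (subspaceZ _ sJ).
  by move=> y Jy; rewrite (taul _ _ (JL Js) (JL Js')) s0 // s'0 // mulr0 addr0.
split=> [s [/JL]//|l s Ll [Js s0]]; split; first exact: brLJ.
move=> y Jy; rewrite brC -scaleN1r tauZl; last by apply: brL => //; exact: JL.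
by rewrite (tau_inv (JL Js) Ll (JL Jy)) s0 ?mulr0 //; exact: brLJ.
Qed.

Definition derived (S : g -> Prop) z := exists s : seq (g * g),
  (forall p, p \in s -> S p.1 /\ S p.2) /\ z = \sum_(p <- s) br p.1 p.2.

Lemma derived_ideal S : ideal_of br L S -> ideal_of br L (derived S).
Proof.
move=> [sS [SL brS]]; split; first split.
- by exists [::]; rewrite big_nil.
- move=> a _ _ [s [Ss ->]] [t [St ->]]; exists ([seq (a *: p.1, p.2) | p <- s] ++ t); split.
    move=> p; rewrite mem_cat => /orP[/mapP[p' /Ss[S1 S2] ->]|/St//].
    by split=> //=; exact: (subspaceZ _ sS).
  rewrite big_cat big_map scaler_sumr /=; congr (_ + _).
  by apply: eq_bigr => p _; rewrite (bilZl brl).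
split=> [_ [s [Ss ->]]|l _ Ll [s [Ss ->]]].
  rewrite big_seq; elim/big_ind: _ => [|x y|p /Ss[S1 S2]]; first exact: subspace0 sL.
    exact: (subspaceD sL).
  by apply: brL; exact: SL.
exists ([seq (br l p.1, p.2) | p <- s] ++ [seq (p.1, br l p.2) | p <- s]); split.
  by move=> p; rewrite mem_cat => /orP[] /mapP[p' /Ss[S1 S2] ->]; split=> //=; apply: brS.
rewrite big_cat !big_map /= (bil_sumr brr) -big_split /=.
by apply: eq_bigr => p _; exact: jacobi.
Qed.

(** Cycling the trace moves the commutator from the pair p to [conj_mx d] and [D p.1]. That
    commutator is [D du] with [du] in J, to which the radical element [p.2] is orthogonal. *)
Lemma conj_trace_derived d : H d -> derived radical d -> \tr (conj_mx d *m D d) = 0.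
Proof.
move=> Hd [s [Ss dE]].
have -> : D d = \sum_(p <- s) (D p.2 *m D p.1 - D p.1 *m D p.2).
  rewrite dE; elim: s {dE} Ss => [|p s IH] Ss.
    rewrite !big_nil; apply/matrixP => i j; rewrite !mxE (bil0l brl).
    by have := coord_sum (fun=> 0) j; rewrite big1 // => k _; rewrite scale0r.
  have [[J1 _] [J2 _]] := Ss p (mem_head _ _).
  have Ss' q : q \in s -> radical q.1 /\ radical q.2 by move=> qs; apply: Ss; rewrite inE qs orbT.
  rewrite !big_cons -[br _ _]scale1r ad_mxP; last 2 first.
  - by apply: brL; exact: JL.
  - rewrite big_seq; elim/big_ind: _ => [|x y|q /Ss'[[? _] [? _]]]; first exact: subspace0 sL.
      exact: (subspaceD sL).
    by apply: brL; exact: JL.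
  by rewrite scale1r ad_mx_br ?IH //; exact: JL.
rewrite mulmx_sumr raddf_sum /= big_seq big1 // => p /Ss[[J1 _] [J2 p20]].
pose du := \sum_k (coord p.1 k * (beta k d)^*) *: b k.
have Jdu : J du by apply: (subspace_sum _ sJ) => k; exact: (subspaceZ _ sJ).
have DJ : D p.1 = \sum_k coord p.1 k *: D (b k).
  by rewrite {1}(coordE J1) ad_mx_sum // => k; exact: JL.
have Ddu : D p.1 *m conj_mx d - conj_mx d *m D p.1 = D du.
  rewrite /du ad_mx_sum; last by move=> k; exact: JL.
  rewrite DJ mulmx_suml mulmx_sumr -sumrB; apply: eq_bigr => k _.
  rewrite -scalemxAl -scalemxAr -scalerBr (conj_mx_comm (JL (bJ k)) Hd (bw k Hd)).
  by rewrite scalerA.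
have := p20 du Jdu; rewrite tauC /tau -Ddu mulmxBl raddfB /= => E.
rewrite mulmxBr raddfB /= -[RHS]E; congr (_ - _); rewrite ?mulmxA //.
by rewrite (mxtrace_mulC _ (D p.1)) !mulmxA.
Qed.

(** Suppose x is in the radical. Two splittings replace h by an element d of H in the derived ideal
    of the radical with the same bracket on x. All eigenvalues of ad d on J vanish by [conj_trace],
    although d scales x by the nonzero xi. *)
Lemma cartan_criterion x h xi : J x -> x != 0 -> H h -> br h x = xi *: x -> xi != 0 ->
  exists2 y, J y & tau x y != 0.
Proof.
move=> Jx x0 Hh hx xi0; apply: contrapT => /forall2NP ntau.
have Sx : radical x.
  by split=> // y Jy; apply/eqP/negPn/negP; case: (ntau y).
have [i [j [Li i0 Jj hE]]] := decJ (HL Hh).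
have Hj h' : H h' -> br h' j = 0.
  move=> Hh'; apply: faithJ; first by apply: brLJ => //; exact: HL.
  move=> v; have := act0_brH Hh' Hh v; rewrite hE (bilDr brr) (bilDl actl).
  by rewrite (act0_br _ i0) add0r.
have jx : br j x = xi *: x by rewrite -hx hE (bilDl brl) (br_act0J Li i0 Jx) add0r.
have [s [Ss sH0 sx]] := ideal_split radical_ideal (JL Jj) Hj Sx.
have Ls : L s by case: Ss => /JL.
have dx : derived radical x.
  exists [:: (xi^-1 *: s, x)]; split.
    move=> p; rewrite inE => /eqP -> /=; split=> //.
    by apply: subspaceZ => //; case: radical_ideal.
  by rewrite big_seq1 /= (bilZl brl) sx jx scalerA mulVf // scale1r.
have [d [Sd dH dxE]] := ideal_split (derived_ideal radical_ideal) Ls sH0 dx.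
have Ld : L d by case: (derived_ideal radical_ideal) => _ [+ _]; apply.
have Hd : H d by apply: H_self => // h' Hh'; rewrite brC dH // oppr0.
have beta0 := conj_trace Hd (conj_trace_derived Hd Sd).
move: dxE; rewrite sx jx (coordE Jx) (bil_sumr brr) big1 => [/esym/eqP|k _]; last first.
  by rewrite (bilZr brr) bw // beta0 scale0r scaler0.
by rewrite -(coordE Jx) scaler_eq0 (negPf xi0) (negPf x0).
Qed.

(** A basis vector not orthogonal to x has weight - xi by invariance, and its bracket t0 with x lies
    in H since H is self-normalizing. If xi t0 = 0, then [conj_mx t0] commutes with [D x], the trace
    argument gives [D t0 = 0], and this contradicts that t0 pairs with h0 to a nonzero value. *)
Lemma sl2_triple x xi : J x -> x != 0 -> (forall h, H h -> br h x = xi h *: x) ->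
  (exists h, H h /\ xi h != 0) ->
  exists y t, [/\ J y, H t, t = br x y, br t x = 2 *: x & forall h, H h -> br h y = - xi h *: y].
Proof.
move=> Jx x0 hx [h0 [Hh0 xih0]].
have [y0 Jy0 ty0] := cartan_criterion Jx x0 Hh0 (hx _ Hh0) xih0.
have [k tk] : exists k, tau x (b k) != 0.
  apply: contrapT => /forallNP tb; case/eqP: ty0.
  rewrite tauC /tau (coordE Jy0) ad_mx_sum; last by move=> k; exact: JL.
  rewrite mulmx_suml raddf_sum big1 //= => k _.
  rewrite -scalemxAl mxtraceZ -/(tau _ _) tauC.
  by have := tb k; move/negP/negPn/eqP => ->; rewrite mulr0.
have betak h : H h -> beta k h = - xi h.
  move=> Hh; apply/eqP; rewrite -addr_eq0 addrC; apply/eqP.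
  have := tau_inv (JL Jx) (HL Hh) (JL (bJ k)).
  rewrite (bw k Hh) (brC x) (hx h Hh) -scaleNr (tauZl _ _ (JL Jx)) [RHS]tauC.
  rewrite (tauZl _ _ (JL (bJ k))) [tau (b k) x]tauC => E.
  by apply: (mulIf tk); rewrite mul0r mulrDl -E mulNr subrr.
have Lb := JL (bJ k); pose t0 := br x (b k).
have Jt0 : J t0 by apply: brLJ => //; exact: JL.
have ht0 h : H h -> br h t0 = 0.
  move=> Hh; rewrite /t0 jacobi (hx h Hh) (bw k Hh) (bilZl brl) (bilZr brr) -scalerDl betak //.
  by rewrite subrr scale0r.
have Ht0 : H t0 by apply: H_self; [exact: JL | move=> h Hh; rewrite brC ht0 ?oppr0].
have taut h : H h -> tau t0 h = xi h * tau x (b k).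
  move=> Hh; rewrite (tau_inv (JL Jx) Lb (HL Hh)) (brC _ h) (bw k Hh) -scaleNr betak // opprK.
  by rewrite tauC (tauZl _ _ Lb) tauC.
have xit0 : xi t0 != 0.
  apply/eqP => xit0; have t0x : br t0 x = 0 *: x by rewrite hx // xit0.
  have : \tr (conj_mx t0 *m D t0) = 0.
    rewrite {2}/t0 (ad_mx_br (JL Jx) Lb) mulmxBr raddfB /=; apply/eqP; rewrite subr_eq0.
    have := conj_mx_comm (JL Jx) Ht0 t0x; rewrite rmorph0 scale0r => /eqP.
    by rewrite subr_eq0 => /eqP cx; rewrite mulmxA mxtrace_mulC mulmxA cx !mulmxA.
  move/(conj_trace Ht0) => bt0; case/eqP: (mulf_neq0 xih0 tk); rewrite -taut // /tau.
  have -> : D t0 = 0 by rewrite ad_mx_diag //; apply/matrixP => p q; rewrite !mxE bt0 mul0rn.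
  by rewrite mul0mx mxtrace0.
pose c := 2 / xi t0; exists (c *: b k), (c *: t0); split.
- exact: (subspaceZ _ sJ).
- exact: (subspaceZ _ sH).
- by rewrite (bilZr brr).
- by rewrite (bilZl brl) hx // scalerA divfK.
- by move=> h Hh; rewrite (bilZr brr) (bw k Hh) betak // !scalerA mulrC.
Qed.

(** Nonzero iterates would have pairwise distinct eigenvalues mu + k c, more than the m weights of
    J. *)
Lemma ad_nilpotent u t c z mu : L u -> H t -> br t u = c *: u -> c != 0 -> J z -> br t z = mu *: z ->
  exists k, iter k (br u) z = 0.
Proof.
move=> Lu Ht tu c0 Jz tz; apply: contrapT => /forallNP nz.
have Jk k : J (iter k (br u) z) by elim: k => //= k IH; exact: brLJ.
have tk k : br t (iter k (br u) z) = (mu + k%:R * c) *: iter k (br u) z.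
  elim: k => [|k IH] /=; first by rewrite mul0r addr0.
  rewrite jacobi tu IH (bilZl brl) (bilZr brr) -scalerDl -natr1; congr (_ *: _); ring.
have /choice[f fP] k : exists i, beta i t = mu + k%:R * c.
  have [i ci] : exists i, coord (iter k (br u) z) i != 0.
    apply: contrapT => /forallNP c0'; apply: (nz k); rewrite (coordE (Jk k)) big1 // => i _.
    by have := c0' i; move/negP/negPn/eqP => ->; rewrite scale0r.
  exists i; apply: (mulIf ci); have := tk k; rewrite {1 2}(coordE (Jk k)) (bil_sumr brr) scaler_sumr.
  rewrite (eq_bigr (fun i => (beta i t * coord (iter k (br u) z) i) *: b i)); last first.
    by move=> l _; rewrite (bilZr brr) bw // scalerA mulrC.
  rewrite [RHS](eq_bigr (fun i => ((mu + k%:R * c) * coord (iter k (br u) z) i) *: b i)); last first.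
    by move=> l _; rewrite scalerA.
  by move/coord_uniq.
have : injective (fun k : 'I_m.+1 => f k).
  move=> k l fkl; apply/val_inj/eqP; rewrite -(eqr_nat K); apply/eqP/(mulIf c0)/(@addrI _ mu).
  by rewrite -!fP fkl.
by move/leq_card; rewrite !card_ord ltnn.
Qed.

Lemma sl2_highest x y t z mu : L x -> L y -> H t -> t = br x y -> br t y = (- 2) *: y ->
  J z -> z != 0 -> br t z = mu *: z -> br x z = 0 -> exists k : nat, mu = k%:R.
Proof.
move=> Lx Ly Ht tE ty Jz z0 tz xz; have m20 : - 2 != 0 :> K by rewrite oppr_eq0 pnatr_eq0.
have yn : exists k, iter k (br y) z == 0.
  by have [k kP] := ad_nilpotent Ly Ht ty m20 Jz tz; exists k; rewrite kP.
have tk k : br t (iter k (br y) z) = (mu - (2 * k)%:R) *: iter k (br y) z.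
  elim: k => [|k IH] /=; first by rewrite muln0 subr0.
  rewrite jacobi ty IH (bilZl brl) (bilZr brr) -scalerDl mulnS natrD; congr (_ *: _); ring.
have xk k : br x (iter k.+1 (br y) z) = (k.+1%:R * (mu - k%:R)) *: iter k (br y) z.
  elim: k => [|k IH]; first by rewrite /= jacobi -tE tz xz (bil0r brr) addr0 mul1r subr0.
  rewrite iterS jacobi -tE tk IH (bilZr brr) -iterS -scalerDl natrM -!natr1.
  by congr (_ *: _); ring.
case: (ex_minnP yn) => -[|k] /eqP yk kmin; first by move: z0; rewrite -yk eqxx.
exists k; apply/subr0_eq; have := xk k; rewrite yk (bil0r brr) => /esym/eqP.
rewrite scaler_eq0 mulf_eq0 pnatr_eq0 /= => /orP[/eqP//|/kmin]; by rewrite ltnn.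
Qed.

Lemma sl2_integral x y t z mu : L x -> L y -> H t -> t = br x y ->
  br t x = 2 *: x -> br t y = (- 2) *: y -> J z -> z != 0 -> br t z = mu *: z ->
  exists k : int, mu = k%:~R.
Proof.
move=> Lx Ly Ht tE tx ty Jz z0 tz; have t20 : 2 != 0 :> K by rewrite pnatr_eq0.
have xn : exists k, iter k (br x) z == 0.
  by have [k kP] := ad_nilpotent Lx Ht tx t20 Jz tz; exists k; rewrite kP.
have Jk k : J (iter k (br x) z) by elim: k => //= k IH; exact: brLJ.
have tk k : br t (iter k (br x) z) = (mu + (2 * k)%:R) *: iter k (br x) z.
  elim: k => [|k IH] /=; first by rewrite muln0 addr0.
  rewrite jacobi tx IH (bilZl brl) (bilZr brr) -scalerDl mulnS natrD; congr (_ *: _); ring.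
case: (ex_minnP xn) => -[|k] /eqP xk kmin; first by move: z0; rewrite -xk eqxx.
have zk0 : iter k (br x) z != 0 by apply/negP => /kmin; rewrite ltnn.
have [N NE] := sl2_highest Lx Ly Ht tE ty (Jk k) zk0 (tk k) xk.
exists (N%:Z - (2 * k)%N%:Z); apply: (@addIr _ (2 * k)%:R).
by rewrite NE intrB subrK.
Qed.

End WeightBasis.
End Complement.
End Level.

(** * Roots of the limit algebra acting on the module *)

Section StandardDot.
Variables (R : realFieldType) (m : nat).
Definition std_dot (u v : 'rV[R]_m) := \sum_l u 0 l * v 0 l.

Lemma std_dotP : inner_product std_dot.
Proof.
rewrite /std_dot; split=> [u v|u v w|a u v|u u0].
- by apply: eq_bigr => l _; rewrite mulrC.
- by rewrite -big_split /=; apply: eq_bigr => l _; rewrite mxE mulrDl.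
- by rewrite mulr_sumr; apply: eq_bigr => l _; rewrite mxE mulrA.
have ge0 l : 0 <= u 0 l * u 0 l by rewrite -expr2 sqr_ge0.
rewrite lt_def sumr_ge0 // andbT; apply: contra u0 => /eqP E.
apply/eqP/rowP => l; rewrite mxE; apply/eqP.
have : (\sum_l u 0 l * u 0 l == 0) by rewrite E.
rewrite psumr_eq0 // => /allP /(_ l); rewrite mem_index_enum => /(_ isT) /=.
by rewrite mulf_eq0 orbb.
Qed.
End StandardDot.

Section Limit.
Variables (K : numClosedFieldType) (g : lmodType K) (br : g -> g -> g) (Ls Hs : nat -> g -> Prop).
Variables (V : lmodType K) (act : g -> V -> V).
Hypothesis brP : is_lie_bracket br.
Hypothesis limP : root_reductive_limit br Ls Hs.
Hypothesis actP : is_rep br act.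
Local Notation h := (limit_cartan Hs).
Hypothesis wtV : weight_module act h.

Let brl := brl brP.
Let brr := brr brP.
Let actl := actl actP.
Let actr := actr actP.
Let act_br := act_br actP.
Local Notation act0 := (act0 act).

Lemma redL n : reductive br (Ls n). Proof. by case: limP => _ []. Qed.
Lemma carH n : cartan_of br (Ls n) (Hs n). Proof. by case: limP => _ [_ []]. Qed.
Lemma Ls_mono n m x : (n <= m)%N -> Ls n x -> Ls m x.
Proof.
case: limP => _ [_ [_ [LS _]]]; move=> /subnK <-; elim: (m - n)%N => //= k IH Lx.
by rewrite addSn; apply: LS; exact: IH.
Qed.
Lemma Hs_mono n m x : (n <= m)%N -> Hs n x -> Hs m x.
Proof.
case: limP => _ [_ [_ [_ [_ [HS _]]]]]; move=> /subnK <-; elim: (m - n)%N => //= k IH Hx.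
by rewrite addSn; apply: HS; exact: IH.
Qed.
Lemma Ls_exhaust x : exists n, Ls n x. Proof. by case: limP => _ [_ [_ [_ []]]]. Qed.
Lemma root_hom n xi : is_root br (Ls n) (Hs n) xi -> exists xi', is_root br (Ls n.+1) (Hs n.+1) xi' /\
  forall x, root_space br (Ls n) (Hs n) xi x -> root_space br (Ls n.+1) (Hs n.+1) xi' x.
Proof. by case: limP => _ [_ [_ [_ [_ [_ rh]]]]]; apply: rh. Qed.
Lemma Hs_h n x : Hs n x -> h x. Proof. by exists n. Qed.

Lemma wtHs n : weight_module act (Hs n).
Proof.
move=> v; have [k [lam [w [ww vE]]]] := wtV v; exists k, lam, w; split=> // i x Hx.
by apply: ww; exists n.
Qed.

Lemma act0_brh x y : h x -> h y -> act0 (br x y).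
Proof. exact: (act0_brH actP wtV). Qed.

(* Weights are functions on the union of the [Hs n], so that equality of two
   weights is equality on the Cartan subalgebra of the limit. *)
Definition cartan := {x : g | h x}.
Definition to_cartan n x (Hx : Hs n x) : cartan := exist _ x (Hs_h Hx).
Definition weight := (cartan -> K).

(** The eigenvalue equation is imposed only on the action, because the complements J chosen at
    different levels are unrelated while their actions on V can be compared. *)
Definition weight_vector (xi : weight) z :=
  forall (t : cartan) v, act (br (sval t) z) v = xi t *: act z v.

(* Roots whose root space acts by zero are left out: they never move a weight of
   the module, and a complement [J] acting faithfully does not see them. *)
Definition act_root (xi : weight) := xi <> 0 /\ exists2 z, weight_vector xi z & ~ act0 z.

(** Root homomorphisms keep x a root vector at every later level, and an element of the limit Cartan
    subalgebra takes its eigenvalue at a level containing it. *)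
Lemma root_vector_lift n x xi : is_root br (Ls n) (Hs n) xi -> root_space br (Ls n) (Hs n) xi x ->
  exists xi' : weight, forall t, br (sval t) x = xi' t *: x.
Proof.
move=> rxi xx.
have lift N : (n <= N)%N -> exists xi', is_root br (Ls N) (Hs N) xi' /\ root_space br (Ls N) (Hs N) xi' x.
  move=> /subnK <-; elim: (N - n)%N => [|k [xi' [rxi' xx']]]; first by exists xi.
  by have [xi'' [rxi'' sub]] := root_hom rxi'; exists xi''; split=> //; exact: sub.
have /choice[xi' xiE] (t : cartan) : exists c, br (sval t) x = c *: x.
  have [m Hm] := svalP t; have [|xi' [_ [_ xx']]] := lift (maxn n m); first exact: leq_maxl.
  by exists (xi' (sval t)); apply: xx'; apply: Hs_mono Hm; exact: leq_maxr.
by exists xi'.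
Qed.

Record level n (J : g -> Prop) := Level {
  lv_ideal : ideal_of br (Ls n) J;
  lv_faith : forall x, J x -> act0 x -> x = 0;
  lv_dec : forall x, Ls n x -> exists i j, [/\ Ls n i, act0 i, J j & x = i + j] }.

Lemma level_exists n : exists J, level n J.
Proof.
have [J [idJ faithJ decJ]] := faithful_complement actP (redL n).
by exists J.
Qed.

Lemma weight_vector_level n J z xi : level n J -> Ls n z -> weight_vector xi z ->
  exists x, [/\ J x, forall v, act x v = act z v &
    forall t (Ht : Hs n t), br t x = xi (to_cartan Ht) *: x].
Proof.
move=> [idJ faithJ decJ] Lz zxi; have [i [j [Li i0 Jj zE]]] := decJ z Lz.
have jz v : act j v = act z v by rewrite zE (bilDl actl) i0 add0r.
exists j; split=> // t Ht; apply: (eqJ actP idJ faithJ).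
- by apply: (brLJ idJ) => //; exact: (HL (carH n)).
- exact: (subspaceZ _ (sJ idJ)).
move=> v; rewrite (bilZl actl) act_br !jz -(act_br) -(zxi (to_cartan Ht) v) //.
Qed.

Lemma act_decomposition x : exists (k : nat) (z : 'I_k -> g) (xi : 'I_k -> weight),
  (forall i, weight_vector (xi i) (z i)) /\ forall v, act x v = \sum_i act (z i) v.
Proof.
have [n Lx] := Ls_exhaust x; have [J [idJ faithJ decJ]] := level_exists n.
have [m [b [beta [[bJ b_span] _ bw]]]] := weight_basis brP actP (redL n) (carH n) (@wtHs n) idJ faithJ.
have [i [j [Li i0 Jj xE]]] := decJ x Lx; have [c jE] := b_span j Jj.
have /choice[xi xiP] k : exists xi : weight, weight_vector xi (b k).
  (* A basis vector of weight 0 commutes with [Hs n], so it lies in [Hs n] and has weight 0 for the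
     whole limit; any other nonzero one is a root vector and lifts. *)
  have [allz|/existsNP[t /not_implyP[Ht /eqP bt]]] := pselect (forall t, Hs n t -> beta k t = 0).
    exists 0 => t v; rewrite scale0r; apply: act0_brh; first exact: svalP.
    exists n; apply: (H_self (carH n)); first exact: (JL idJ).
    by move=> t' Ht'; rewrite (brC brP) bw // allz // scale0r oppr0.
  have [b0|b0] := eqVneq (b k) 0.
    by exists 0 => t' v; rewrite b0 (bil0r brr) (bil0l actl) scaler0.
  have [||xi xiE] := @root_vector_lift n (b k) (beta k).
  - split; first by exists t.
    by exists (b k); split=> //; split; [exact: (JL idJ) | move=> *; exact: bw].
  - by split; [exact: (JL idJ) | move=> *; exact: bw].
  by exists xi => t' v; rewrite xiE (bilZl actl).
exists m, (fun k => c k *: b k), xi; split.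
  by move=> k t v; rewrite (bilZr brr) !(bilZl actl) xiP !scalerA mulrC.
by move=> v; rewrite xE (bilDl actl) i0 add0r jE (bil_suml actl).
Qed.

Record coroot_data (xi : weight) (x y : g) (t : cartan) := CorootData {
  cr_x : weight_vector xi x;
  cr_x0 : ~ act0 x;
  cr_y : forall t' : cartan, br (sval t') y = - xi t' *: y;
  cr_t : sval t = br x y;
  cr_tx : br (sval t) x = 2 *: x;
  cr_xit : xi t = 2 }.

Lemma coroot_data_act0 xi x y t : coroot_data xi x y t -> ~ act0 (sval t).
Proof.
move=> [_ x0 _ _ tx _] t0; apply: x0 => v.
have := act_br (sval t) x v; rewrite tx (bilZl actl) !t0 (bil0r actr) subrr => /eqP.
by rewrite scaler_eq0 pnatr_eq0 => /eqP.
Qed.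

Lemma act_neq0 z : ~ act0 z -> z != 0.
Proof. by move=> z0; apply/eqP => zE; apply: z0 => v; rewrite zE (bil0l actl). Qed.

Lemma coroot_exists xi : act_root xi -> exists x y t, coroot_data xi x y t.
Proof.
move=> [/eqP xi0 [z zxi z0]].
have [t0 xit0] : exists t0, xi t0 != 0.
  apply: contrapT => /forallNP H; case/eqP: xi0; apply/funext => t.
  by have := H t; move/negP/negPn/eqP.
have [n1 Lz] := Ls_exhaust z; have [n2 Ht0] := svalP t0.
pose n := maxn n1 n2; have {}Lz : Ls n z by apply: Ls_mono Lz; exact: leq_maxl.
have {}Ht0 : Hs n (sval t0) by apply: Hs_mono Ht0; exact: leq_maxr.
have [J lvJ] := level_exists n; have [idJ faithJ decJ] := lvJ.
have [m [b [beta [[bJ b_span] bf bw]]]] := weight_basis brP actP (redL n) (carH n) (@wtHs n) idJ faithJ.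
have /choice[coord coordE] x : exists c : 'I_m -> K, J x -> x = \sum_i c i *: b i.
  by have [/b_span[c ->]|nJ] := pselect (J x); [exists c | exists (fun=> 0)].
have [x [Jx xz hx]] := weight_vector_level lvJ Lz zxi.
have x0 : ~ act0 x by move=> x0; apply: z0 => v; rewrite -xz.
pose xi' t := if pselect (Hs n t) is left Ht then xi (to_cartan Ht) else 0.
have xi'E t (Ht : Hs n t) : xi' t = xi (to_cartan Ht).
  by rewrite /xi'; case: pselect => // Ht'; congr (xi (exist _ _ _)); exact: Prop_irrelevance.
have t0E : to_cartan Ht0 = t0.
  by case: (t0) Ht0 => u hu Hu; congr exist; exact: Prop_irrelevance.
have [|||y [t [Jy Ht tE tx ty]]] := @sl2_triple _ _ _ _ _ _ _ brP actP (redL n) (carH n) (@wtHs n) J idJ faithJ decJ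
  m b beta coord bJ coordE bf bw x xi' Jx _ _ _.
- exact: act_neq0.
- by move=> t Ht; rewrite (xi'E _ Ht) hx.
- by exists (sval t0); split=> //; rewrite (xi'E _ Ht0) t0E.
have tx' : xi' t = 2.
  apply/eqP; rewrite -subr_eq0; have := tx; rewrite hx -(xi'E _ Ht) => /eqP.
  by rewrite -subr_eq0 -scalerBl scaler_eq0 (negPf (act_neq0 x0)) orbF.
have Lx := JL idJ Jx; have Ly := JL idJ Jy.
have xwt : weight_vector xi x.
  by move=> t' v; rewrite act_br !xz -act_br zxi.
have t_act0 : ~ act0 t.
  move=> ta0; apply: x0 => v; have := act_br t x v; rewrite tx (bilZl actl) !ta0 (bil0r actr) subrr => /eqP.
  by rewrite scaler_eq0 pnatr_eq0 => /eqP.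
have y0 : y != 0.
  by apply/eqP => yE; apply: t_act0 => v; rewrite tE yE (bil0r brr) (bil0l actl).
have [||eta etaE] := @root_vector_lift n y (fun t => - xi' t).
- split; last by exists y; split=> //; split.
  by exists (sval t0); split=> //; rewrite (xi'E _ Ht0) t0E oppr_eq0.
- by split.
(* So far y has weight - xi only on [Hs n]. The bracket of t' with t acts by zero, and it also acts
   as [xi t' + eta t'] times t, which does not act by zero. *)
have etaN t' : eta t' = - xi t'.
  apply/eqP; rewrite -addr_eq0 addrC; apply/negPn/negP => s0; apply: t_act0 => v.
  have := act0_brh (svalP t') (Hs_h Ht) v.
  rewrite {1}tE (jacobi brP) etaE (bilDl actl) (bilZr brr) (bilZl actl) -tE.
  rewrite act_br xwt (xwt t' v) (bilZr actr) -scalerBr -act_br -tE -scalerDl => /eqP.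
  by rewrite scaler_eq0 (negPf s0) => /eqP.
exists x, y, (to_cartan Ht); split=> //; first by move=> t'; rewrite etaE etaN.
by rewrite -tx' (xi'E _ Ht).
Qed.

Lemma weight_vector_br xi eta x z : weight_vector xi x -> weight_vector eta z ->
  weight_vector (xi + eta) (br x z).
Proof.
move=> wx wz t v; rewrite (jacobi brP) (bilDl actl).
have -> : act (br (br (sval t) x) z) v = xi t *: act (br x z) v.
  by rewrite act_br (wx t (act z v)) (wx t v) (bilZr actr) -scalerBr -act_br.
have -> : act (br x (br (sval t) z)) v = eta t *: act (br x z) v.
  by rewrite act_br (wz t v) (wz t (act x v)) (bilZr actr) -scalerBr -act_br.
by rewrite -scalerDl.
Qed.

Lemma opp_act_root xi x y t : coroot_data xi x y t -> act_root (- xi).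
Proof.
move=> cr; have [wx x0 hy tE tx xit] := cr; split.
  move=> /(congr1 (fun f : weight => f t)) /eqP.
  by rewrite [X in X == _]/(- xi t) xit oppr_eq0 [X in _ == X]/0 pnatr_eq0.
exists y => [t' v|y0]; first by rewrite hy (bilZl actl).
apply: (coroot_data_act0 cr) => v; rewrite tE act_br !y0 (bil0r actr) subrr //.
Qed.

Lemma common_level (s t : seq g) : (forall u, u \in t -> h u) -> exists N,
  (forall x, x \in s -> Ls N x) /\ (forall u, u \in t -> Hs N u).
Proof.
move=> th; have [N1 sN] : exists N, forall x, x \in s -> Ls N x.
  elim: s => [|x s [N IH]]; first by exists 0%N.
  have [M Lx] := Ls_exhaust x; exists (maxn N M) => y; rewrite inE => /predU1P[->|/IH].
    by apply: Ls_mono Lx; exact: leq_maxr.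
  by apply: Ls_mono; exact: leq_maxl.
have [N2 tN] : exists N, forall u, u \in t -> Hs N u.
  elim: t th => [|x t IH] th; first by exists 0%N.
  have [|N {}IH] := IH; first by move=> u ut; apply: th; rewrite inE ut orbT.
  have [M Hx] := th x (mem_head _ _); exists (maxn N M) => y; rewrite inE => /predU1P[->|/IH].
    by apply: Hs_mono Hx; exact: leq_maxr.
  by apply: Hs_mono; exact: leq_maxl.
exists (maxn N1 N2); split=> [x /sN|u /tN]; [apply: Ls_mono; exact: leq_maxl|].
by apply: Hs_mono; exact: leq_maxr.
Qed.

Definition level_basis n (J : g -> Prop) m (b : 'I_m -> g) (beta : 'I_m -> g -> K)
    (coord : g -> 'I_m -> K) :=
  [/\ level n J, forall i, J (b i), forall x, J x -> x = \sum_i coord x i *: b i,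
     free_family b & forall i h, Hs n h -> br h (b i) = beta i h *: b i].

Lemma level_basis_exists n : exists J m b beta coord, @level_basis n J m b beta coord.
Proof.
have [J lvJ] := level_exists n; have [idJ faithJ decJ] := lvJ.
have [m [b [beta [[bJ b_span] bf bw]]]] := weight_basis brP actP (redL n) (carH n) (@wtHs n) idJ faithJ.
have /choice[coord coordE] x : exists c : 'I_m -> K, J x -> x = \sum_i c i *: b i.
  by have [/b_span[c ->]|nJ] := pselect (J x); [exists c | exists (fun=> 0)].
by exists J, m, b, beta, coord; split.
Qed.

Lemma cartanE n (t : cartan) (Ht : Hs n (sval t)) : to_cartan Ht = t.
Proof. by case: t Ht => u hu Hu; congr exist; exact: Prop_irrelevance. Qed.

Lemma coroot_ty xi x y t : coroot_data xi x y t -> br (sval t) y = (- 2) *: y.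
Proof. by move=> [_ _ hy _ _ xit]; rewrite hy xit. Qed.

Section AtLevel.
Variables (n : nat) (J : g -> Prop) (m : nat) (b : 'I_m -> g) (beta : 'I_m -> g -> K).
Variable coord : g -> 'I_m -> K.
Hypothesis lb : level_basis n J b beta coord.
Variables (xi : weight) (x y : g) (t : cartan).
Hypothesis cr : coroot_data xi x y t.
Hypotheses (Lx : Ls n x) (Ly : Ls n y) (Ht : Hs n (sval t)).

Lemma level_integral z mu : J z -> z != 0 -> br (sval t) z = mu *: z -> exists k : int, mu = k%:~R.
Proof.
have [[idJ faithJ decJ] bJ coordE bf bw] := lb; have [_ _ _ tE tx _] := cr.
move=> Jz z0 tz.
exact: (sl2_integral brP idJ coordE bf bw Lx Ly Ht tE tx (coroot_ty cr) Jz z0 tz).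
Qed.

Lemma level_highest z mu : J z -> z != 0 -> br (sval t) z = mu *: z -> br x z = 0 ->
  exists k : nat, mu = k%:R.
Proof.
have [[idJ faithJ decJ] bJ coordE bf bw] := lb; have [_ _ _ tE tx _] := cr.
move=> Jz z0 tz xz.
exact: (sl2_highest brP idJ coordE bf bw Lx Ly Ht tE (coroot_ty cr) Jz z0 tz xz).
Qed.

(** The integers [rho] are the eigenvalues of ad t on J. Invariance of the trace form gives tau t u
    = xi u * tau x y, so the sum of their squares is tau t t = 2 tau x y, and xi becomes a rational
    combination of the [beta l]. *)
Lemma level_form : exists rho : 'I_m -> int, [/\ forall l, beta l (sval t) = (rho l)%:~R,
  0 < \sum_l rho l ^+ 2 &
  forall u : cartan, Hs n (sval u) ->
    xi u * (\sum_l rho l ^+ 2)%:~R = 2 * \sum_l (rho l)%:~R * beta l (sval u)].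
Proof.
have [lvJ bJ coordE bf bw] := lb; have [idJ faithJ decJ] := lvJ; have [wx x0 hy tE tx xit] := cr.
have b0 l : b l != 0.
  apply/eqP => bl0; have H := bf (fun i => (i == l)%:R).
  have /eqP := oner_neq0 K; apply; have := H _ l; rewrite eqxx; apply; rewrite (bigD1 l) //= bl0 scaler0 add0r big1 // => i il.
  by rewrite (negPf il) scale0r.
have /choice[rho rhoE] l : exists k : int, beta l (sval t) = k%:~R.
  by apply: (level_integral (bJ l) (b0 l)); exact: bw.
pose tau := tr_form br b coord.
have tauE u : Hs n u -> \sum_l (rho l)%:~R * beta l u = tau (sval t) u.
  move=> Hu; rewrite /tau /tr_form (ad_mx_diag (carH n) idJ bJ coordE bf bw Hu) (ad_mx_diag (carH n) idJ bJ coordE bf bw Ht).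
  by rewrite mulmx_diag mxtrace_diag; apply: eq_bigr => l _; rewrite !mxE rhoE.
have tau_t u : Hs n (sval u) -> tau (sval t) (sval u) = xi u * tau x y.
  move=> Hu; rewrite tE /tau (tau_inv brP (redL n) idJ bJ coordE bf Lx Ly (HL (carH n) Hu)).
  rewrite (brC brP y) hy -scaleNr opprK tauC.
  by rewrite (tauZl brP (redL n) idJ bJ coordE bf _ _ Ly) tauC.
have sqE : (\sum_l rho l ^+ 2)%:~R = 2 * tau x y.
  rewrite -xit -tau_t // -tauE // rmorph_sum /=; apply: eq_bigr => l _.
  by rewrite rhoE rmorphXn /= expr2.
exists rho; split=> //; last by move=> u Hu; rewrite tauE // tau_t // sqE mulrCA.
rewrite lt_def sumr_ge0 ?andbT => [|l _]; last exact: sqr_ge0.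
apply/negP; rewrite psumr_eq0 => [/allP rho0|l _]; last exact: sqr_ge0.
have beta0 l : beta l (sval t) = 0.
  have := rho0 l; rewrite mem_index_enum => /(_ isT); rewrite expf_eq0 /= => /eqP r0.
  by rewrite rhoE r0.
have [x' [Jx' xx' tx']] := weight_vector_level lvJ Lx wx.
apply: x0 => v; rewrite -xx'; have := tx' _ Ht; rewrite cartanE xit.
rewrite {1}(coordE _ Jx') (bil_sumr brr) big1 => [/esym/eqP|l _].
  by rewrite scaler_eq0 pnatr_eq0 /= => /eqP ->; rewrite (bil0l actl).
by rewrite (bilZr brr) bw // beta0 scale0r scaler0.
Qed.

End AtLevel.

Lemma pairing_integral eta xi x y t : act_root eta -> coroot_data xi x y t ->
  exists k : int, eta t = k%:~R.
Proof.
move=> [_ [z wz z0]] cr.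
have [|N [LN HN]] := @common_level [:: x; y; z] [:: sval t].
  by move=> u; rewrite inE => /eqP ->; exact: svalP.
have [Lx Ly Lz] : [/\ Ls N x, Ls N y & Ls N z] by split; apply: LN; rewrite !inE eqxx ?orbT.
have Ht : Hs N (sval t) by apply: HN; rewrite mem_head.
have [J [m [b [beta [coord lb]]]]] := level_basis_exists N; have [lvJ _ _ _ _] := lb.
have [z' [Jz' zz' tz']] := weight_vector_level lvJ Lz wz.
apply: (level_integral lb cr Lx Ly Ht Jz').
  by apply: act_neq0 => z'0; apply: z0 => v; rewrite -zz'.
by rewrite (tz' _ Ht) cartanE.
Qed.

(** If the bracket of x and z acted by zero, z would give a highest weight vector of negative weight
    k for the sl2-triple. *)
Lemma pairing_string eta xi x y t k : act_root eta -> coroot_data xi x y t ->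
  eta t = k%:~R -> k < 0 -> act_root (eta + xi) \/ eta + xi = 0.
Proof.
move=> [_ [z wz z0]] cr tk k0; have [wx x0 hy tE tx xit] := cr.
have [->|/eqP s0] := eqVneq (eta + xi) 0; first by right.
left; split=> //; exists (br x z); first by rewrite addrC; exact: weight_vector_br.
move=> xz0.
have [|N [LN HN]] := @common_level [:: x; y; z] [:: sval t].
  by move=> u; rewrite inE => /eqP ->; exact: svalP.
have [Lx Ly Lz] : [/\ Ls N x, Ls N y & Ls N z] by split; apply: LN; rewrite !inE eqxx ?orbT.
have Ht : Hs N (sval t) by apply: HN; rewrite mem_head.
have [J [m [b [beta [coord lb]]]]] := level_basis_exists N; have [lvJ _ _ _ _] := lb.
have [idJ faithJ _] := lvJ.
have [z' [Jz' zz' tz']] := weight_vector_level lvJ Lz wz.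
have z'0 : z' != 0 by apply: act_neq0 => z'0; apply: z0 => v; rewrite -zz'.
have xz' : br x z' = 0.
  apply: faithJ; first exact: (brLJ idJ).
  by move=> v; rewrite act_br !zz' -act_br.
have tz'k : br (sval t) z' = k%:~R *: z' by rewrite (tz' _ Ht) cartanE tk.
have [j] := level_highest lb cr Lx Ly Ht Jz' z'0 tz'k xz'.
by move=> /eqP; rewrite -[j%:R]/(j%:Z%:~R) eqr_int => /eqP kj; move: k0; rewrite kj.
Qed.

(** * Euclidean realization of finitely many roots *)

Section Datum.
Variables (R : realFieldType) (iota : {rmorphism R -> K}).
Variables (crx cry : weight -> g) (crt : weight -> cartan) (pair : weight -> weight -> int).
Hypothesis crP : forall xi, act_root xi -> coroot_data xi (crx xi) (cry xi) (crt xi).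
Hypothesis pairP : forall eta xi, act_root eta -> act_root xi -> eta (crt xi) = (pair eta xi)%:~R.

Definition level_realization n m (beta : 'I_m -> g -> K) (F : seq weight) (r : weight -> 'rV[R]_m) :=
  [/\ forall xi (t : cartan), xi \in F -> Hs n (sval t) -> xi t = \sum_l iota (r xi 0 l) * beta l (sval t),
    forall xi, xi \in F -> 0 < std_dot (r xi) (r xi) &
    forall eta xi, eta \in F -> xi \in F ->
      (pair eta xi)%:~R = 2 * std_dot (r eta) (r xi) / std_dot (r xi) (r xi)].

(** All large levels are provided because weights must be compared at Cartan elements lying outside
    any fixed level. *)
Lemma level_realization_exists (F : seq weight) : (forall xi, xi \in F -> act_root xi) ->
  exists N, forall n, (N <= n)%N -> exists m beta r, @level_realization n m beta F r.
Proof.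
move=> PF.
have [|N [LN HN]] := @common_level (map crx F ++ map cry F) [seq sval (crt xi) | xi <- F].
  by move=> u /mapP[xi _ ->]; exact: svalP.
exists N => n Nn.
have Lx xi : xi \in F -> Ls n (crx xi).
  by move=> xF; apply: (Ls_mono Nn); apply: LN; rewrite mem_cat map_f.
have Ly xi : xi \in F -> Ls n (cry xi).
  by move=> xF; apply: (Ls_mono Nn); apply: LN; rewrite mem_cat map_f ?orbT.
have Ht xi : xi \in F -> Hs n (sval (crt xi)).
  by move=> xF; apply: (Hs_mono Nn); apply: HN; exact: (map_f (fun xi => sval (crt xi))).
have [J [m [b [beta [coord lb]]]]] := level_basis_exists n.
have /choice[rho rhoP] xi : exists rho : 'I_m -> int, xi \in F ->
    [/\ forall l, beta l (sval (crt xi)) = (rho l)%:~R, 0 < \sum_l rho l ^+ 2 &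
      forall u : cartan, Hs n (sval u) ->
        xi u * (\sum_l rho l ^+ 2)%:~R = 2 * \sum_l (rho l)%:~R * beta l (sval u)].
  have [xF|xF] := boolP (xi \in F); last by exists (fun=> 0).
  by have [rho H] := level_form lb (crP (PF _ xF)) (Lx _ xF) (Ly _ xF) (Ht _ xF); exists rho.
pose q xi : R := (\sum_l rho xi l ^+ 2)%:~R.
have q0 xi : xi \in F -> 0 < q xi by move=> /rhoP[_ + _]; rewrite ltr0z.
(* These are the coefficients of xi in the [beta l] supplied by [level_form]: the eigenvalues of the
   coroot, rescaled. *)
pose r xi : 'rV[R]_m := \row_l (2 * (rho xi l)%:~R / q xi).
have iq xi : iota (q xi) = (\sum_l rho xi l ^+ 2)%:~R by rewrite rmorph_int.
have iq0 xi : xi \in F -> iota (q xi) != 0 by move=> xF; rewrite fmorph_eq0 gt_eqF ?q0.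
have rE xi (t : cartan) : xi \in F -> Hs n (sval t) -> xi t = \sum_l iota (r xi 0 l) * beta l (sval t).
  move=> xF Hst; apply: (mulIf (iq0 _ xF)); have [_ _ xE] := rhoP xi xF.
  rewrite {1}iq xE // mulr_sumr mulr_suml; apply: eq_bigr => l _.
  by rewrite mxE fmorph_div rmorphM rmorph_nat rmorph_int; field; rewrite -iq iq0.
have dotE eta xi : std_dot (r eta) (r xi) = 4 / (q eta * q xi) * \sum_l (rho eta l * rho xi l)%:~R.
  rewrite /std_dot mulr_sumr; apply: eq_bigr => l _; rewrite !mxE intrM invfM; ring.
have dotxx xi : xi \in F -> std_dot (r xi) (r xi) = 4 / q xi.
  move=> xF; rewrite dotE.
  have -> : \sum_l (rho xi l * rho xi l)%:~R = q xi.
    by rewrite /q rmorph_sum /=; apply: eq_bigr => l _; rewrite expr2.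
  by have /gt_eqF := q0 _ xF; move: (q xi) => c /negbT c0; field.
exists m, beta, r; split=> // [xi xF|eta xi eF xF]; first by rewrite dotxx // divr_gt0 ?q0.
apply: (fmorph_inj iota); rewrite rmorph_int -(pairP (PF _ eF) (PF _ xF)) (rE _ _ eF (Ht _ xF)) dotxx // dotE.
rewrite (_ : 2 * _ / _ = 2 / q eta * \sum_l (rho eta l * rho xi l)%:~R); last first.
  have /gt_eqF := q0 _ xF; have /gt_eqF := q0 _ eF.
  by move: (q xi) (q eta) (\sum_l _) => c d e /negbT d0 /negbT c0; field; rewrite d0 c0.
have [bE _ _] := rhoP xi xF; rewrite mulr_sumr rmorph_sum /=; apply: eq_bigr => l _.
rewrite bE mxE; have : q eta != 0 by rewrite gt_eqF ?q0.
move: (q eta) => c c0; rewrite !(rmorphM, fmorphV, rmorph_nat, rmorph_int) /=; field.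
by rewrite fmorph_eq0.
Qed.

End Datum.
End Limit.

(** * The root datum of the module *)

Section RootDatumOfModule.
Variables (K : numClosedFieldType) (g : lmodType K) (br : g -> g -> g) (Ls Hs : nat -> g -> Prop).
Variables (V : lmodType K) (act : g -> V -> V).
Hypothesis brP : is_lie_bracket br.
Hypothesis limP : root_reductive_limit br Ls Hs.
Hypothesis actP : is_rep br act.
Hypothesis wtV : weight_module act (limit_cartan Hs).
Variables (R : realFieldType) (iota : {rmorphism R -> K}).

Local Notation weight := (weight Hs).
Local Notation cartan := (cartan Hs).
Local Notation act_root := (@act_root K g br Hs V act).

Section Pairing.
Variables (crx cry : weight -> g) (crt : weight -> cartan) (pair : weight -> weight -> int).
Hypothesis crP : forall xi, act_root xi -> coroot_data br act xi (crx xi) (cry xi) (crt xi).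
Hypothesis pairP : forall eta xi, act_root eta -> act_root xi -> eta (crt xi) = (pair eta xi)%:~R.

Lemma std_dot_suml m (I : Type) (s : seq I) (c : I -> R) (u : I -> 'rV[R]_m) v :
  std_dot (\sum_(i <- s) c i *: u i) v = \sum_(i <- s) c i * std_dot (u i) v.
Proof.
have dP := std_dotP R m; elim: s => [|i s IH]; last first.
  by rewrite !big_cons (dotDl dP) (dotZl dP) IH.
rewrite !big_nil; apply: (@addrI _ (std_dot 0 v)).
by rewrite -(dotDl dP) !addr0.
Qed.

(** A combination orthogonal to each of its own terms has norm 0. The right-hand side involves
    Cartan numbers only, so linear relations do not depend on the level. *)
Lemma comb_realization n m (beta : 'I_m -> g -> K) F r (cs : seq (R * weight)) :
  level_realization iota pair n beta F r -> (forall p, p \in cs -> p.2 \in F) ->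
  \sum_(p <- cs) p.1 *: r p.2 = 0 <->
  (forall eta, eta \in F -> \sum_(p <- cs) p.1 * (pair p.2 eta)%:~R = 0 :> R).
Proof.
move=> [_ r0 rn] csF; set w := \sum_(p <- cs) _.
have dotw eta : eta \in F -> \sum_(p <- cs) p.1 * (pair p.2 eta)%:~R =
    2 / std_dot (r eta) (r eta) * std_dot w (r eta).
  move=> eF; rewrite std_dot_suml mulr_sumr; apply: eq_big_seq => p /csF pF.
  by rewrite rn //; ring.
split=> [w0 eta eF|H].
  by rewrite dotw // w0 /std_dot [X in _ * X]big1 ?mulr0 // => l _; rewrite mxE mul0r.
apply/eqP/negPn/negP => w0; have [_ _ _ dotpos] := std_dotP R m.
have := dotpos _ w0; rewrite {1}/w std_dot_suml big_seq big1 ?ltxx // => p pcs.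
have pF := csF _ pcs; rewrite (dotC (std_dotP R m)).
have /eqP := H _ pF; rewrite dotw // mulf_eq0 mulf_eq0 pnatr_eq0 invr_eq0 /=.
by rewrite gt_eqF ?r0 //= => /eqP ->; rewrite mulr0.
Qed.

(** Coroots give one direction. Conversely a relation among Cartan numbers holds in the realization
    at every large level, and each t belongs to such a level. *)
Lemma comb_weight (F : seq weight) (cs : seq (R * weight)) : (forall xi, xi \in F -> act_root xi) ->
  (forall p, p \in cs -> p.2 \in F) ->
  (forall eta, eta \in F -> \sum_(p <- cs) p.1 * (pair p.2 eta)%:~R = 0 :> R) <->
  (forall t : cartan, \sum_(p <- cs) iota p.1 * p.2 t = 0).
Proof.
move=> PF csF; split=> [H t|H eta eF]; last first.
  apply: (fmorph_inj iota); rewrite rmorph0 rmorph_sum -[RHS](H (crt eta)) /=.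
  apply: eq_big_seq => p /csF pF; rewrite rmorphM rmorph_int pairP //; exact: PF.
have [N lrN] := level_realization_exists brP limP actP wtV iota crP pairP PF.
have [M tM] := svalP t.
have [m [beta [r lr]]] := lrN (maxn N M) (leq_maxl _ _).
have [rE _ _] := lr; have := proj2 (comb_realization lr csF) H => w0.
have HtM : Hs (maxn N M) (sval t) by apply: (Hs_mono limP) tM; exact: leq_maxr.
transitivity (\sum_l iota ((\sum_(p <- cs) p.1 *: r p.2) 0 l) * beta l (sval t)); last first.
  by rewrite w0; apply: big1 => l _; rewrite mxE rmorph0 mul0r.
under [RHS]eq_bigr => l _ do rewrite summxE rmorph_sum mulr_suml.
rewrite exchange_big /=; apply: eq_big_seq => p /csF pF.
rewrite (rE _ _ pF HtM) mulr_sumr; apply: eq_bigr => l _.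
by rewrite mxE rmorphM mulrA.
Qed.

Definition root_line (alpha : weight) (q : R) : weight := fun t => iota q * alpha t.

Lemma root_line1 alpha : root_line alpha 1 = alpha.
Proof. by apply/funext => t; rewrite /root_line rmorph1 mul1r. Qed.

Lemma root_datum_of_pairing alpha : act_root alpha ->
  root_datum act_root pair (root_line alpha).
Proof.
move=> Pa; split; rewrite ?root_line1 //.
- by move=> p q; apply/funext => t; rewrite /root_line rmorphD mulrDl.
- move=> p q /(congr1 (fun f : weight => f (crt alpha))).
  have [_ _ _ _ _ a2] := crP Pa.
  by rewrite /root_line a2 => /(mulIf _) => /(_ (lt0r_neq0 (ltr0Sn _ _))) /fmorph_inj.
- by move=> xi Px; apply: (opp_act_root actP (crP Px)).
- move=> x y Px Py xy0.
  exact: (pairing_string brP limP actP wtV Px (crP Py) (pairP Px Py) xy0).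
- move=> x y z Px Py Pz Pxy; apply/eqP; rewrite -(eqr_int K) intrD -!pairP //.
- move=> F PF aF; have [N lrN] := level_realization_exists brP limP actP wtV iota crP pairP PF.
have [m [beta [r lr]]] := lrN N (leqnn _); have [rE r0 rn] := lr.
exists m, r, (@std_dot R m); split=> //; first exact: std_dotP.
  move=> x y xF yF rxy; pose cs := [:: (1 : R, x); (-1, y)].
  have csF p : p \in cs -> p.2 \in F by rewrite !inE => /orP[] /eqP ->.
  have w0 : \sum_(p <- cs) p.1 *: r p.2 = 0.
    by rewrite !big_cons big_nil /= rxy scale1r scaleN1r addr0 subrr.
  apply/funext => t; apply/eqP; rewrite -subr_eq0; apply/eqP.
  have := proj1 (comb_weight PF csF) (proj1 (comb_realization lr csF) w0) t.
  by rewrite !big_cons big_nil /= rmorphN rmorph1 mul1r mulN1r addr0.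
move=> S q SF; pose cs := (- q, alpha) :: [seq (1 : R, x) | x <- S].
have csF p : p \in cs -> p.2 \in F.
  by rewrite inE => /predU1P[->//|/mapP[x xS ->]]; exact: SF.
have rsum : \sum_(p <- cs) p.1 *: r p.2 = \sum_(x <- S) r x - q *: r (root_line alpha 1).
  rewrite root_line1 big_cons big_map /= scaleNr addrC; congr (_ - _).
  by apply: eq_bigr => x _; rewrite scale1r.
have wsum t : \sum_(p <- cs) iota p.1 * p.2 t = (\sum_(x <- S) x - root_line alpha q) t.
  rewrite big_cons big_map /= rmorphN mulNr addrC; congr (_ - _).
  by rewrite fct_sumE; apply: eq_bigr => x _; rewrite rmorph1 mul1r.
have G := iff_trans (comb_realization lr csF) (comb_weight PF csF).
split=> [/eqP|E].
  rewrite -subr_eq0 -rsum => /eqP /(proj1 G) H; apply/eqP; rewrite -subr_eq0; apply/eqP/funext => t.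
  by rewrite -wsum H.
apply/eqP; rewrite -subr_eq0 -rsum; apply/eqP/(proj2 G) => t.
by rewrite wsum E subrr.
Qed.

End Pairing.

Lemma root_datum_exists alpha : act_root alpha ->
  exists pair, root_datum act_root pair (root_line alpha).
Proof.
move=> Pa.
have [crx crxP] : exists f : weight -> g * g * cartan, forall xi, act_root xi ->
    coroot_data br act xi (f xi).1.1 (f xi).1.2 (f xi).2.
  have /choice[f fP] xi : exists p : g * g * cartan, act_root xi -> coroot_data br act xi p.1.1 p.1.2 p.2.
    have [/(coroot_exists brP limP actP wtV)[x [y [t cr]]]|nP] := pselect (act_root xi).
      by exists (x, y, t).
    have [x [y [t _]]] := coroot_exists brP limP actP wtV Pa.
    by exists (x, y, t).
  by exists f.
have /choice[pair pairP] (p : weight * weight) : exists k : int,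
    act_root p.1 -> act_root p.2 -> p.1 (crx p.2).2 = k%:~R.
  have [P1|P1] := pselect (act_root p.1); last by exists 0.
  have [P2|P2] := pselect (act_root p.2); last by exists 0.
  by have [k kE] := pairing_integral brP limP actP wtV P1 (crxP _ P2); exists k.
exists (fun eta xi => pair (eta, xi)).
exact: (root_datum_of_pairing crxP (fun eta xi => pairP (eta, xi)) Pa).
Qed.

Lemma act_root_degree_bound alpha : act_root alpha ->
  exists C, forall T d, min_zero_sum act_root (root_line alpha) T d -> d <= C.
Proof.
by move=> /root_datum_exists[pair rdP]; exact: (degree_bound rdP).
Qed.

End RootDatumOfModule.

(** * Words in root vectors *)

(** Swaps are assumed only within rearrangements of [ws], which is all that a shortest word
    provides. *)
Lemma swap_invariant (T : eqType) (A : Type) (f : seq T -> A) ws :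
  (forall s1 x y s2, perm_eq (s1 ++ x :: y :: s2) ws ->
    f (s1 ++ x :: y :: s2) = f (s1 ++ y :: x :: s2)) ->
  forall ws', perm_eq ws ws' -> f ws = f ws'.
Proof.
move=> fswap.
have move_head a : forall s x b, perm_eq (s ++ x :: a ++ b) ws ->
    f (s ++ x :: a ++ b) = f (s ++ a ++ x :: b).
  elim: a => [//|y a IH] s x b /= p; rewrite fswap //.
  have := IH (rcons s y) x b; rewrite !cat_rcons; apply.
  rewrite -(permPr p) perm_cat2l; exact: (permEl (perm_catCA [:: y] [:: x] (a ++ b))).
suff H u : forall s u', perm_eq (s ++ u) ws -> perm_eq u u' -> f (s ++ u) = f (s ++ u').
  by move=> ws' p; apply: (H ws [::]).
elim: u => [|x u IH] s u' p uu'; first by rewrite perm_sym in uu'; rewrite (perm_nilP uu').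
have /path.splitPr xu' : x \in u' by rewrite -(perm_mem uu') mem_head.
case: xu' uu' => a b; rewrite perm_sym -cat1s perm_catCA /= perm_cons perm_sym => uab.
have -> : f (s ++ x :: u) = f (s ++ x :: a ++ b).
  by have := IH (rcons s x) (a ++ b); rewrite !cat_rcons; apply.
apply: move_head; rewrite -(permPr p) perm_cat2l perm_cons perm_sym //.
Qed.

Lemma perm_map_lift (T U : eqType) (f : T -> U) s t : perm_eq (map f s) t ->
  exists2 s', perm_eq s s' & map f s' = t.
Proof.
elim: t s => [|y t IH] s p; first by exists s => //; apply/perm_nilP.
have /mapP[x xs yE] : y \in map f s by rewrite (perm_mem p) mem_head.
have sx := perm_to_rem xs; have [|s' ss' <-] := IH (rem x s).
  by have := perm_map f sx; rewrite /= -yE => q; move: p; rewrite (permPl q) perm_cons.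
by exists (x :: s'); rewrite /= ?yE // (permPl sx) perm_cons.
Qed.

Section Words.
Variables (K : numClosedFieldType) (g : lmodType K) (br : g -> g -> g) (Ls Hs : nat -> g -> Prop).
Variables (V : lmodType K) (act : g -> V -> V).
Hypothesis brP : is_lie_bracket br.
Hypothesis limP : root_reductive_limit br Ls Hs.
Hypothesis actP : is_rep br act.
Hypothesis wtV : weight_module act (limit_cartan Hs).
Hypothesis irrV : irreducible act.

Local Notation weight := (weight Hs).
Local Notation cartan := (cartan Hs).
Local Notation act_root := (@act_root K g br Hs V act).
Local Notation weight_vector := (@weight_vector K g br Hs V act).

Let actl := actl actP.
Let actr := actr actP.
Let act_br := act_br actP.

Definition of_weight (mu : weight) v := forall t : cartan, act (sval t) v = mu t *: v.
Definition in_supp (mu : weight) := exists2 v, v != 0 & of_weight mu v.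

Lemma of_weight_act xi z mu v : weight_vector xi z -> of_weight mu v -> of_weight (mu + xi) (act z v).
Proof.
move=> zxi vmu t; have := zxi t v; rewrite act_br vmu (bilZr actr) => /eqP.
by rewrite subr_eq => /eqP ->; rewrite -scalerDl addrC.
Qed.

Definition word_act (ws : seq (weight * g)) v := foldr (fun p u => act p.2 u) v ws.
Definition word (ws : seq (weight * g)) := forall p, p \in ws -> weight_vector p.1 p.2.

Lemma word_act_cat ws ws' v : word_act (ws ++ ws') v = word_act ws (word_act ws' v).
Proof. exact: foldr_cat. Qed.

Lemma word_act0 ws : word_act ws 0 = 0.
Proof. by elim: ws => //= p ws ->; rewrite (bil0r actr). Qed.

Lemma word_actB ws u v : word_act ws (u - v) = word_act ws u - word_act ws v.
Proof. by elim: ws => //= p ws ->; rewrite (bilDr actr) (bilNr actr). Qed.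

Lemma word_cons p ws : word (p :: ws) -> weight_vector p.1 p.2 /\ word ws.
Proof. by move=> W; split=> [|q qw]; apply: W; rewrite inE ?eqxx ?qw ?orbT. Qed.

Lemma word_weight ws mu v : word ws -> of_weight mu v ->
  of_weight (mu + \sum_(p <- ws) p.1) (word_act ws v).
Proof.
move=> + vmu; elim: ws => [|p ws IH] W; first by rewrite big_nil addr0.
have [pw /IH{}IH] := word_cons W; rewrite big_cons addrCA addrC.
exact: of_weight_act.
Qed.

(** Sums of multiples of words applied to v form a nonzero submodule, hence contain u. If all words
    leading to weight mu killed v, u would be a sum of vectors of other weights. *)
Lemma word_exists lam mu v u : v != 0 -> of_weight lam v -> u != 0 -> of_weight mu u ->
  exists ws, [/\ word ws, word_act ws v != 0 & lam + \sum_(p <- ws) p.1 = mu].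
Proof.
move=> v0 vlam u0 umu.
pose P w := exists c ws, word ws /\ w = c *: word_act ws v.
pose S w := exists l : seq V, (forall x, x \in l -> P x) /\ w = \sum_(x <- l) x.
have SD w w' : S w -> S w' -> S (w + w').
  move=> [l [lP ->]] [l' [lP' ->]]; exists (l ++ l'); rewrite big_cat; split=> // x.
  by rewrite mem_cat => /orP[/lP|/lP'].
have S0 : S 0 by exists [::]; rewrite big_nil.
have PS w : P w -> S w.
  by move=> Pw; exists [:: w]; rewrite big_seq1; split=> // x; rewrite inE => /eqP ->.
have Ssum (I : Type) (s : seq I) (F : I -> V) : (forall i, S (F i)) -> S (\sum_(i <- s) F i).
  by move=> SF; elim: s => [|i s IH]; rewrite ?big_nil // big_cons; apply: SD.
have SZ a w : S w -> S (a *: w).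
  move=> [l [lP ->]]; rewrite scaler_sumr; elim: l lP => [|x l IH] lP; first by rewrite big_nil.
  rewrite big_cons; apply: SD; last by apply: IH => y yl; apply: lP; rewrite inE yl orbT.
  have [c [ws [W ->]]] := lP _ (mem_head _ _); apply: PS.
  by exists (a * c), ws; rewrite scalerA.
have Sact x w : S w -> S (act x w).
  move=> [l [lP ->]]; rewrite (bil_sumr actr); elim: l lP => [|y l IH] lP; first by rewrite big_nil.
  rewrite big_cons; apply: SD; last by apply: IH => z zl; apply: lP; rewrite inE zl orbT.
  have [c [ws [W ->]]] := lP _ (mem_head _ _).
  have [k [z [xi [zxi zE]]]] := act_decomposition brP limP actP wtV x.
  rewrite zE; apply: Ssum => i; apply: PS; exists c, ((xi i, z i) :: ws).
  by rewrite (bilZr actr); split=> // p; rewrite inE => /predU1P[->|/W //]; exact: zxi.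
have {S0 SD PS Ssum SZ Sact} [l [lP uE]] : S u.
  have Sv : S v by apply: (PS); exists 1, [::]; rewrite scale1r.
  have [|Sz|SV] := proj2 irrV S; last exact: SV.
    by split=> //; split=> // a x y Sx Sy; apply: SD => //; exact: SZ.
  by move: v0; rewrite (Sz _ Sv) eqxx.
apply: contrapT => /forallNP noword.
have H0 : limit_cartan Hs 0 by exists 0%N; have [[[H0 _] _] _] := carH limP 0.
pose t0 : cartan := exist _ 0 H0.
have /choice[nu nuP] (k : 'I_(size l)) : exists nu : weight,
    of_weight nu l`_k /\ exists t, nu t != mu t.
  have [c [ws [W wE]]] := lP _ (mem_nth 0 (ltn_ord k)).
  have [E|nE] := pselect (lam + \sum_(p <- ws) p.1 = mu); last first.
    exists (lam + \sum_(p <- ws) p.1); split.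
      by move=> t; rewrite wE (bilZr actr) (word_weight W vlam) !scalerA mulrC.
    apply: contrapT => /forallNP H; apply: nE; apply/funext => t.
    by have /negP/negPn/eqP := H t.
  (* This summand is the zero vector, so any function other than mu serves as its weight. *)
  exists (mu + (fun=> 1)); split=> [t|]; last first.
    by exists t0; rewrite -subr_eq0 addrAC subrr add0r oner_neq0.
  rewrite wE; have [->|w0] := eqVneq (word_act ws v) 0; first by rewrite scaler0 (bil0r actr) scaler0.
  by case: (noword ws); split.
move: u0; rewrite [u](@eigen_sum_eq0 _ _ _ (fun t : cartan => act (sval t)) mu _ nu (fun k => l`_k) u) ?eqxx //.
- by move=> k i; have [] := nuP k.
- by move=> k; have [] := nuP k.
- by rewrite uE (big_nth 0) big_mkord.
Qed.
Variables (R : realFieldType) (iota : {rmorphism R -> K}) (alpha : weight).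
Hypothesis Palpha : act_root alpha.
Local Notation line := (root_line iota alpha).

Lemma root_lineD p q : line (p + q) = line p + line q.
Proof. by apply/funext => t; rewrite /root_line rmorphD mulrDl. Qed.
Lemma root_line0 : line 0 = 0.
Proof. by apply/funext => t; rewrite /root_line rmorph0 mul0r. Qed.
Lemma root_lineB p q : line (p - q) = line p - line q.
Proof. by apply/funext => t; rewrite /root_line rmorphB mulrBl. Qed.

Lemma word_letter ws v p : word ws -> word_act ws v != 0 -> p \in ws -> p.1 <> 0 -> act_root p.1.
Proof.
move=> W w0 pw p0; split=> //; exists p.2; first exact: W.
move=> z0; move: w0; case/path.splitPr: pw => a b.
by rewrite word_act_cat /= z0 word_act0 eqxx.
Qed.

Lemma word_reduce ws lam v : word ws -> of_weight lam v -> word_act ws v != 0 ->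
  exists T j, [/\ forall xi, xi \in T -> act_root xi,
    forall S q, submset S T -> S != [::] -> \sum_(x <- S) x <> line q,
    in_supp (lam + line j) & \sum_(p <- ws) p.1 = \sum_(x <- T) x + line j].
Proof.
have [k] := ubnP (size ws); elim: k ws lam v => // k IH ws lam v sz W vlam w0.
have [[ws' [W' sz' s' w'0]]|/forallNP nshort] := pselect (exists ws',
    [/\ word ws', (size ws' < size ws)%N, \sum_(p <- ws') p.1 = \sum_(p <- ws) p.1 &
    word_act ws' v != 0]).
  have [|T [j H]] := IH ws' lam v _ W' vlam w'0; first by rewrite (leq_trans sz').
  by exists T, j; rewrite -s'.
have inv ws' : perm_eq ws ws' -> word_act ws v = word_act ws' v.
  apply: (@swap_invariant _ _ (fun ws => word_act ws v)) => s1 x y s2 p.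
  apply/eqP; rewrite -subr_eq0 !word_act_cat -word_actB /= -act_br.
  apply/negPn/negP => n0; apply: (nshort (s1 ++ (x.1 + y.1, br x.2 y.2) :: s2)); split.
  - have Wp q : q \in s1 ++ x :: y :: s2 -> weight_vector q.1 q.2 by rewrite (perm_mem p); exact: W.
    move=> q; rewrite mem_cat inE => /or3P[qs|/eqP ->|qs].
    + by apply: Wp; rewrite mem_cat qs.
    + by apply: (weight_vector_br brP actP); apply: Wp; rewrite mem_cat !inE eqxx ?orbT.
    + by apply: Wp; rewrite mem_cat !inE qs ?orbT.
  - by rewrite -(perm_size p) !size_cat /= ltn_add2l.
  - by rewrite -(perm_big _ p) !big_cat !big_cons /= !addrA.
  - by rewrite word_act_cat.
pose T := map fst ws.
have [[S [q [/submset_perm[U TU] S0 SE]]]|/forallNP nzs] := pselect (exists S q,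
    [/\ submset S T, S != [::] & \sum_(x <- S) x = line q]); last first.
  exists T, 0; split.
  - move=> xi /mapP[p pw ->]; apply: (word_letter W w0 pw) => p0.
    case: (nzs [:: p.1]); exists 0; split=> //; last by rewrite big_seq1 p0 root_line0.
    by apply: submset1; apply: map_f.
  - by move=> S q sS S0 SE; case: (nzs S); exists q.
  - by exists v; rewrite ?root_line0 ?addr0 //; apply/eqP => vE; rewrite vE word_act0 eqxx in w0.
  - by rewrite big_map root_line0 addr0.
(* The letters with weights in S are moved to the right end, so they act first and carry v to weight
   [lam + line q]; the remaining word is shorter because S is nonempty. *)
have TU' : perm_eq T (U ++ S) by rewrite (permPl TU) perm_catC.
have [ws' p wsE] := perm_map_lift TU'.
pose A := take (size U) ws'; pose B := drop (size U) ws'.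
have AU : map fst A = U by rewrite map_take wsE take_size_cat.
have BS : map fst B = S by rewrite map_drop wsE drop_size_cat.
have Wx q' : q' \in A ++ B -> weight_vector q'.1 q'.2.
  by rewrite cat_take_drop -(perm_mem p); exact: W.
have WA : word A by move=> q' qA; apply: Wx; rewrite mem_cat qA.
have WB : word B by move=> q' qB; apply: Wx; rewrite mem_cat qB orbT.
have AB0 : word_act A (word_act B v) != 0.
  by rewrite -word_act_cat cat_take_drop -inv.
have Bsum : \sum_(p <- B) p.1 = line q by rewrite -SE -BS big_map.
have Bw : of_weight (lam + line q) (word_act B v) by rewrite -Bsum; exact: word_weight.
have szA : (size A < k)%N.
  have szws : size ws = (size U + size S)%N by rewrite -(size_map fst) (perm_size TU') size_cat.
  have : (0 < size S)%N by rewrite lt0n size_eq0.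
  by rewrite -(size_map fst) AU; move: sz; rewrite szws; lia.
have [T' [j [PT' zT' sT' E']]] := IH A _ _ szA WA Bw AB0.
exists T', (q + j); split=> //; first by rewrite root_lineD addrA.
rewrite (perm_big _ p) -(cat_take_drop (size U) ws') big_cat /= -/A -/B E' Bsum.
by rewrite root_lineD -addrA (addrC (line j)).
Qed.

Lemma act_root_opp xi : act_root xi -> act_root (- xi).
Proof.
move=> /(coroot_exists brP limP actP wtV)[x [y [t cr]]].
exact: (opp_act_root actP cr).
Qed.

Definition line_bounded (lam : weight) := exists c, forall q, in_supp (lam + line q) -> q <= c.

Lemma step_bounded xi z lam v : weight_vector xi z -> of_weight lam v -> act z v != 0 ->
  line_bounded lam -> line_bounded (lam + xi).
Proof.
move=> zxi vlam zv0 [c bc].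
have v0 : v != 0 by apply/eqP => vE; rewrite vE (bil0r actr) eqxx in zv0.
have [C CP] := act_root_degree_bound brP limP actP wtV iota Palpha.
have [xi0|/eqP xi0] := eqVneq xi 0; first by exists c; rewrite xi0 addr0.
have Pxi : act_root xi.
  by split=> //; exists z => // z0; rewrite z0 eqxx in zv0.
exists (c + C) => q [u u0 uq].
have [ws [W w0 wE]] := word_exists v0 vlam u0 uq.
have [T [j [PT zT sT sE]]] := word_reduce W vlam w0.
have jc := bc _ sT.
have TE : xi + line q = \sum_(x <- T) x + line j.
  by rewrite -sE; apply: (@addrI _ lam); rewrite wE addrA.
suff : q - j <= C by lra.
apply: (CP (- xi :: T)); split.
- by move=> x; rewrite inE => /predU1P[->|/PT //]; exact: act_root_opp.
- rewrite big_cons root_lineB; apply: (@addrI _ (xi + line j)).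
  by rewrite addrACA subrr add0r addrACA subrr addr0 TE addrC.
(* A part avoiding - xi is a part of T, which is excluded. For a part containing - xi the complement
   lies in T and also sums to a multiple of alpha, so it is empty. *)
move=> S p sS S0 SE; have [xS|xS] := boolP (- xi \in S); last first.
  have sST : submset S T.
    move=> x; have := sS x; rewrite /=; have [<-|//] := eqVneq (- xi) x.
    by move=> _; rewrite (count_memPn xS).
  by case: (zT S p sST S0).
have [U TU] := submset_perm sS; have pS := perm_to_rem xS.
have TU' : perm_eq T (rem (- xi) S ++ U).
  by rewrite -(perm_cons (- xi)) (permPl TU) -cat_cons perm_cat2r.
have [U0|U0] := eqVneq U [::]; first by rewrite (perm_size TU) U0 cats0.
case: (zT U (q - j - p) _ U0); first by apply: (@perm_submset _ _ _ (rem (- xi) S)); rewrite (permPl TU') perm_catC.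
have : \sum_(x <- - xi :: T) x = line (q - j).
  rewrite big_cons root_lineB; apply: (@addrI _ (xi + line j)).
  by rewrite addrACA subrr add0r addrACA subrr addr0 TE addrC.
rewrite (perm_big _ TU) big_cat /= SE => E.
by rewrite (root_lineB (q - j)) -E addrC addrK.
Qed.

Lemma line_bounded_transfer lam mu : in_supp lam -> in_supp mu ->
  line_bounded lam -> line_bounded mu.
Proof.
move=> [v v0 vlam] [u u0 umu] blam.
have [ws [W w0 <-]] := word_exists v0 vlam u0 umu.
elim: ws W w0 => [|p ws IH] W w0; first by rewrite big_nil addr0.
have [pw W'] := word_cons W; rewrite big_cons addrCA addrC.
apply: (step_bounded pw (word_weight W' vlam)) => //; apply: IH => //.
by apply: contraNneq w0 => /= ->; rewrite (bil0r actr).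
Qed.

End Words.

(** * From root lines to shadows *)

Section ActRootOrCentral.
Variables (K : numClosedFieldType) (g : lmodType K) (br : g -> g -> g) (Ls Hs : nat -> g -> Prop).
Variables (V : lmodType K) (act : g -> V -> V).
Hypothesis brP : is_lie_bracket br.
Hypothesis limP : root_reductive_limit br Ls Hs.
Hypothesis actP : is_rep br act.
Hypothesis wtV : weight_module act (limit_cartan Hs).

Lemma supp_in_supp (lam : g -> K) :
  supp act (limit_cartan Hs) lam <-> in_supp act (fun t : cartan Hs => lam (sval t)).
Proof.
split=> [[v [v0 vw]]|[v v0 vw]]; first by exists v => // t; apply: vw; exact: svalP.
by exists v; split=> // x hx; exact: (vw (exist _ x hx)).
Qed.

(* If the root space of [alpha] acts by zero, then so does a Cartan element on
   which [alpha] does not vanish; hence shadows along [alpha] are trivial. *)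
Lemma root_act (alpha : g -> K) : is_root br (fun _ => True) (limit_cartan Hs) alpha ->
  act_root br act (fun t : cartan Hs => alpha (sval t)) \/
  exists2 t : cartan Hs, alpha (sval t) != 0 & act0 act (sval t).
Proof.
move=> [[h0 [hh0 ah0]] [x [x0 [_ xw]]]].
have [ax0|ax0] := pselect (act0 act x); last first.
  left; split.
    by move/(congr1 (fun f : weight Hs => f (exist _ h0 hh0))) => /= E; rewrite E eqxx in ah0.
  by exists x => // t v; rewrite xw ?(bilZl (actl actP)) //; exact: svalP.
right; have [|n [Ln Hn]] := common_level limP [:: x] (t := [:: h0]).
  by move=> u; rewrite inE => /eqP ->.
have {Ln} Lx := Ln x (mem_head _ _); have {Hn} Hh0 := Hn h0 (mem_head _ _).
have [J [idJ faithJ decJ]] := level_exists limP actP n.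
(* The element sought is i. As x acts by zero it commutes with j, so i and h0 have the same bracket
   with x and [alpha i = alpha h0]. *)
have [i [j [Li i0 Jj hE]]] := decJ h0 (HL (carH limP n) Hh0).
have jbr t : act0 act t -> Ls n t -> br t j = 0.
  move=> t0 Lt; apply: faithJ; first exact: (brLJ idJ).
  by move=> v; rewrite (act_br actP) !t0 (bil0r (actr actP)) subrr.
have Hj : Hs n j.
  apply: (H_self (carH limP n)); first exact: (JL idJ).
  move=> t Ht; rewrite (brC brP) (_ : br t j = 0) ?oppr0 //.
  apply: faithJ; first exact: (brLJ idJ (HL (carH limP n) Ht)).
  move=> v; have := act0_brh actP wtV (Hs_h Ht) (Hs_h Hh0) v.
  by rewrite hE (bilDr (brr brP)) (bilDl (actl actP)) (act_br actP t i) !i0 (bil0r (actr actP)) subrr add0r.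
have Hi : Hs n i.
  have [[sH _] _] := carH limP n.
  have -> : i = -1 *: j + h0 by rewrite hE scaleN1r addrCA addNr addr0.
  exact: (proj2 sH).
exists (to_cartan Hi) => //=.
have xE : alpha i *: x = alpha h0 *: x.
  rewrite -(xw _ (Hs_h Hi)) -(xw _ hh0) hE (bilDl (brl brP)).
  by rewrite (brC brP j) jbr // oppr0 addr0.
apply: contraNneq ah0 => ai; move/eqP: xE; rewrite ai scale0r eq_sym scaler_eq0.
by rewrite (negPf x0) orbF.
Qed.
End ActRootOrCentral.

Section Shadow.
Variables (R : realType) (g : lmodType (Cplx R)) (br : g -> g -> g) (Ls Hs : nat -> g -> Prop).
Variables (V : lmodType (Cplx R)) (act : g -> V -> V).
Hypothesis brP : is_lie_bracket br.
Hypothesis limP : root_reductive_limit br Ls Hs.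
Hypothesis actP : is_rep br act.
Hypothesis wtV : weight_module act (limit_cartan Hs).
Hypothesis irrV : irreducible act.
Local Notation h := (limit_cartan Hs).
Local Notation res a := (fun t : cartan Hs => a (sval t)).

Lemma bdd_above_line (lam alpha : g -> Cplx R) :
  bdd_above (shadow_set act h lam alpha) <->
  line_bounded act (real_complex R) (res alpha) (res lam).
Proof.
have E q := supp_in_supp Hs act (fun x => lam x + real_complex R q * alpha x).
by split=> -[c bc]; exists c => q qS; apply: bc; [apply: (proj2 (E q)) | apply: (proj1 (E q))].
Qed.

Lemma shadow_bdd_above_transfer (alpha lam mu : g -> Cplx R) :
  act_root br act (res alpha) \/ (exists2 t : cartan Hs, alpha (sval t) != 0 & act0 act (sval t)) ->
  supp act h lam -> supp act h mu ->
  bdd_above (shadow_set act h lam alpha) -> bdd_above (shadow_set act h mu alpha).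
Proof.
move=> [Pa|[t at0 t0]] /supp_in_supp lamS /supp_in_supp muS.
  move=> /bdd_above_line blam; apply/bdd_above_line.
  exact: (line_bounded_transfer brP limP actP wtV irrV Pa lamS muS blam).
(* Since t acts by zero, evaluating a shadow at t gives q * alpha t = 0, so q = 0. *)
have tS (nu : weight Hs) : in_supp act nu -> nu t = 0.
  move=> [v v0 vw]; have := vw t; rewrite t0 => /esym/eqP.
  by rewrite scaler_eq0 (negPf v0) orbF => /eqP.
move=> _; exists 0 => q /supp_in_supp /tS /eqP /=.
rewrite [mu _](tS _ muS) add0r mulf_eq0 (negPf at0) orbF.
by rewrite fmorph_eq0 => /eqP ->.
Qed.

Lemma bdd_below_opp (lam alpha : g -> Cplx R) :
  bdd_below (shadow_set act h lam alpha) <->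
  bdd_above (shadow_set act h lam (fun x => - alpha x)).
Proof.
have shN a q : shadow_set act h lam a q -> shadow_set act h lam (fun x => - a x) (- q).
  move=> [v [v0 vw]]; exists v; split=> // x hx.
  by rewrite vw // rmorphN mulrNN.
split=> -[b bb]; exists (- b) => q /shN qS; first rewrite lerNr.
  apply: bb; move: qS; congr (shadow_set _ _ _ _ _).
  by apply/funext => x; rewrite opprK.
by rewrite lerNl; exact: bb.
Qed.

Lemma dichotomy (P Q : (g -> Cplx R) -> Prop) :
  (forall lam mu, P lam -> P mu -> Q lam -> Q mu) ->
  (forall lam, P lam -> Q lam) \/ (forall lam, P lam -> ~ Q lam).
Proof.
move=> tr; have [[lam [Pl Ql]]|/forallNP nQ] := pselect (exists lam, P lam /\ Q lam).
  by left=> mu Pm; exact: tr Ql.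
by right=> lam Pl Ql; apply: (nQ lam).
Qed.

End Shadow.

Theorem theorem2 (R : realType) (g : lmodType (Cplx R)) (br : g -> g -> g)
  (Ls Hs : nat -> g -> Prop)
  (V : lmodType (Cplx R)) (act : g -> V -> V) :
  is_lie_bracket br ->
  root_reductive_limit br Ls Hs ->
  is_rep br act ->
  weight_module act (limit_cartan Hs) ->
  irreducible act ->
  forall alpha : g -> Cplx R,
    is_root br (fun _ => True) (limit_cartan Hs) alpha ->
    ((forall lam, supp act (limit_cartan Hs) lam ->
        bdd_above (shadow_set act (limit_cartan Hs) lam alpha)) \/
     (forall lam, supp act (limit_cartan Hs) lam ->
        ~ bdd_above (shadow_set act (limit_cartan Hs) lam alpha))) /\
    ((forall lam, supp act (limit_cartan Hs) lam ->
        bdd_below (shadow_set act (limit_cartan Hs) lam alpha)) \/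
     (forall lam, supp act (limit_cartan Hs) lam ->
        ~ bdd_below (shadow_set act (limit_cartan Hs) lam alpha))).
Proof.
move=> brP limP actP wtV irrV alpha /(root_act brP limP actP wtV) ra.
split; apply: dichotomy => lam mu lamS muS.
  exact: (shadow_bdd_above_transfer brP limP actP wtV irrV ra lamS muS).
move=> /bdd_below_opp blam; apply/bdd_below_opp.
apply: (shadow_bdd_above_transfer brP limP actP wtV irrV _ lamS muS blam).
case: ra => [/(act_root_opp brP limP actP wtV)|[t at0 t0]]; first by left.
by right; exists t; rewrite ?oppr_eq0.
Qed.
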